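(* For every constant $p>3/4$, with probability tending to $1$ as $n\to\infty$, the largest antichain in $\mathcal{P}(n)_p$ is (one of) the middle layer(s). That is, with high probability every maximum-size antichain of $X=\mathcal{P}(n)_p$ is of the form $X\cap\binom{[n]}{\lfloor n/2\rfloor}$ or $X\cap\binom{[n]}{\lceil n/2\rceil}$; in particular $w(X)=\max\{|X\cap\binom{[n]}{\lfloor n/2\rfloor}|,|X\cap\binom{[n]}{\lceil n/2\rceil}|\}$.
   Context: $\mathcal{P}(n)$ is the Boolean lattice: all subsets of $[n]=\{1,\dots,n\}$ ordered by inclusion, and $\binom{[n]}{k}$ denotes the family of $k$-element subsets of $[n]$. For $0\le p\le 1$, $\mathcal{P}(n)_p$ denotes the random subfamily of $\mathcal{P}(n)$ obtained by including each subset independently with probability $p$, viewed as an induced subposet. An antichain is a family of pairwise incomparable sets; $w(X)$ is the size of a largest antichain in $X$. *)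

(* Defs.v *)
From mathcomp Require Import all_boot all_order all_algebra.
From mathcomp Require Import all_classical all_reals all_analysis.
Set Implicit Arguments.
Unset Strict Implicit.
Unset Printing Implicit Defensive.
Import GRing.Theory Num.Theory.
Local Open Scope ring_scope.

(* The ground set [n] is 'I_n, so P(n) is the finite type {set 'I_n} and a
   subfamily of P(n) is an element of {set {set 'I_n}}. *)

Definition layer (n k : nat) : {set {set 'I_n}} :=
  finset (fun A : {set 'I_n} => #|A| == k).

Definition antichain (n : nat) (F : {set {set 'I_n}}) : bool :=
  [forall A in F, forall B in F,
     (A != B) ==> ~~ (A \subset B) && ~~ (B \subset A)].

Definition width (n : nat) (X : {set {set 'I_n}}) : nat :=
  (\max_(F : {set {set 'I_n}} | (F \subset X) && antichain F) #|F|)%N.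

Definition maximum_antichain (n : nat) (X F : {set {set 'I_n}}) : bool :=
  [&& F \subset X, antichain F & #|F| == width X].

(* The law of P(n)_p: [binomial_weight p X] is the probability that the random
   subfamily equals X, each set being kept independently with probability p. *)
Definition binomial_weight (R : realType) (n : nat) (p : R)
    (X : {set {set 'I_n}}) : R :=
  \prod_(A : {set 'I_n}) (if A \in X then p else 1 - p).

Definition Pr (R : realType) (n : nat) (p : R) (E : pred {set {set 'I_n}}) : R :=
  \sum_(X : {set {set 'I_n}} | E X) binomial_weight p X.

Lemma Pr_total (R : realType) (n : nat) (p : R) :
  Pr p (fun _ : {set {set 'I_n}} => true) = 1.
Proof.
rewrite /Pr /binomial_weight.
have := @bigA_distr R 0 1 *%R +%R {set 'I_n} (fun=> p) (fun=> 1 - p).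
rewrite big1 => [H|A _]; last by rewrite /= addrCA subrr addr0.
by rewrite [RHS]H; apply: eq_bigl => X; rewrite inE.
Qed.

(* Main.v *)
Require Import Defs.
From mathcomp Require Import all_boot all_order all_algebra.
From mathcomp Require Import ring lra zify.
From mathcomp Require Import reals sequences.
From mathcomp.analysis Require Import exp.
From mathcomp Require Import fingroup perm.
Set Implicit Arguments.
Unset Strict Implicit.
Unset Printing Implicit Defensive.
Import Order.TTheory GRing.Theory Num.Theory.
Local Open Scope ring_scope.

(* A maximum antichain F of X cannot have its top level k above the middle:
   replacing A = F ∩ [n]^(k) by its lower shadow N in X would enlarge it, since
   |A| < |N|. Far above the middle this expansion follows by counting the edges
   of X between the two levels, because almost every degree in X is close to p
   times its value in P(n). Near the middle, the edges of X leaving A or N are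
   counted as well: if there were few of them, then walks of length six inside X
   (p > 3/4 makes every set have linearly many neighbours in X) show that A is
   close to a family determined by a sparse random subset A0 of A; a union
   bound over the few possible A0 shows that the degrees average correctly on
   all such families, whence |N| > |A|. At the two middle layers of an odd cube
   the edge-isoperimetric inequality for the bipartite middle graph takes over,
   and it applies as long as |A| is at most 6/10 of a layer of X. The case of
   levels below the middle is symmetric under complementation. *)

(** The bound p > 3/4 comes from a union bound: a set near the middle has about n/2 lower
    neighbours, all missing with probability (1 - p)^(n/2), which beats the 2^n sets only if 1 - p <
    1/4. No such bound makes all degrees close to their means; it only limits the exceptional sets
    to boundedly many in each ball of radius two, and this local sparsity has to carry the argument.
    The sampling rate q is forced. A sample of s points costs a factor 2^(n s) in the union bound.
    It determines about s/q sets, whose edges in each of the n directions may err by O(s/(q n)); the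
    tail exponent (s/(q n))^2/(s/q) reaches n s only if q = O(n^-3). The sample must still be felt
    around every set, so q times the size of a neighbourhood must be large. Neighbourhoods of order
    n^2 are too small; sets at distance two, about n^4 of them, suffice. This is why the walks
    exchange two elements; the detour through a deleted element d gives linearly many candidate
    walks with the same end. *)

(** * Expectation over the random family *)

Section Expectation.
Variables (R : realType) (n : nat) (p : R).
Hypotheses (p_ge0 : 0 <= p) (p_le1 : p <= 1).
Local Notation fam := {set {set 'I_n}}.
Implicit Types (X S : fam) (f g : fam -> R).

Definition Ex f : R := \sum_(X : fam) binomial_weight p X * f X.

Lemma binomial_weight_ge0 X : 0 <= binomial_weight p X.
Proof. by apply: prodr_ge0 => A _; case: ifP => _ //; rewrite subr_ge0. Qed.

Lemma Pr_Ex (E : pred fam) : Pr p E = Ex (fun X => (E X)%:R).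
Proof.
rewrite /Pr /Ex big_mkcond; apply: eq_bigr => X _.
by case: (E X); rewrite ?mulr1 ?mulr0.
Qed.

Lemma Ex_cst c : Ex (fun=> c) = c.
Proof.
have := Pr_total n p; rewrite /Pr /Ex -mulr_suml => ->.
by rewrite mul1r.
Qed.

Lemma ler_Ex f g : (forall X, f X <= g X) -> Ex f <= Ex g.
Proof. by move=> h; apply: ler_sum => X _; apply/ler_wpM2l/h/binomial_weight_ge0. Qed.

Lemma eq_Ex f g : f =1 g -> Ex f = Ex g.
Proof. by move=> h; apply: eq_bigr => X _; rewrite h. Qed.

Lemma Ex_sum (I : finType) (P : pred I) (F : I -> fam -> R) :
  Ex (fun X => \sum_(i | P i) F i X) = \sum_(i | P i) Ex (F i).
Proof.
rewrite /Ex exchange_big; apply: eq_bigr => X _.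
by rewrite mulr_sumr.
Qed.

Lemma ExD f g : Ex (fun X => f X + g X) = Ex f + Ex g.
Proof. by rewrite -big_split; apply: eq_bigr => X _; rewrite mulrDr. Qed.

Lemma ExZ c f : Ex (fun X => c * f X) = c * Ex f.
Proof. by rewrite /Ex mulr_sumr; apply: eq_bigr => X _; rewrite mulrCA. Qed.

Lemma Pr_le_Ex (E : pred fam) f :
  (forall X, 0 <= f X) -> (forall X, E X -> 1 <= f X) -> Pr p E <= Ex f.
Proof.
by move=> f0 f1; rewrite Pr_Ex; apply: ler_Ex => X; case: (boolP (E X)) => // /f1.
Qed.

Lemma Pr_mono (E F : pred fam) : (forall X, E X -> F X) -> Pr p E <= Pr p F.
Proof.
move=> h; rewrite !Pr_Ex; apply: ler_Ex => X.
by case: (boolP (E X)) => // /h ->.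
Qed.

Lemma PrC (E : pred fam) : Pr p (predC E) = 1 - Pr p E.
Proof.
rewrite -[1](Pr_total n p) !Pr_Ex /Ex -sumrB; apply: eq_bigr => X _ /=.
by case: (E X); rewrite ?mulr1 ?mulr0 ?subrr ?subr0.
Qed.

Lemma Pr_union (I : finType) (P : pred I) (E : pred fam) (F : I -> pred fam) :
  (forall X, E X -> exists2 i, P i & F i X) ->
  Pr p E <= \sum_(i | P i) Pr p (F i).
Proof.
move=> h; under eq_bigr do rewrite Pr_Ex.
rewrite -Ex_sum; apply: Pr_le_Ex => X; first by apply: sumr_ge0.
move=> /h[i Pi Fi]; rewrite (bigD1 i) //= Fi lerDl.
by apply: sumr_ge0.
Qed.

Lemma Pr_union_le (I : finType) (P : pred I) (E : pred fam) (F : I -> pred fam) b :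
  (forall X, E X -> exists2 i, P i & F i X) ->
  (forall i, P i -> Pr p (F i) <= b) ->
  Pr p E <= #|P|%:R * b.
Proof.
move=> h hb; apply: (le_trans (Pr_union h)).
apply: (@le_trans _ _ (\sum_(i | P i) b)); first exact: ler_sum.
by rewrite sumr_const mulr_natl.
Qed.

Lemma Ex_subset S : Ex (fun X => (S \subset X)%:R) = p ^+ #|S|.
Proof.
have := @bigA_distr R 0 1 *%R +%R {set 'I_n} (fun=> p)
  (fun A => (1 - p) * (A \notin S)%:R).
have -> : \prod_(A : {set 'I_n}) (p + (1 - p) * (A \notin S)%:R) = p ^+ #|S|.
  rewrite (bigID (mem S)) /= [X in _ * X]big1 => [|A /negbTE nAS].
    rewrite mulr1 (eq_bigr (fun=> p)) ?prodr_const // => A AS.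
    by rewrite AS mulr0 addr0.
  by rewrite nAS mulr1 addrC subrK.
move=> ->; apply: eq_big => [X|X _]; first by rewrite inE.
case: (boolP (S \subset X)) => [SX|/subsetPn[A AS AX]].
  rewrite mulr1; apply: eq_bigr => A _; case: ifP => // /negbT AX.
  by rewrite (contra _ AX) ?mulr1 // => /(subsetP SX).
by rewrite mulr0 (bigD1 A) //= (negbTE AX) AS mulr0 mul0r.
Qed.

(** Independence over disjoint blocks. Each factor is [b] plus [a - b] times the indicator of
    [S j \subset X]. After expansion over the sets [K] of selected indices, containing all blocks of
    [K] has probability [p] to the sum of their sizes, and the sum over [K] folds back into a
    product. *)
Lemma Ex_blocks (J : finType) (P : {set J}) (S : J -> fam) (a b : R) :
  {in P &, forall i j, i != j -> [disjoint S i & S j]} ->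
  Ex (fun X => \prod_(j in P) (if S j \subset X then a else b))
  = \prod_(j in P) (b + (a - b) * p ^+ #|S j|).
Proof.
move=> dis.
pose F X j := if j \in P then (a - b) * (S j \subset X)%:R else 0.
pose G j := if j \in P then b else 1.
have e1 X : \prod_(j in P) (if S j \subset X then a else b) =
    \sum_(K : {set J}) \prod_j (if j \in K then F X j else G j).
  have := @bigA_distr R 0 1 *%R +%R J (F X) G => <-.
  rewrite big_mkcond; apply: eq_bigr => j _; rewrite /F /G.
  by case: (j \in P); case: (S j \subset X) => /=; rewrite ?mulr1 ?mulr0 ?add0r ?subrK.
rewrite (eq_Ex e1) Ex_sum.
transitivity (\sum_(K : {set J}) \prod_j
   (if j \in K then (if j \in P then (a - b) * p ^+ #|S j| else 0) else G j)).
  apply: eq_bigr => K _.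
  have [KP|/subsetPn[j jK jP]] := boolP (K \subset P); last first.
    rewrite [RHS](bigD1 j) //= jK (negbTE jP) mul0r.
    rewrite -[RHS](Ex_cst 0); apply: eq_Ex => X.
    by rewrite (bigD1 j) //= jK /F (negbTE jP) mul0r.
  pose c := \prod_j (if j \in K then a - b else G j).
  have e2 X : \prod_j (if j \in K then F X j else G j) =
      c * ((\bigcup_(j in K) S j) \subset X)%:R.
    have -> : ((\bigcup_(j in K) S j) \subset X)%:R
        = \prod_j (if j \in K then (S j \subset X)%:R else 1 : R).
      case: (boolP (_ \subset X)) => [/bigcupsP h|].
        by rewrite big1 // => j _; case: ifP => // /h ->.
      move=> h; apply/esym/eqP/prodf_eq0.
      have /existsP[j /andP[jK nS]] : [exists j, (j \in K) && ~~ (S j \subset X)].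
        apply: contraR h; rewrite negb_exists => /forallP h.
        apply/bigcupsP => j jK; move: (h j).
        by rewrite jK /= negbK.
      by exists j => //; rewrite jK (negbTE nS).
    rewrite /c -big_split; apply: eq_bigr => j _ /=; rewrite /F.
    by case: ifP => [/(subsetP KP) ->|_] //; rewrite mulr1.
  rewrite (eq_Ex e2) ExZ Ex_subset.
  have -> : #|\bigcup_(j in K) S j| = (\sum_(j in K) #|S j|)%N.
    have -> : \bigcup_(j in K) S j = \bigcup_j (if j \in K then S j else set0).
      by rewrite big_mkcond.
    rewrite -sum1_card partition_disjoint_bigcup => [|i j ij].
      rewrite [RHS]big_mkcond; apply: eq_bigr => j _.
      by rewrite sum1_card; case: ifP => // _; rewrite cards0.
    case: ifP => [iK|_]; last by rewrite -setI_eq0 set0I.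
    case: ifP => [jK|_]; last by rewrite -setI_eq0 setI0.
    by apply: dis ij; apply: (subsetP KP).
  rewrite -prodrXr /c big_mkcond [X in _ * X]big_mkcond -big_split /=.
  apply: eq_bigr => j _.
  by case: ifP => [/(subsetP KP) ->|_] //; rewrite mulr1.
have := @bigA_distr R 0 1 *%R +%R J
  (fun j => if j \in P then (a - b) * p ^+ #|S j| else 0) G.
rewrite (eq_bigl predT) => [<-|K]; last by rewrite inE.
rewrite [RHS]big_mkcond; apply: eq_bigr => j _; rewrite /G.
by case: (j \in P) => /=; rewrite ?add0r // addrC.
Qed.

(** Weights can vanish, so values above 1 everywhere do not make the expectation exceed 1 at once.
    But equality would force every weight to be zero, against their total being 1. *)
Lemma Ex_exists_le1 f : Ex f <= 1 -> exists X, f X <= 1.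
Proof.
move=> h; have [/existsP[X hX]|] := boolP [exists X, f X <= 1]; first by exists X.
rewrite negb_exists => /forallP hall.
have lt1 X : 1 < f X by rewrite ltNge; exact: hall.
suff : Ex (fun=> 1) < Ex f by rewrite Ex_cst ltNge h.
have : Ex (fun=> 1) <= Ex f by apply: ler_Ex => X; exact: ltW.
rewrite le_eqVlt => /orP[/eqP e|//].
have /eqP : Ex (fun X => f X - 1) = 0.
  have -> : Ex (fun X => f X - 1) = Ex f - Ex (fun=> 1).
    by rewrite /Ex -sumrB; apply: eq_bigr => X _; rewrite mulrBr.
  by rewrite e subrr.
rewrite /Ex psumr_eq0 => [/allP z|X _]; last first.
  by apply: mulr_ge0; [exact: binomial_weight_ge0|rewrite subr_ge0 ltW].
have w0 X : binomial_weight p X = 0.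
  have := z X; rewrite mem_index_enum => /(_ isT).
  by rewrite mulf_eq0 subr_eq0 (gt_eqF (lt1 X)) orbF => /eqP.
have := Pr_total n p; rewrite /Pr big1 // => /eqP.
by rewrite eq_sym oner_eq0.
Qed.

End Expectation.

(** * Exponential tail bounds *)

Section Tails.
Variables (R : realType) (n : nat) (p : R).
Hypotheses (p_ge0 : 0 <= p) (p_le1 : p <= 1).
Local Notation fam := {set {set 'I_n}}.

(** The exponential is at most 1/(1 - x), and (1 - x)(1 + x + 2x^2) = 1 + x^2(1 - 2x) is at least 1
    for x up to 1/2. *)
Lemma expR_le_quadratic (x : R) : x <= 1 / 2 -> expR x <= 1 + x + 2 * x ^+ 2.
Proof.
move=> hx; have h1 := expR_ge1Dx (- x).
have pos : 0 < 1 - x by lra.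
have : expR x <= (1 - x)^-1.
  by rewrite -[leLHS]invrK -expRN lef_pV2 // posrE // expR_gt0.
move=> /le_trans; apply.
rewrite -[leLHS]mul1r ler_pdivrMr //; nra.
Qed.

Lemma expR_sum_card (J : finType) (P : {set J}) (Q : pred J) (l : R) :
  expR (l * #|[set j in P | Q j]|%:R) = \prod_(j in P) (if Q j then expR l else 1).
Proof.
rewrite -[in RHS]big_mkcondr /= (eq_bigl (fun j => j \in [set j in P | Q j])) => [|j].
  by rewrite prodr_const -expRM_natr.
by rewrite inE.
Qed.

Lemma Ex_exp_blocks (J : finType) (P : {set J}) (S : J -> fam) (l : R) :
  {in P &, forall i j, i != j -> [disjoint S i & S j]} ->
  Ex p (fun X => expR (l * #|[set j in P | S j \subset X]|%:R))
  = \prod_(j in P) (1 + (expR l - 1) * p ^+ #|S j|).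
Proof.
move=> dis; rewrite -Ex_blocks //; apply: eq_Ex => X; exact: expR_sum_card.
Qed.

(** The sign of [l] is left free, so that this single exponential moment bound serves both tails. *)
Lemma Hoeffding_upper (J : finType) (P : {set J}) (S : J -> fam) r (m t l : R) :
  {in P &, forall i j, i != j -> [disjoint S i & S j]} ->
  {in P, forall j, #|S j| = r} ->
  #|P|%:R <= m -> `|l| <= 1 / 2 ->
  Pr p (fun X => t <= l * (#|[set j in P | S j \subset X]|%:R - p ^+ r * #|P|%:R))
    <= expR (- t + 2 * l ^+ 2 * m).
Proof.
move=> dis card hm hl.
pose c := expR (- t - l * (p ^+ r * #|P|%:R)).
have pr0 : 0 <= p ^+ r by exact: exprn_ge0.
have pr1 : p ^+ r <= 1 by exact: exprn_ile1.
apply: le_trans (Pr_le_Ex (f := fun X =>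
  c * expR (l * #|[set j in P | S j \subset X]|%:R)) _ _ _ _) _ => //.
- by move=> X; rewrite mulr_ge0 ?expR_ge0.
- move=> X h; rewrite -expRD -[leLHS]expR0 ler_expR; lra.
rewrite ExZ Ex_exp_blocks //.
have : \prod_(j in P) (1 + (expR l - 1) * p ^+ #|S j|) <=
    \prod_(j in P) expR (l * p ^+ r + 2 * l ^+ 2).
  apply: ler_prod => j jP; rewrite card //; apply/andP; split.
    by have := expR_gt0 l; nra.
  apply: le_trans (expR_ge1Dx _).
  have : expR l <= 1 + l + 2 * l ^+ 2.
    by apply: expR_le_quadratic; move: hl; rewrite ler_norml => /andP[].
  have : 0 <= l ^+ 2 by exact: sqr_ge0.
  nra.
rewrite prodr_const -expRM_natr => h.
apply: (le_trans (ler_wpM2l (expR_ge0 _) h)).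
rewrite -expRD ler_expR.
have : l ^+ 2 * #|P|%:R <= l ^+ 2 * m by apply: ler_wpM2l => //; exact: sqr_ge0.
lra.
Qed.

Lemma Hoeffding (J : finType) (P : {set J}) (S : J -> fam) r (m t : R) :
  {in P &, forall i j, i != j -> [disjoint S i & S j]} ->
  {in P, forall j, #|S j| = r} ->
  #|P|%:R <= m -> 0 < m -> 0 <= t -> t <= 2 * m ->
  Pr p (fun X => t <= `|#|[set j in P | S j \subset X]|%:R - p ^+ r * #|P|%:R|)
    <= 2 * expR (- (t ^+ 2 / (8 * m))).
Proof.
move=> dis card hm m0 t0 tm.
(* This value minimises - l t + 2 l^2 m, with minimum - t^2/(8 m); the assumption t <= 2 m says that
   l <= 1/2. *)
pose l := t / (4 * m).
have l0 : 0 <= l by rewrite divr_ge0 //; lra.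
have l1 : l <= 1 / 2 by rewrite /l ler_pdivrMr; lra.
have el : l * t = t ^+ 2 / (4 * m) by rewrite /l; field; rewrite gt_eqF.
have el2 : 2 * l ^+ 2 * m = t ^+ 2 / (8 * m) by rewrite /l; field; rewrite gt_eqF.
have el3 : t ^+ 2 / (4 * m) = 2 * (t ^+ 2 / (8 * m)) by field; rewrite gt_eqF.
have U1 := @Hoeffding_upper J P S r m (l * t) l dis card hm.
have U2 := @Hoeffding_upper J P S r m (l * t) (- l) dis card hm.
rewrite normrN ger0_norm // sqrrN el2 el el3 in U2.
rewrite ger0_norm // el2 el el3 in U1.
pose F (b : bool) (X : fam) := 2 * (t ^+ 2 / (8 * m)) <=
  (if b then l else - l) * (#|[set j in P | S j \subset X]|%:R - p ^+ r * #|P|%:R).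
apply: (@le_trans _ _ (\sum_(b : bool) Pr p (F b))).
  apply: Pr_union => // X; rewrite ler_normr => /orP[] h.
    by exists true => //; rewrite /F -el3 -el; exact: ler_wpM2l.
  by exists false => //; rewrite /F -el3 -el mulNr -mulrN; exact: ler_wpM2l.
rewrite big_bool /=; move: (U1 l1) (U2 l1); rewrite /F.
set u := expR _ => h1 h2.
have -> : expR (- (t ^+ 2 / (8 * m))) = u.
  by rewrite /u; congr expR; lra.
lra.
Qed.

Lemma Hoeffding_card (U : fam) (m t : R) :
  #|U|%:R <= m -> 0 < m -> 0 <= t -> t <= 2 * m ->
  Pr p (fun X => t <= `|#|U :&: X|%:R - p * #|U|%:R|) <= 2 * expR (- (t ^+ 2 / (8 * m))).
Proof.
move=> hm m0 t0 tm.
have := @Hoeffding _ U (fun A => [set A]) 1 m t _ _ hm m0 t0 tm.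
rewrite expr1 => h; apply: le_trans (h _ _).
- apply: Pr_mono => // X; suff -> : U :&: X = [set j in U | [set j] \subset X] by [].
  by apply/setP => A; rewrite !inE sub1set.
- by move=> A B _ _ AB; rewrite disjoints1 inE.
- by move=> A _; rewrite cards1.
Qed.

Lemma Ex_exp_card (U : fam) (l : R) :
  Ex p (fun X => expR (l * #|X :&: U|%:R)) = (1 + (expR l - 1) * p) ^+ #|U|.
Proof.
rewrite -prodr_const (eq_bigr (fun A => 1 + (expR l - 1) * p ^+ #|[set A]|));
  last by move=> A _; rewrite cards1 expr1.
rewrite -(@Ex_exp_blocks _ U (fun A => [set A]) l); last first.
  by move=> A B _ _ AB; rewrite disjoints1 inE.
apply: eq_Ex => X; congr (expR (_ * _%:R)); apply: eq_card => A.
by rewrite !inE sub1set andbC.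
Qed.

End Tails.

(** * Sets at distance two and the walks leading to them *)

Section Paths.
Variable n : nat.
Local Notation pt := {set 'I_n}.
Local Notation fam := {set {set 'I_n}}.
Local Notation quad := ('I_n * 'I_n * 'I_n * 'I_n)%type.
Implicit Types (X : fam) (u v x y : pt) (t : quad).

Definition deg X x := #|[set i in x | x :\ i \in X]|.

(** The sphere of radius two around [v] in the Johnson graph of its layer; [Bal] is the
    corresponding ball. *)
Definition Gam v : fam := [set u : pt | (#|u| == #|v|) && (#|v :\: u| == 2%N)].

Definition Bal v : fam := [set u : pt | (#|u| == #|v|) && (#|v :\: u| <= 2)%N].

Definition shift v (P Q : pt) : pt := (v :\: P) :|: Q.

(** A quadruple (a1, b1, a2, b2) encodes the exchange of a1, a2 for b1, b2. *)
Definition qa1 t := t.1.1.1.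
Definition qb1 t := t.1.1.2.
Definition qa2 t := t.1.2.
Definition qb2 t := t.2.

Definition shape v t := [&& qa1 t \in v, qa2 t \in v, qa1 t != qa2 t,
  qb1 t \notin v, qb2 t \notin v & qb1 t != qb2 t].

(* A path v, v - d, w2, w3, w4, w5, w6 zigzagging between two consecutive
   layers from v to the set w6 v t in Gam v. *)
Definition w2 v (d : 'I_n) t := shift v [set d] [set qb1 t].
Definition w3 v (d : 'I_n) t := shift v [set d; qa1 t] [set qb1 t].
Definition w4 v (d : 'I_n) t := shift v [set d; qa1 t] [set qb1 t; qb2 t].
Definition w5 v (d : 'I_n) t := shift v [set d; qa1 t; qa2 t] [set qb1 t; qb2 t].
Definition w6 v t := shift v [set qa1 t; qa2 t] [set qb1 t; qb2 t].

(** The other sets of the walk are shared between walks: [v] and [w6 v t] do not depend on [d], and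
    [v :\ d] does not depend on [t]. The four sets kept here form disjoint blocks for distinct [d],
    which gives independence. *)
Definition path4 v d t : fam := [set w2 v d t; w3 v d t; w4 v d t; w5 v d t].

Definition okd X v t d := [&& d != qa1 t, d != qa2 t & path4 v d t \subset X].

Lemma card_shift v (P Q : pt) : P \subset v -> [disjoint Q & v] -> #|P| = #|Q| ->
  #|shift v P Q| = #|v|.
Proof.
move=> Pv Qv e; rewrite cardsU.
have -> : (v :\: P) :&: Q = set0.
  apply/eqP; rewrite setI_eq0 disjoint_sym; apply: disjointWr Qv.
  by rewrite subsetDl.
rewrite cards0 subn0 cardsD (setIidPr Pv) -e subnK //.
exact: subset_leq_card.
Qed.

Lemma shiftK v (P Q : pt) : P \subset v -> [disjoint Q & v] ->
  shift (shift v P Q) Q P = v.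
Proof.
move=> Pv Qv; apply/setP => z; rewrite !inE.
case: (boolP (z \in P)) => [/(subsetP Pv) ->|_]; rewrite ?orbT ?orbF //=.
have [zQ|] := boolP (z \in Q); rewrite /= ?orbF //.
by rewrite (disjointFr Qv zQ).
Qed.

Lemma set2_sub v (a b : 'I_n) : a \in v -> b \in v -> [set a; b] \subset v.
Proof. by move=> av bv; apply/subsetP => z /set2P[] ->. Qed.

Lemma set2_dis v (a b : 'I_n) : a \notin v -> b \notin v -> [disjoint [set a; b] & v].
Proof.
move=> av bv; apply/pred0P => z /=; rewrite !inE.
by case: eqP => [->|_]; rewrite ?(negbTE av) //; case: eqP => // ->; rewrite (negbTE bv).
Qed.

Lemma set1_dis v (a : 'I_n) : a \notin v -> [disjoint [set a] & v].
Proof. by rewrite disjoints1. Qed.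

Lemma Gam_w6 v u : u \in Gam v -> exists2 t, shape v t & w6 v t = u.
Proof.
rewrite inE => /andP[/eqP cu /cards2P[a1 [a2 [a12 e]]]].
have : #|u :\: v| == 2%N.
  by rewrite cardsD cu setIC -cardsD e cards2 a12.
move=> /cards2P[b1 [b2 [b12 e']]].
exists (a1, b1, a2, b2).
  have /setDP[a1v _] : a1 \in v :\: u by rewrite e set21.
  have /setDP[a2v _] : a2 \in v :\: u by rewrite e set22.
  have /setDP[_ b1v] : b1 \in u :\: v by rewrite e' set21.
  have /setDP[_ b2v] : b2 \in u :\: v by rewrite e' set22.
  by rewrite /shape /qa1 /qa2 /qb1 /qb2 /= a1v a2v a12 b1v b2v b12.
rewrite /w6 /qa1 /qa2 /qb1 /qb2 /= -e -e' /shift.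
apply/setP => z; rewrite !inE.
by case: (z \in v); case: (z \in u).
Qed.

Lemma Gam_sym u v : (u \in Gam v) = (v \in Gam u).
Proof.
rewrite !inE eq_sym; case: eqP => //= e.
by rewrite !cardsD e setIC.
Qed.

Lemma Bal_sym u v : (u \in Bal v) = (v \in Bal u).
Proof.
rewrite !inE eq_sym; case: eqP => //= e.
by rewrite !cardsD e setIC.
Qed.

Lemma Gam_Bal v : Gam v \subset Bal v.
Proof. by apply/subsetP => u; rewrite !inE => /andP[-> /eqP ->]. Qed.

Lemma shift_Bal v (P Q : pt) : P \subset v -> [disjoint Q & v] -> #|P| = #|Q| ->
  (#|P| <= 2)%N -> shift v P Q \in Bal v.
Proof.
move=> Pv Qv e P2; rewrite inE card_shift // eqxx /=.
apply: leq_trans P2; apply: subset_leq_card; apply/subsetP => z.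
by rewrite !inE negb_or negb_and negbK => /andP[/andP[/orP[//|/negbTE ->] _]].
Qed.

(* Sets with at most two elements are images of pairs of optional elements. *)
Lemma card_Bal v : (#|Bal v| <= n.+1 ^ 4)%N.
Proof.
pose f (o : option 'I_n) : pt := if o is Some a then [set a] else set0.
pose g (q : option 'I_n * option 'I_n * (option 'I_n * option 'I_n)) :=
  shift v (f q.1.1 :|: f q.1.2) (f q.2.1 :|: f q.2.2).
have small (P : pt) : (#|P| <= 2)%N -> exists o, P = f o.1 :|: f o.2.
  rewrite leq_eqVlt => /orP[/cards2P[a [b [_ ->]]]|]; first by exists (Some a, Some b).
  rewrite ltnS leq_eqVlt => /orP[/cards1P[a ->]|].
    by exists (Some a, None); rewrite /= setU0.
  by rewrite ltnS leqn0 cards_eq0 => /eqP ->; exists (None, None); rewrite /= setU0.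
have sub : Bal v \subset g @: setT.
  apply/subsetP => u; rewrite inE => /andP[/eqP cu c].
  have [o eo] := small _ c.
  have [|o' eo'] := small (u :\: v).
    by rewrite cardsD cu setIC -cardsD.
  apply/imsetP; exists (o, o') => //; rewrite /g /= -eo -eo' /shift.
  by apply/setP => z; rewrite !inE; case: (z \in v); case: (z \in u).
apply: (leq_trans (subset_leq_card sub)); apply: (leq_trans (leq_imset_card _ _)).
by rewrite cardsT !card_prod !card_option !card_ord !expnS expn0 muln1 !mulnA.
Qed.

Lemma card_Gam_ge v : ('C(#|v|, 2) * 'C(n - #|v|, 2) <= #|Gam v|)%N.
Proof.
pose D1 := [set P : pt | P \subset v & #|P| == 2%N].
pose D2 := [set Q : pt | Q \subset ~: v & #|Q| == 2%N].
have -> : ('C(#|v|, 2) * 'C(n - #|v|, 2) = #|setX D1 D2|)%N.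
  rewrite cardsX !cards_draws; congr (_ * 'C(_, 2))%N.
  by rewrite [RHS]cardsCs setCK card_ord.
have inj : {in setX D1 D2 &, injective (fun PQ : pt * pt => shift v PQ.1 PQ.2)}.
  move=> [P Q] [P' Q']; rewrite !inE /= => /andP[/andP[Pv _] /andP[Qv _]].
  move=> /andP[/andP[Pv' _] /andP[Qv' _]] e.
  have h z : (z \in shift v P Q) = (z \in shift v P' Q') by rewrite e.
  congr (_, _); apply/setP => z; move: (h z); rewrite /= !inE.
    have [zv|nzv] := boolP (z \in v).
      have /negbTE -> : z \notin Q by apply: contraL zv => /(subsetP Qv); rewrite inE.
      have /negbTE -> : z \notin Q' by apply: contraL zv => /(subsetP Qv'); rewrite inE.
      by rewrite !andbT !orbF => /negb_inj.
    have /negbTE -> : z \notin P by apply: contra nzv => /(subsetP Pv).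
    by have /negbTE -> : z \notin P' by apply: contra nzv => /(subsetP Pv').
  have [zv|nzv] := boolP (z \in v); last by rewrite !andbF.
  have /negbTE -> : z \notin Q by apply: contraL zv => /(subsetP Qv); rewrite inE.
  by have /negbTE -> : z \notin Q' by apply: contraL zv => /(subsetP Qv'); rewrite inE.
apply: (@leq_trans #|(fun PQ : pt * pt => shift v PQ.1 PQ.2) @: setX D1 D2|).
  by rewrite card_in_imset.
apply: subset_leq_card.
apply/subsetP => u /imsetP[[P Q] /setXP[]]; rewrite !inE /= => /andP[Pv /eqP cP].
move=> /andP[Qv /eqP cQ] ->; rewrite card_shift ?cP ?cQ //; last first.
  by rewrite disjoints_subset.
rewrite eqxx /= -cP; apply/eqP; apply: eq_card => z.
rewrite !inE negb_or negb_and negbK.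
have [zv|nzv] := boolP (z \in v); last first.
  by rewrite !andbF; apply/esym/negbTE; apply: contra nzv => /(subsetP Pv).
rewrite orbF !andbT.
have -> : z \notin Q by apply: contraL zv => /(subsetP Qv); rewrite inE.
by rewrite andbT.
Qed.

Lemma card_fiber_le (S C : finType) (P : {set S}) (Q : {set C}) (f : S -> C) (k : nat) :
  (forall s, s \in P -> f s \in Q) ->
  (forall c, c \in Q -> #|[set s in P | f s == c]| <= k)%N ->
  (#|P| <= #|Q| * k)%N.
Proof.
move=> PQ fib; rewrite -sum1_card (partition_big f (mem Q)) //=.
rewrite -sum_nat_const; apply: leq_sum => c cQ.
apply: leq_trans (fib c cQ); rewrite sum1dep_card; apply: subset_leq_card.
by apply/subsetP => s; rewrite !inE.
Qed.

Lemma card_le_inj (S C : finType) (P : {set S}) (f : S -> C) (k : nat) :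
  {in P &, injective f} -> #|C| = k -> (#|P| <= k)%N.
Proof. by move=> inj <-; rewrite -(card_in_imset inj) max_card. Qed.

End Paths.

(** * Walks that cross a cut *)

Section Crossing.
Variable n : nat.
Local Notation pt := {set 'I_n}.
Local Notation fam := {set {set 'I_n}}.
Local Notation quad := ('I_n * 'I_n * 'I_n * 'I_n)%type.
Local Notation walk := (pt * ('I_n * quad))%type.
Implicit Types (X A B : fam) (u v x y : pt) (t : quad) (s : walk).

Definition valid_walk s := [&& shape s.1 s.2.2, s.2.1 \in s.1,
  s.2.1 != qa1 s.2.2 & s.2.1 != qa2 s.2.2].

(** An edge between two levels is recorded as its upper end together with the element deleted from
    it, whichever way the walk traverses it. *)
Definition walk_edge (j : 'I_6) s : pt * 'I_n :=
  let: (v, (d, t)) := s in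
  match val j with
  | 0 => (v, d) | 1 => (w2 v d t, qb1 t) | 2 => (w2 v d t, qa1 t)
  | 3 => (w4 v d t, qb2 t) | 4 => (w4 v d t, qa2 t) | _ => (w6 v t, d)
  end%N.

(** The edge boundary of A together with B in the bipartite graph that X induces on levels k and k -
    1. *)
Definition cut_edges k X A B : {set pt * 'I_n} :=
  [set e | [&& e.1 \in X, #|e.1| == k, e.2 \in e.1, e.1 :\ e.2 \in X &
     (e.1 \in A) != (e.1 :\ e.2 \in B)]].

(** All constraints between [z] and the data of a walk in boolean form; with them, identities
    between the sets of a walk reduce to a finite case analysis. *)
Lemma walk_facts v d t z : valid_walk (v, (d, t)) ->
  [&& (z == qb1 t) ==> (z \notin v), (z == qb2 t) ==> (z \notin v),
     ~~ ((z == qb1 t) && (z == qb2 t)), (z == qa1 t) ==> (z \in v),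
     (z == qa2 t) ==> (z \in v), (z == d) ==> (z \in v),
     ~~ ((z == qa1 t) && (z == qa2 t)), ~~ ((z == d) && (z == qa1 t)) &
     ~~ ((z == d) && (z == qa2 t))].
Proof.
case/and4P=> /and5P[/= a1v a2v a12 b1v /andP[b2v b12]] dv da1 da2.
repeat (apply/andP; split); try (by apply/implyP => /eqP ->);
  by apply/negP => /andP[/eqP -> /eqP h]; move: h => /eqP; apply/negP.
Qed.

Ltac walk_tac v d t hv z :=
  apply/setP => z; rewrite !inE; move: (walk_facts z hv);
  case: (z == qb1 t); case: (z == qb2 t); case: (z == qa1 t); case: (z == qa2 t);
  case: (z == d); case: (z \in v).

Lemma w2_b1 v d t : valid_walk (v, (d, t)) -> w2 v d t :\ qb1 t = v :\ d.
Proof. by move=> hv; walk_tac v d t hv z. Qed.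

Lemma w2_a1 v d t : valid_walk (v, (d, t)) -> w2 v d t :\ qa1 t = w3 v d t.
Proof. by move=> hv; walk_tac v d t hv z. Qed.

Lemma w4_b2 v d t : valid_walk (v, (d, t)) -> w4 v d t :\ qb2 t = w3 v d t.
Proof. by move=> hv; walk_tac v d t hv z. Qed.

Lemma w4_a2 v d t : valid_walk (v, (d, t)) -> w4 v d t :\ qa2 t = w5 v d t.
Proof. by move=> hv; walk_tac v d t hv z. Qed.

Lemma w6_d v d t : valid_walk (v, (d, t)) -> w6 v t :\ d = w5 v d t.
Proof. by move=> hv; walk_tac v d t hv z. Qed.

Lemma walk_edge_shift (j : 'I_6) v d t : valid_walk (v, (d, t)) ->
  exists P Q, [/\ (walk_edge j (v, (d, t))).1 = shift v P Q, P \subset v,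
    [disjoint Q & v], #|P| = #|Q| & [/\ (#|P| <= 2)%N,
    P = match val j with 0 => set0 | 1 | 2 => [set d] | 3 | 4 => [set d; qa1 t]
        | _ => [set qa1 t; qa2 t] end%N &
    Q = match val j with 0 => set0 | 1 | 2 => [set qb1 t] | _ => [set qb1 t; qb2 t]
        end%N]].
Proof.
case/and4P=> /and5P[/= a1v a2v a12 b1v /andP[b2v b12]] dv da1 da2.
eexists; eexists; split; last by split; [|reflexivity|reflexivity];
  case: j => [[|[|[|[|[|j]]]]] /= _]; rewrite ?cards2 ?cards1 ?cards0 //; case: (_ != _).
all: rewrite /walk_edge; case: j => [[|[|[|[|[|j]]]]] /= _] //=.
all: rewrite ?sub0set ?sub1set ?set2_sub ?set2_dis ?set1_dis ?cards2 ?da1 ?a12 ?b12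
   ?cards1 ?cards0 //.
- by rewrite /shift setD0 setU0.
- by rewrite -setI_eq0 set0I.
Qed.

(** Mark upper sets by membership in [A] and lower sets by membership in [B]. The marks at the two
    ends differ, so they change along some edge; if they agree on the first edge, they change
    later. *)
Lemma crossing k X A B v d t :
  valid_walk (v, (d, t)) -> #|v| = k -> v \in X -> v :\ d \in X ->
  path4 v d t \subset X -> w6 v t \in X -> (v \in A) != (w6 v t \in A) ->
  exists2 j, walk_edge j (v, (d, t)) \in cut_edges k X A B &
    ((v \in A) == (v :\ d \in B)) ==> (j != ord0).
Proof.
move=> hv cv vX vdX /subsetP pX w6X ne.
have w2X : w2 v d t \in X by apply: pX; rewrite !inE eqxx.
have w3X : w3 v d t \in X by apply: pX; rewrite !inE eqxx !orbT.
have w4X : w4 v d t \in X by apply: pX; rewrite !inE eqxx !orbT.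
have w5X : w5 v d t \in X by apply: pX; rewrite !inE eqxx !orbT.
have card_top j : #|(walk_edge j (v, (d, t))).1| == k.
  have [P [Q [-> h1 h2 h3 _]]] := walk_edge_shift j hv.
  by rewrite card_shift // cv.
have in_w2 : (qb1 t \in w2 v d t) && (qa1 t \in w2 v d t).
  rewrite !inE; move: (walk_facts (qb1 t) hv) (walk_facts (qa1 t) hv).
  rewrite !eqxx orbT /=; case: (qa1 t == qb1 t); case: (qa1 t == qb2 t);
    case: (qa1 t == qa2 t); case: (qa1 t == d); case: (qa1 t \in v);
    by rewrite ?orbT ?andbF.
have in_w4 : (qb2 t \in w4 v d t) && (qa2 t \in w4 v d t).
  rewrite !inE; move: (walk_facts (qb2 t) hv) (walk_facts (qa2 t) hv).
  rewrite !eqxx orbT /=; case: (qa2 t == qb1 t); case: (qa2 t == qb2 t);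
    case: (qa2 t == qa1 t); case: (qa2 t == d); case: (qa2 t \in v);
    by rewrite ?orbT ?andbF.
have in_w6 : d \in w6 v t.
  rewrite !inE; move: (walk_facts d hv); rewrite !eqxx /=.
  case: (d == qb1 t); case: (d == qb2 t); case: (d == qa1 t); case: (d == qa2 t);
    by case: (d \in v).
have dv : d \in v by case/and4P: hv.
have [c1|c1] := boolP ((v \in A) == (v :\ d \in B)); last first.
  exists ord0; last by [].
  by rewrite inE /= vX cv eqxx dv vdX c1.
have mem j : (walk_edge j (v, (d, t))).1 \in X ->
   (walk_edge j (v, (d, t))).2 \in (walk_edge j (v, (d, t))).1 ->
   (walk_edge j (v, (d, t))).1 :\ (walk_edge j (v, (d, t))).2 \in X ->
   ((walk_edge j (v, (d, t))).1 \in A) !=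
     ((walk_edge j (v, (d, t))).1 :\ (walk_edge j (v, (d, t))).2 \in B) ->
   walk_edge j (v, (d, t)) \in cut_edges k X A B.
  by move=> h1 h2 h3 h4; rewrite inE h1 card_top h2 h3 h4.
case/andP: in_w2 => b1w a1w; case/andP: in_w4 => b2w a2w.
have [c2|c2] := boolP ((w2 v d t \in A) == (v :\ d \in B)); last first.
  by exists (@Ordinal 6 1 isT) => //; apply: mem; rewrite //= w2_b1.
have [c3|c3] := boolP ((w2 v d t \in A) == (w3 v d t \in B)); last first.
  by exists (@Ordinal 6 2 isT) => //; apply: mem; rewrite //= w2_a1.
have [c4|c4] := boolP ((w4 v d t \in A) == (w3 v d t \in B)); last first.
  by exists (@Ordinal 6 3 isT) => //; apply: mem; rewrite //= w4_b2.
have [c5|c5] := boolP ((w4 v d t \in A) == (w5 v d t \in B)); last first.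
  by exists (@Ordinal 6 4 isT) => //; apply: mem; rewrite //= w4_a2.
have [c6|c6] := boolP ((w6 v t \in A) == (w5 v d t \in B)); last first.
  by exists (@Ordinal 6 5 isT) => //; apply: mem; rewrite //= w6_d.
by move: ne; rewrite (eqP c1) -(eqP c2) (eqP c3) -(eqP c4) (eqP c5) -(eqP c6) eqxx.
Qed.

(** The deleted element of the edge reveals one of the five elements d, a1, b1, a2, b2. Once the
    other four are given, the upper end is a known [shift] of the start, and [shiftK] recovers the
    start. *)
Lemma card_walks_edge (P : {set walk}) (j : 'I_6) e :
  (forall s, s \in P -> valid_walk s) ->
  (#|[set s in P | walk_edge j s == e]| <= n ^ 4)%N.
Proof.
move=> PV.
pose g s : quad := let: (v, (d, (a1, b1, a2, b2))) := s in
  match val j with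
  | 0 => (a1, b1, a2, b2) | 1 => (d, a1, b2, a2) | 2 => (d, b1, a2, b2)
  | 3 => (d, b1, a1, a2) | 4 => (d, b1, a1, b2) | _ => (a1, b1, a2, b2) end%N.
apply: (@card_le_inj _ _ _ g); last first.
  by rewrite !card_prod card_ord !expnS expn0 muln1 !mulnA.
move=> [v [d [[[a1 b1] a2] b2]]] [v' [d' [[[a1' b1'] a2'] b2']]].
rewrite !inE => /andP[/PV hv /eqP e1] /andP[/PV hv' /eqP e2].
rewrite -e2 in e1 => {e2} eg.
have [et ed] : (a1, b1, a2, b2) = (a1', b1', a2', b2') /\ d = d'.
  move: eg; have := congr1 snd e1;
    rewrite /g /walk_edge /qa1 /qa2 /qb1 /qb2 /=.
  by case: (j) => [[|[|[|[|[|i]]]]] /= _] // ? []; intros; subst.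
case: et ed hv' e1 => <- <- <- <- <- hv' e1.
have [P1 [Q1 [f1 s1 r1 _ [_ eP eQ]]]] := walk_edge_shift j hv.
have [P2 [Q2 [f2 s2 r2 _ [_ eP' eQ']]]] := walk_edge_shift j hv'.
have {}e1 := congr1 fst e1; move: e1; rewrite f1 f2 => e1.
rewrite -(shiftK s1 r1) -(shiftK s2 r2) e1.
by rewrite eP eQ eP' eQ'.
Qed.

(** Comparing the upper end with the known start [v] reveals one more element. The first edge is
    excluded because its upper end is [v] itself, which leaves the whole quadruple free. *)
Lemma card_walks_edge_from (P : {set walk}) (j : 'I_6) e v :
  j != ord0 -> (forall s, s \in P -> valid_walk s) ->
  (#|[set s in P | (walk_edge j s == e) && (s.1 == v)]| <= n ^ 3)%N.
Proof.
move=> j0 PV.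
pose g s : 'I_n * 'I_n * 'I_n := let: (v, (d, (a1, b1, a2, b2))) := s in
  match val j with
  | 1 => (a1, b2, a2) | 2 => (d, b2, a2)
  | 3 => (d, a1, a2) | 4 => (d, a1, b2) | _ => (a1, a2, b2) end%N.
apply: (@card_le_inj _ _ _ g); last first.
  by rewrite !card_prod card_ord !expnS expn0 muln1 !mulnA.
move=> [v1 [d [[[a1 b1] a2] b2]]] [v2 [d' [[[a1' b1'] a2'] b2']]].
rewrite !inE => /and3P[/PV hv /eqP e1 /eqP /= ev1] /and3P[/PV hv' /eqP e2 /eqP /= ev2].
move=> eg; subst v1 v2; rewrite -e2 in e1 => {e2}.
have et := congr1 fst e1; have es := congr1 snd e1.
have [dv b1v b12] : [/\ d \in v, b1 \notin v & b1 != b2].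
  by case/and4P: hv => /and5P[_ _ _ ? /andP[_ ?]].
have hb (w w' : pt) (z : 'I_n) : w = w' -> z \in w -> z \in w' by move=> ->.
move: eg et es; rewrite /g /walk_edge /w2 /w4 /w6 /shift /qa1 /qa2 /qb1 /qb2 /=.
case: (j) j0 => [[|[|[|[|[|i]]]]] /= ji] // _.
- move=> [<- <- <-] et es; case: _ / es et => et.
  suff -> : d = d' by [].
  have : d \notin v :\: [set d] :|: [set b1].
    by rewrite !inE eqxx /=; apply: contraNneq b1v => <-.
  by rewrite et !inE dv andbT negb_or negbK => /andP[/eqP].
- move=> [<- <- <-] et es; case: _ / es et => et.
  suff -> : b1 = b1' by [].
  have /(hb _ _ b1 et) : b1 \in v :\: [set d] :|: [set b1] by rewrite !inE eqxx ?orbT.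
  by rewrite !inE (negbTE b1v) ?(negbTE b12) andbF ?orbF => /eqP.
- move=> [<- <- <-] et es; case: _ / es et => et.
  suff -> : b1 = b1' by [].
  have /(hb _ _ b1 et) : b1 \in v :\: [set d; a1] :|: [set b1; b2] by rewrite !inE eqxx ?orbT.
  by rewrite !inE (negbTE b1v) ?(negbTE b12) andbF ?orbF => /eqP.
- move=> [<- <- <-] et es; case: _ / es et => et.
  suff -> : b1 = b1' by [].
  have /(hb _ _ b1 et) : b1 \in v :\: [set d; a1] :|: [set b1; b2] by rewrite !inE eqxx ?orbT.
  by rewrite !inE (negbTE b1v) ?(negbTE b12) andbF ?orbF => /eqP.
- move=> [<- <- <-] et es; case: _ / es et => et.
  suff -> : b1 = b1' by [].
  have /(hb _ _ b1 et) : b1 \in v :\: [set a1; a2] :|: [set b1; b2] by rewrite !inE eqxx ?orbT.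
  by rewrite !inE (negbTE b1v) ?(negbTE b12) andbF ?orbF => /eqP.
Qed.

Lemma card_union_edges (P : {set walk}) (Q : pred 'I_6) (C : {set pt * 'I_n}) K :
  (forall s, s \in P -> exists2 j, Q j & walk_edge j s \in C) ->
  (forall j, Q j -> #|[set s in P | walk_edge j s \in C]| <= K)%N ->
  (#|P| <= 6 * K)%N.
Proof.
move=> h hK.
apply: (@leq_trans (\sum_(j | Q j) #|[set s in P | walk_edge j s \in C]|)).
  apply: (@leq_trans #|\bigcup_(j | Q j) [set s in P | walk_edge j s \in C]|).
    apply: subset_leq_card; apply/subsetP => s sP; have [j Qj hj] := h s sP.
    by apply/bigcupP; exists j => //; rewrite inE sP.
  elim/big_ind2: _ => [|x1 x2 y1 y2 h1 h2|//]; first by rewrite cards0.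
  by apply: leq_trans (leq_add h1 h2); rewrite cardsU leq_subr.
apply: (@leq_trans (\sum_(j | Q j) K)); first exact: leq_sum.
rewrite sum_nat_const leq_mul2r; apply/orP; right.
by rewrite (leq_trans (max_card _)) // card_ord.
Qed.

Lemma card_walks_le (P : {set walk}) (C : {set pt * 'I_n}) :
  (forall s, s \in P -> valid_walk s) ->
  (forall s, s \in P -> exists j, walk_edge j s \in C) ->
  (#|P| <= 6 * (#|C| * n ^ 4))%N.
Proof.
move=> PV h; apply: (@card_union_edges P predT C) => [s /h[j]|j _]; first by exists j.
apply: (@card_fiber_le _ _ _ _ (walk_edge j)) => [s|e eC]; first by rewrite inE => /andP[].
apply: leq_trans (@card_walks_edge P j e PV); apply: subset_leq_card.
by apply/subsetP => s; rewrite !inE => /andP[/andP[-> _] ->].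
Qed.

(** The start of a walk is within distance two of the upper end of each of its edges. If the starts
    are sparse, an edge admits only [K] of them, with n^3 walks each, which saves a factor of order
    n over [card_walks_le]. *)
Lemma card_walks_sparse_le (P : {set walk}) (C : {set pt * 'I_n}) (V : fam) K :
  (forall s, s \in P -> valid_walk s) ->
  (forall s, s \in P -> s.1 \in V) ->
  (forall u, #|Bal u :&: V| <= K)%N ->
  (forall s, s \in P -> exists2 j, j != ord0 & walk_edge j s \in C) ->
  (#|P| <= 6 * (#|C| * (K * n ^ 3)))%N.
Proof.
move=> PV PVV VK h.
apply: (@card_union_edges P (fun j => j != ord0) C) => [s /h[j]|j j0]; first by exists j.
apply: (@card_fiber_le _ _ _ _ (walk_edge j)) => [s|e eC]; first by rewrite inE => /andP[].
apply: (@leq_trans (#|Bal e.1 :&: V| * n ^ 3)); last by rewrite leq_mul2r VK orbT.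
apply: (@card_fiber_le _ _ _ _ (fun s : walk => s.1)) => [[v [d t]]|v vB].
  move=> /setIdP[/setIdP[sP _] /eqP <-].
  have [P1 [Q1 [f1 s1 r1 c1 [c2 _ _]]]] := walk_edge_shift j (PV _ sP).
  by rewrite in_setI (PVV _ sP) andbT Bal_sym f1 shift_Bal.
apply: leq_trans (@card_walks_edge_from P j e v j0 PV); apply: subset_leq_card.
by apply/subsetP => s; rewrite !inE => /andP[/andP[/andP[-> _] ->] ->].
Qed.

End Crossing.

(** * Misplaced sets and their approximation by samples *)

Section Core.
Variables (R : realType) (n k : nat) (p : R).
Local Notation pt := {set 'I_n}.
Local Notation fam := {set {set 'I_n}}.
Local Notation quad := ('I_n * 'I_n * 'I_n * 'I_n)%type.
Local Notation walk := (pt * ('I_n * quad))%type.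
Implicit Types (A B X : fam) (u v x y : pt) (t : quad) (s : walk).

Definition bad (eps : R) X : fam :=
  [set x | eps * n%:R < `|(deg X x)%:R - p * #|x|%:R|].

(* The sets around which the sample A0, taken at rate q from a subfamily of X of
   full local density p, has at least half of its expected density. *)
Definition coarse (q : R) (A0 : fam) : fam :=
  [set v : pt | (#|v| == k) && (q * p * #|Gam v|%:R / 2 <= #|Gam v :&: A0|%:R)].

(** The thresholds 7/8 and 1/8 lie on both sides of the 1/2 in [coarse], so that a sample reads sets
    that are not misplaced correctly with high probability. Also 7/8 is below the 15/16 guaranteed
    for X, so a misplaced set of A still sees p |Gam v|/16 sets of X outside A. *)
Definition misplaced X A : fam :=
  [set v in X | (#|v| == k) &&
     (if v \in A then #|Gam v :&: A|%:R <= 7 / 8 * p * #|Gam v|%:R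
      else p * #|Gam v|%:R / 8 <= #|Gam v :&: A|%:R)].

(** [D] is the set of allowed first deletions: all those that stay in X for general misplaced sets,
    only those that lead into B for bad ones. *)
Definition few_paths (c : R) X v (D : pt) : {set quad} :=
  [set t | shape v t && (#|[set d in D | okd X v t d]|%:R < c * n%:R)].

Definition down_in B x := #|[set i in x | x :\ i \in B]|.

Variables (X A B : fam) (M K3 C0 : nat) (c g eps : R).
Hypotheses (p_gt0 : 0 < p) (p_le1 : p <= 1) (c_gt0 : 0 < c) (g_gt0 : 0 < g).
Hypotheses (n_gt0 : (0 < n)%N) (eps_le1 : eps <= 1) (eps_ge0 : 0 <= eps).
Hypothesis Hdeg : forall x, #|x| = k -> (n <= M * deg X x)%N.
Hypothesis Hgam : forall x, #|x| = k ->
  15 / 16 * p * #|Gam x|%:R <= #|Gam x :&: X|%:R.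
Hypothesis Hpath : forall v (D : pt), #|v| = k -> D \subset v -> (n <= M * #|D|)%N ->
  (#|few_paths c X v D| <= K3 * n ^ 3)%N.
Hypothesis Hbad : forall u, (#|Bal u :&: bad eps X| <= C0)%N.
Hypothesis Hg : forall x, #|x| = k -> g * n%:R ^+ 4 <= #|Gam x|%:R.
Hypothesis Hn3 : (K3 * n ^ 3)%:R <= p * g * n%:R ^+ 4 / 32.
Hypothesis AX : A \subset X.
Hypothesis Ak : forall x, x \in A -> #|x| = k.
Hypothesis BX : B \subset X.

Local Notation CE := (cut_edges k X A B).
Local Notation mis := (misplaced X A).

Definition opposite v : fam := [set u in Gam v | (u \in X) && ((u \in A) != (v \in A))].

Definition walks_from (V : fam) (D : pt -> pt) : {set walk} :=
  [set s | [&& s.1 \in V, shape s.1 s.2.2, w6 s.1 s.2.2 \in opposite s.1 &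
     (s.2.1 \in D s.1) && okd X s.1 s.2.2 s.2.1]].

(** Each start has at least p g n^4/16 quadruples ending in an opposite set. Those with few paths
    number at most K3 n^3, which is at most half of that; each of the others has at least c n usable
    deletions [d]. *)
Lemma card_walks_from (V : fam) (D : pt -> pt) :
  (forall v, v \in V -> [/\ #|v| = k, D v \subset v, (n <= M * #|D v|)%N &
     p * #|Gam v|%:R / 16 <= #|opposite v|%:R]) ->
  #|V|%:R * (p * g * n%:R ^+ 4 / 32 * (c * n%:R)) <= #|walks_from V D|%:R.
Proof.
move=> HV.
have -> : #|walks_from V D| = (\sum_(v in V)
   \sum_(t | shape v t && (w6 v t \in opposite v)) #|[set d in D v | okd X v t d]|)%N.
  rewrite (eq_bigr (fun v => \sum_(dt : 'I_n * quad | [&& shape v dt.2,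
     w6 v dt.2 \in opposite v & (dt.1 \in D v) && okd X v dt.2 dt.1]) 1)%N).
    rewrite -sum1_card pair_big_dep /=; apply: eq_bigl => [[v [d t]]] /=.
    by rewrite !inE.
  move=> v _; transitivity (\sum_(t | shape v t && (w6 v t \in opposite v))
     \sum_(d | (d \in D v) && okd X v t d) 1)%N.
    by apply: eq_bigr => t _; rewrite sum1dep_card.
  rewrite (exchange_big_dep predT) //= pair_big_dep /=.
  by apply: eq_bigl => [[d t]] /=; rewrite -!andbA.
rewrite natr_sum mulr_natl -sumr_const; apply: ler_sum => v vV.
have [vk Dv cD cO] := HV v vV.
pose T1 := [set t | shape v t && (w6 v t \in opposite v)].
pose T2 := few_paths c X v (D v).
have cT1 : (#|opposite v| <= #|T1|)%N.
  apply: leq_trans (leq_imset_card (w6 v) T1); apply: subset_leq_card.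
  apply/subsetP => u uO; have /setIdP[/Gam_w6[t st e] _] := uO.
  by apply/imsetP; exists t => //; rewrite inE st e.
have cT2 : (#|T2| <= K3 * n ^ 3)%N by exact: Hpath.
have cT : p * g * n%:R ^+ 4 / 32 <= #|T1 :\: T2|%:R.
  have : (#|T1| <= #|T1 :\: T2| + #|T2|)%N.
    by rewrite -(cardsID T2 T1) addnC leq_add2l subset_leq_card // subsetIr.
  rewrite -(ler_nat R) natrD => h1.
  have h2 : #|T2|%:R <= p * g * n%:R ^+ 4 / 32.
    by apply: le_trans Hn3; rewrite ler_nat.
  have h3 : p * (g * n%:R ^+ 4) <= p * #|Gam v|%:R by rewrite ler_pM2l // Hg.
  have h4 : #|opposite v|%:R <= #|T1|%:R :> R by rewrite ler_nat.
  lra.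
apply: (@le_trans _ _ (\sum_(t in T1 :\: T2) c * n%:R)).
  rewrite sumr_const -[leRHS]mulr_natl; apply: ler_wpM2r cT.
  by rewrite mulr_ge0 // ltW.
rewrite natr_sum (bigID (fun t => t \in T2) (fun t => shape v t && _)) /=.
rewrite -[leLHS]add0r lerD ?sumr_ge0 //.
rewrite [leRHS](eq_bigl (fun t => t \in T1 :\: T2)) => [|t]; last by rewrite !inE andbC.
apply: ler_sum => t; rewrite !inE => /andP[h /andP[st _]].
by move: h; rewrite st /= -leNgt.
Qed.

Lemma walks_from_cross (V : fam) (D : pt -> pt) s :
  (forall v, v \in V -> [/\ v \in X, #|v| = k, D v \subset v &
    forall d, d \in D v -> v :\ d \in X]) ->
  s \in walks_from V D ->
  valid_walk s /\ exists2 j, walk_edge j s \in CE &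
    ((s.1 \in A) == (s.1 :\ s.2.1 \in B)) ==> (j != ord0).
Proof.
case: s => [v [d t]] HV; rewrite inE /= => /and4P[vV st /setIdP[w6G /andP[w6X ne]]].
move=> /andP[dD /and3P[da1 da2 pX]].
have [vX vk Dv DX] := HV v vV.
have hv : valid_walk (v, (d, t)).
  by rewrite /valid_walk /= st (subsetP Dv) //= da1 da2.
split => //; apply: crossing => //; first exact: DX.
by rewrite eq_sym.
Qed.

Lemma opposite_misplaced v : v \in mis -> p * #|Gam v|%:R / 16 <= #|opposite v|%:R.
Proof.
rewrite inE => /and3P[vX /eqP vk]; case: ifP => vA h.
  have -> : opposite v = (Gam v :&: X) :\: (Gam v :&: A).
    apply/setP => u; rewrite !inE vA.
    by case: (_ && (_ == 2%N)); case: (u \in X); case: (u \in A).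
  rewrite cardsD natrB; last by rewrite subset_leq_card // subsetIl.
  have : #|Gam v :&: X :&: (Gam v :&: A)|%:R <= #|Gam v :&: A|%:R :> R.
    by rewrite ler_nat subset_leq_card // subsetIr.
  have := Hgam vk; lra.
have -> : opposite v = Gam v :&: A.
  apply/setP => u; rewrite !inE vA.
  by case: (boolP (u \in A)) => [/(subsetP AX) ->|_]; rewrite ?andbF ?andbT.
have : 0 <= p * #|Gam v|%:R by rewrite mulr_ge0 // ltW.
lra.
Qed.

(** Double counting: every misplaced set starts about n^5 walks that cross the cut, and a cut edge
    lies on at most 6 n^4 of them. The constant is 6 times 32. *)
Lemma card_misplaced : #|mis|%:R * (p * g * c * n%:R) <= 192 * #|CE|%:R.
Proof.
pose D v := [set i in v | v :\ i \in X].
have HV v : v \in mis -> v \in X /\ #|v| = k by rewrite inE => /and3P[-> /eqP].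
have low : #|mis|%:R * (p * g * n%:R ^+ 4 / 32 * (c * n%:R)) <= #|walks_from mis D|%:R.
  apply: card_walks_from => v vm; have [vX vk] := HV v vm.
  split => //; first by apply/subsetP => i; rewrite inE => /andP[].
    exact: Hdeg.
  exact: opposite_misplaced.
have cross s : s \in walks_from mis D -> valid_walk s /\ exists2 j, walk_edge j s \in CE &
    ((s.1 \in A) == (s.1 :\ s.2.1 \in B)) ==> (j != ord0).
  apply: walks_from_cross => v vm; have [vX vk] := HV v vm.
  split => //; first by apply/subsetP => i; rewrite inE => /andP[].
  by move=> d; rewrite inE => /andP[].
have up : (#|walks_from mis D| <= 6 * (#|CE| * n ^ 4))%N.
  by apply: card_walks_le => s /cross[] // _ [j hj _]; exists j.
have n0 : 0 < n%:R ^+ 4 :> R by rewrite exprn_gt0 // ltr0n.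
have : #|walks_from mis D|%:R <= 6 * (#|CE|%:R * n%:R ^+ 4) :> R.
  by rewrite -natrX -!natrM ler_nat.
move=> /(le_trans low) h.
rewrite -(ler_pM2r n0); lra.
Qed.

Definition bad_misplaced : fam :=
  [set v in mis | (v \in A) && (v \in bad eps X) && (n <= M * down_in B v)%N].

(* Around a bad misplaced set the cut has quadratically many edges, while bad sets
   are scarce. *)
Lemma card_bad_misplaced :
  #|bad_misplaced|%:R * (p * g * c * n%:R ^+ 2) <= 192 * C0%:R * #|CE|%:R.
Proof.
pose D v := [set i in v | v :\ i \in B].
have HV v : v \in bad_misplaced ->
    [/\ v \in X, #|v| = k, v \in mis, v \in A & (n <= M * #|D v|)%N].
  move=> /setIdP[vm /andP[/andP[vA _] h]].
  by have /setIdP[vX /andP[/eqP vk _]] := vm; split.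
have DS v : D v \subset v by apply/subsetP => i; rewrite inE => /andP[].
have low : #|bad_misplaced|%:R * (p * g * n%:R ^+ 4 / 32 * (c * n%:R)) <=
    #|walks_from bad_misplaced D|%:R.
  apply: card_walks_from => v /HV[vX vk vm vA nD]; split => //.
  exact: opposite_misplaced.
have cross s : s \in walks_from bad_misplaced D ->
    valid_walk s /\ exists2 j, walk_edge j s \in CE &
    ((s.1 \in A) == (s.1 :\ s.2.1 \in B)) ==> (j != ord0).
  apply: walks_from_cross => v /HV[vX vk vm vA nD]; split => // d.
  by rewrite inE => /andP[_ /(subsetP BX)].
have up : (#|walks_from bad_misplaced D| <= 6 * (#|CE| * (C0 * n ^ 3)))%N.
  apply: (@card_walks_sparse_le _ _ _ (bad eps X)) => [s /cross[]//|s|//|s sW].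
    by rewrite inE => /andP[/setIdP[_ /andP[/andP[_ ->]]]].
  have [_ [j hj imp]] := cross s sW; exists j => //; apply: (implyP imp).
  move: sW; rewrite inE => /andP[/HV[_ _ _ -> _]] /and3P[_ _ /andP[]].
  by rewrite inE => /andP[_ ->].
have n0 : 0 < n%:R ^+ 3 :> R by rewrite exprn_gt0 // ltr0n.
have : #|walks_from bad_misplaced D|%:R <= 6 * (#|CE|%:R * (C0%:R * n%:R ^+ 3)) :> R.
  by rewrite -natrX -!natrM ler_nat.
move=> /(le_trans low) h.
rewrite -(ler_pM2r n0).
have e1 : n%:R ^+ 2 * n%:R ^+ 3 = n%:R ^+ 4 * n%:R :> R by rewrite -exprD -exprSr.
have -> : #|bad_misplaced|%:R * (p * g * c * n%:R ^+ 2) * n%:R ^+ 3 =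
  32 * (#|bad_misplaced|%:R * (p * g * n%:R ^+ 4 / 32 * (c * n%:R))).
  by rewrite -[LHS]mulrA -[X in _ * X]mulrA e1; field.
lra.
Qed.

Variable q : R.
Hypotheses (q_gt0 : 0 < q) (q_le1 : q <= 1).
Hypothesis Hq : 2 * ((n.+1 ^ 4).+1%:R * n%:R ^+ 2) *
  expR (- (q * p * (g * n%:R ^+ 4) / 64)) <= 1.

Definition misread (A0 : fam) : fam :=
  [set v in X | [&& #|v| == k, v \notin mis & (v \in A) != (v \in coarse q A0)]].

(** Chernoff bound with parameter 1/8 of either sign: a mean of at least 7/8 or at most 1/8 of q p
    |Gam v| has to cross the threshold 1/2. The exponents obtained are -5/256 and -11/256 times q p
    |Gam v|, both below -1/64. *)
Lemma Pr_misread v : v \in X -> #|v| = k -> v \notin mis ->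
  Pr q (fun Y : fam => (v \in A) != (v \in coarse q (A :&: Y))) <=
    expR (- (q * p * #|Gam v|%:R / 64)).
Proof.
move=> vX vk; rewrite inE vX vk eqxx /= => hm.
have q0 := ltW q_gt0.
pose U := Gam v :&: A; pose th := q * p * #|Gam v|%:R / 2.
have eU Y : #|Gam v :&: (A :&: Y)| = #|Y :&: U| by rewrite setIA setIC.
have e1 l Y : expR (l * #|Y :&: U|%:R) = expR (l * #|Gam v :&: (A :&: Y)|%:R) by rewrite eU.
have pow l : (1 + (expR l - 1) * q) ^+ #|U| <= expR ((expR l - 1) * (q * #|U|%:R)).
  rewrite mulrA expRM_natr lerXn2r ?nnegrE ?expR_ge0 ?expR_ge1Dx //.
  have : 0 <= expR l * q by rewrite mulr_ge0 ?expR_ge0.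
  move: q_le1; lra.
have qU : 0 <= q * #|U|%:R by rewrite mulr_ge0.
move: hm; case: ifP => vA hm.
  have hU : 7 / 8 * (q * p * #|Gam v|%:R) <= q * #|U|%:R.
    by rewrite -ltNge in hm; have := ler_wpM2l q0 (ltW hm); rewrite -/U; lra.
  apply: (@le_trans _ _ (Ex q (fun Y : fam =>
     expR (th / 8) * expR (- (1 / 8) * #|Y :&: U|%:R)))).
    apply: Pr_le_Ex => // Y; first by rewrite mulr_ge0 ?expR_ge0.
    rewrite inE vk eqxx /= -ltNge eU => h.
    rewrite -expRD -[leLHS]expR0 ler_expR; rewrite -/th in h; lra.
  rewrite ExZ Ex_exp_card; apply: (le_trans (ler_wpM2l (expR_ge0 _) (pow _))).
  rewrite -expRD ler_expR.
  have h8 : expR (- (1 / 8)) <= 1 + - (1 / 8) + 2 * (- (1 / 8)) ^+ 2 :> R.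
    by apply: expR_le_quadratic; lra.
  have : (expR (- (1 / 8)) - 1) * (q * #|U|%:R) <= - (3 / 32) * (q * #|U|%:R).
    by apply: ler_wpM2r => //; lra.
  have : 0 <= q * p * #|Gam v|%:R by rewrite mulr_ge0 // mulr_ge0 // ltW.
  rewrite /th; lra.
have hU : q * #|U|%:R <= q * p * #|Gam v|%:R / 8.
  by rewrite -ltNge in hm; have := ler_wpM2l q0 (ltW hm); rewrite -/U; lra.
apply: (@le_trans _ _ (Ex q (fun Y : fam =>
   expR (- (th / 8)) * expR (1 / 8 * #|Y :&: U|%:R)))).
  apply: Pr_le_Ex => // Y; first by rewrite mulr_ge0 ?expR_ge0.
  rewrite inE vk eqxx /= negbK eU => h.
  rewrite -expRD -[leLHS]expR0 ler_expR; rewrite -/th in h; lra.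
rewrite ExZ Ex_exp_card; apply: (le_trans (ler_wpM2l (expR_ge0 _) (pow _))).
rewrite -expRD ler_expR.
have h8 : expR (1 / 8) <= 1 + 1 / 8 + 2 * (1 / 8) ^+ 2 :> R.
  by apply: expR_le_quadratic; lra.
have : (expR (1 / 8) - 1) * (q * #|U|%:R) <= 5 / 32 * (q * #|U|%:R).
  by apply: ler_wpM2r => //; lra.
have : 0 <= q * p * #|Gam v|%:R by rewrite mulr_ge0 // mulr_ge0 // ltW.
rewrite /th; lra.
Qed.

(** A set outside A can be misread only if it sees a sample point, so the candidates number O(n^4
    |A|) instead of 2^n. This is what allows an error proportional to |A|. *)
Lemma misread_sub (Y : fam) :
  misread (A :&: Y) \subset A :|: \bigcup_(u in A) Gam u.
Proof.
apply/subsetP => v /setIdP[vX /and3P[/eqP vk _]]; rewrite in_setU.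
case: (v \in A) => //=; rewrite inE vk eqxx /= negbK => h.
have : 0 < #|Gam v :&: (A :&: Y)|%:R :> R.
  apply: lt_le_trans h; rewrite divr_gt0 // !mulr_gt0 //.
  by apply: lt_le_trans (Hg vk); rewrite mulr_gt0 // exprn_gt0 // ltr0n.
rewrite ltr0n card_gt0 => /set0Pn[u /setIP[uv /setIP[uA _]]].
by apply/bigcupP; exists u => //; rewrite Gam_sym.
Qed.

Lemma sampling : exists A0 : fam, [/\ A0 \subset A, #|A0|%:R <= 2 * q * #|A|%:R &
  #|misread A0|%:R * n%:R ^+ 2 <= #|A|%:R :> R].
Proof.
have [A0|A0] := eqVneq A set0.
  exists set0; rewrite sub0set A0 cards0 mulr0; split => //.
  rewrite (_ : misread _ = set0) ?cards0 ?mul0r //.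
  apply/eqP; rewrite -subset0; have := misread_sub set0.
  by rewrite setI0 [X in _ \subset A :|: X]big1 => [|u]; rewrite A0 ?setU0 // inE.
have a0 : 0 < #|A|%:R :> R by rewrite ltr0n card_gt0.
have n0 : 0 < n%:R ^+ 2 :> R by rewrite exprn_gt0 // ltr0n.
pose Z := A :|: \bigcup_(u in A) Gam u.
have cZ : #|Z|%:R <= #|A|%:R * (n.+1 ^ 4).+1%:R :> R.
  rewrite -natrM ler_nat mulnS; apply: leq_trans (_ : #|A| + #|\bigcup_(u in A) Gam u| <= _)%N.
    by rewrite cardsU leq_subr.
  rewrite leq_add2l -sum_nat_const.
  elim/big_ind2: _ => [|x1 x2 y1 y2 h1 h2|u _]; first by rewrite cards0.
    by apply: leq_trans (leq_add h1 h2); rewrite cardsU leq_subr.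
  by apply: leq_trans (card_Bal u); rewrite subset_leq_card // Gam_Bal.
pose e := expR (- (q * p * (g * n%:R ^+ 4) / 64)).
have hq : 2 * ((n.+1 ^ 4).+1%:R * n%:R ^+ 2) * e <= 1 := Hq.
(* Both requirements are normalised so that each has expectation at most 1/2; a family where the sum
   is at most 1 meets both. *)
pose f (Y : fam) := (2 * q * #|A|%:R)^-1 * #|A :&: Y|%:R +
   (n%:R ^+ 2 / #|A|%:R) * #|misread (A :&: Y)|%:R.
have q0 := ltW q_gt0.
have [Y hY] : exists Y, f Y <= 1.
  apply: (@Ex_exists_le1 _ _ q) => //; rewrite /f ExD !ExZ.
  have -> : Ex q (fun Y : fam => #|A :&: Y|%:R) = q * #|A|%:R.
    rewrite (eq_Ex _ (g := fun Y : fam => \sum_(u in A) ([set u] \subset Y)%:R)).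
      rewrite Ex_sum (eq_bigr (fun=> q)) ?sumr_const ?mulr_natr // => u _.
      by rewrite Ex_subset cards1 expr1.
    move=> Y; rewrite -sum1_card natr_sum big_mkcond [RHS]big_mkcond /=.
    by apply: eq_bigr => u _; rewrite in_setI sub1set; case: (u \in A); case: (u \in Y).
  have : Ex q (fun Y : fam => #|misread (A :&: Y)|%:R) <= #|Z|%:R * e.
    rewrite (eq_Ex _ (g := fun Y : fam => \sum_(v in Z) (v \in misread (A :&: Y))%:R)).
      rewrite Ex_sum mulr_natl -sumr_const; apply: ler_sum => v vZ.
      rewrite -Pr_Ex.
      have [hv|hv] := boolP [&& v \in X, #|v| == k & v \notin mis].
        case/and3P: hv => vX /eqP vk vm.
        apply: le_trans (le_trans (Pr_misread vX vk vm) _).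
          by apply: Pr_mono => // Y /setIdP[_ /and3P[]].
        rewrite ler_expR lerN2 ler_pM2r ?invr_gt0 // ler_pM2l ?mulr_gt0 //.
        exact: Hg.
      apply: (@le_trans _ _ 0); last exact: expR_ge0.
      rewrite Pr_Ex -[leRHS](@Ex_cst _ n q) ler_Ex // => Y.
      rewrite (_ : v \in misread _ = false) //; apply: contraNF hv.
      by move=> /setIdP[-> /and3P[-> -> _]].
    move=> Y; rewrite -sum1_card natr_sum big_mkcond [RHS]big_mkcond /=.
    apply: eq_bigr => v _; case: (boolP (v \in misread _)) => [h|_]; last by case: ifP.
    by rewrite (subsetP (misread_sub Y) _ h).
  move=> h1.
  have h2 : #|Z|%:R * e <= #|A|%:R * (n.+1 ^ 4).+1%:R * e by rewrite ler_wpM2r ?expR_ge0.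
  have h3 : n%:R ^+ 2 / #|A|%:R * Ex q (fun Y : fam => #|misread (A :&: Y)|%:R) <= 1 / 2.
    have := ler_wpM2l (_ : 0 <= n%:R ^+ 2 / #|A|%:R) (le_trans h1 h2).
    move=> /(_ (ltW (divr_gt0 n0 a0))) /le_trans; apply.
    rewrite mulrAC ler_pdivrMr //; move: hq; set N4 := (n.+1 ^ 4).+1%:R => hq.
    have -> : n%:R ^+ 2 * (#|A|%:R * N4 * e) = #|A|%:R * (N4 * n%:R ^+ 2 * e) by ring.
    have h4 : N4 * n%:R ^+ 2 * e <= 1 / 2 by lra.
    have := ler_wpM2l (ltW a0) h4; lra.
  have -> : (2 * q * #|A|%:R)^-1 * (q * #|A|%:R) = 1 / 2.
    by field; rewrite !gt_eqF.
  lra.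
have f1 : 0 <= (2 * q * #|A|%:R)^-1 * #|A :&: Y|%:R.
  by apply: mulr_ge0 => //; rewrite invr_ge0; apply: mulr_ge0 => //; apply: mulr_ge0.
have f2 : 0 <= (n%:R ^+ 2 / #|A|%:R) * #|misread (A :&: Y)|%:R :> R.
  by apply: mulr_ge0 => //; apply: divr_ge0 => //; exact: ltW.
exists (A :&: Y); rewrite subsetIl; split => //.
  have : (2 * q * #|A|%:R)^-1 * #|A :&: Y|%:R <= 1 by rewrite /f in hY; lra.
  by rewrite mulrC ler_pdivrMr ?mul1r // !mulr_gt0.
have : (n%:R ^+ 2 / #|A|%:R) * #|misread (A :&: Y)|%:R <= 1 :> R by rewrite /f in hY; lra.
by rewrite mulrAC ler_pdivrMr // mul1r mulrC.
Qed.

(** Bad sets with too few lower neighbours in [B] to start the walks of [card_bad_misplaced]. They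
    are left out of the sums here and are paid for later, since almost all their edges lie in the
    cut. *)
Definition thin : fam := [set x in A | (x \in bad eps X) && (M * down_in B x < n)%N].

Local Notation defect x := (p * k%:R - (deg X x)%:R : R).

Lemma norm_defect x : #|x| = k -> `|defect x| <= n%:R.
Proof.
move=> xk; have kn : k%:R <= n%:R :> R.
  by rewrite ler_nat -xk (leq_trans (max_card _)) // card_ord.
have dk : (deg X x)%:R <= k%:R :> R.
  by rewrite ler_nat -xk subset_leq_card //; apply/subsetP => i; rewrite inE => /andP[].
have d0 : 0 <= (deg X x)%:R :> R by [].
have k0 : 0 <= k%:R :> R by [].
rewrite ler_norml; move: p_le1 p_gt0; nra.
Qed.

(** Every coarse set has a sample point at distance two, and the ball around a sample point holds at
    most [C0] bad sets. *)
Lemma card_bad_coarse (A0 : fam) : (#|bad eps X :&: coarse q A0| <= C0 * #|A0|)%N.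
Proof.
apply: (@leq_trans #|\bigcup_(u in A0) (Bal u :&: bad eps X)|).
  apply: subset_leq_card; apply/subsetP => v /setIP[vb].
  rewrite inE => /andP[/eqP vk h].
  have : 0 < #|Gam v :&: A0|%:R :> R.
    apply: lt_le_trans h; rewrite divr_gt0 // !mulr_gt0 //.
    by apply: lt_le_trans (Hg vk); rewrite mulr_gt0 // exprn_gt0 // ltr0n.
  rewrite ltr0n card_gt0 => /set0Pn[u /setIP[uv uA]].
  apply/bigcupP; exists u => //; rewrite in_setI vb andbT.
  by apply: (subsetP (Gam_Bal u)); rewrite Gam_sym.
rewrite mulnC -sum_nat_const.
elim/big_ind2: _ => [|x1 x2 y1 y2 h1 h2|u _]; [by rewrite cards0| |exact: Hbad].
by apply: leq_trans (leq_add h1 h2); rewrite cardsU leq_subr.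
Qed.

Lemma sum_indicator (S : fam) (f : pt -> R) :
  \sum_(x in S) f x = \sum_x (x \in S)%:R * f x.
Proof.
by rewrite big_mkcond; apply: eq_bigr => x _; case: ifP; rewrite ?mul1r ?mul0r.
Qed.

(** The sums differ only where the two indicators do. A merely misplaced set has a good degree and
    costs eps n; the three rarer kinds (bad misplaced, misread, bad and coarse) are charged the
    trivial bound n. *)
Lemma sum_coarse_close (A0 : fam) :
  `|\sum_(x in A :\: thin) defect x - \sum_(x in coarse q A0 :&: X) defect x| <=
  n%:R * (eps * #|mis|%:R + #|bad_misplaced|%:R + #|misread A0|%:R + C0%:R * #|A0|%:R).
Proof.
have n0 : 0 <= n%:R :> R by [].
pose BC := bad eps X :&: coarse q A0.
apply: (@le_trans _ _ (\sum_(x : pt) n%:R * (eps * (x \in mis)%:R +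
   (x \in bad_misplaced)%:R + (x \in misread A0)%:R + (x \in BC)%:R))); last first.
  rewrite -mulr_sumr ler_wpM2l // !big_split /= -mulr_sumr.
  have card1 (S : fam) : \sum_x (x \in S)%:R = #|S|%:R :> R.
    by rewrite -sum1_card natr_sum [RHS]big_mkcond; apply: eq_bigr => x _; case: ifP.
  by rewrite !card1 lerD2l -natrM ler_nat card_bad_coarse.
rewrite !sum_indicator -sumrB; apply: (le_trans (ler_norm_sum _ _ _)).
apply: ler_sum => x _; rewrite -mulrBl normrM.
have rhs0 : 0 <= eps * (x \in mis)%:R + (x \in bad_misplaced)%:R +
     (x \in misread A0)%:R + (x \in BC)%:R.
  by rewrite !addr_ge0 // mulr_ge0.
have [->|ne] := eqVneq (x \in A :\: thin) (x \in coarse q A0 :&: X).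
  by rewrite subrr normr0 mul0r mulr_ge0.
have hX : x \in X /\ #|x| = k.
  move: ne; rewrite in_setD in_setI; case: (boolP (x \in A)) => [xA _|xA].
    by rewrite (subsetP AX) // Ak.
  rewrite andbF eq_sym eqbF_neg negbK => /andP[xc ->]; split => //.
  by move: xc; rewrite inE => /andP[/eqP].
case: hX => xX xk.
have -> : `|(x \in A :\: thin)%:R - (x \in coarse q A0 :&: X)%:R| = 1 :> R.
  by move: ne; case: (_ \in _); case: (_ \in _) => // _; rewrite ?subr0 ?sub0r ?normrN normr1.
rewrite mul1r.
have big : 1 <= eps * (x \in mis)%:R + (x \in bad_misplaced)%:R +
     (x \in misread A0)%:R + (x \in BC)%:R ->
   `|defect x| <= n%:R * (eps * (x \in mis)%:R + (x \in bad_misplaced)%:R +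
     (x \in misread A0)%:R + (x \in BC)%:R).
  move=> h; apply: (le_trans (norm_defect xk)).
  by rewrite -[leLHS]mulr1 ler_wpM2l.
have e0 : 0 <= eps * (x \in mis)%:R by rewrite mulr_ge0.
have /orP[xm|xm] := orbN (x \in misread A0).
  by apply: big; rewrite xm -addrA [X in _ <= _ + X]addrC addrA lerDr !addr_ge0.
have /orP[xb|xb] := orbN (x \in BC).
  by apply: big; rewrite xb lerDr !addr_ge0.
have /orP[xbm|xbm] := orbN (x \in bad_misplaced).
  by apply: big; rewrite xbm (negbTE xm) (negbTE xb) !addr0 lerDr.
have same : x \notin mis -> (x \in A) = (x \in coarse q A0).
  by move=> hx; apply/eqP; move: xm; rewrite inE xX xk eqxx hx /= negbK.
(* A bad [x] that is not coarse must lie in [A] outside [thin]. Not being misread, it is misplaced,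
   with enough lower neighbours in [B], hence a bad misplaced set, a case already settled. *)
have [xB|xB] := boolP (x \in bad eps X).
  exfalso; move: xb; rewrite in_setI xB /= => xc; move: ne.
  rewrite in_setI (negbTE xc) /= in_setD inE xB /=.
  case: (boolP (x \in A)) => xA; rewrite ?andbF //= andbT -leqNgt => /negP h.
  have xM : x \in mis by apply: contraT => /same; rewrite xA (negbTE xc).
  by move: xbm; rewrite inE xM xA xB /=; case: leqP h.
have xM : x \in mis.
  apply: contraT => /same hs; move: ne.
  by rewrite in_setD in_setI xX andbT inE (negbTE xB) andbF /= hs eqxx.
rewrite xM (negbTE xm) (negbTE xb) (negbTE xbm) !addr0 mulr1 [leRHS]mulrC.
by move: xB; rewrite inE -leNgt xk distrC.
Qed.

(** The two differences are disjoint, and a set in either one is misplaced or misread. *)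
Lemma coarse_close (A0 : fam) :
  (#|A :\: coarse q A0| + #|(coarse q A0 :&: X) :\: A| <= #|mis| + #|misread A0|)%N.
Proof.
set S1 := A :\: _; set S2 := _ :\: A.
have S0 : S1 :&: S2 = set0.
  by apply/setP => x; rewrite !inE; case: (x \in A); rewrite ?andbF.
rewrite -(cardsUI S1) S0 cards0 addn0 -(cardsUI mis).
apply: leq_trans (leq_addr _ _); apply: subset_leq_card; apply/subsetP => x.
rewrite in_setU => h.
have [xX xk ne] : [/\ x \in X, #|x| = k & (x \in A) != (x \in coarse q A0)].
  case/orP: h => /setDP[h1 h2]; first by rewrite (subsetP AX) // Ak // h1 (negbTE h2).
  case/setIP: h1 => h1 xX; rewrite xX h1 (negbTE h2); split => //.
  by move: h1; rewrite inE => /andP[/eqP].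
rewrite in_setU; case: (boolP (x \in mis)) => //= xm.
by rewrite inE xX xk eqxx xm.
Qed.

End Core.

(** * Regularity conditions on the family and their consequence for sums of degrees *)

Section Good.
Variables (R : realType) (n : nat) (p : R).
Local Notation pt := {set 'I_n}.
Local Notation fam := {set {set 'I_n}}.
Implicit Types (X A B : fam).

Definition good_deg M k X := [forall x : pt, (#|x| == k) ==> (n <= M * deg X x)%N].

Definition good_gam k X := [forall x : pt, (#|x| == k) ==>
  (15 / 16 * p * #|Gam x|%:R <= #|Gam x :&: X|%:R)].

Definition good_path M K3 (c : R) k X := [forall v : pt, forall D : pt,
  [&& #|v| == k, D \subset v & (n <= M * #|D|)%N] ==>
  (#|few_paths c X v D| <= K3 * n ^ 3)%N].

Definition good_bad C0 (eps : R) X := [forall u : pt, (#|Bal u :&: bad p eps X| <= C0)%N].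

Definition edges_in X (E : {set pt * 'I_n}) : {set pt * 'I_n} :=
  [set e : pt * 'I_n in E | (e.1 \in X) && (e.1 :\ e.2 \in X)].

(** Together with [edges_into] this is the edge boundary of the pair (S, S') in the full cube. With
    S' empty it is the set of all edges going down from S. *)
Definition edges_out k (S S' : fam) : {set pt * 'I_n} :=
  [set e : pt * 'I_n | [&& #|e.1| == k, e.2 \in e.1, e.1 \in S & e.1 :\ e.2 \notin S']].

Definition edges_into k (S S' : fam) : {set pt * 'I_n} :=
  [set e : pt * 'I_n | [&& #|e.1| == k, e.2 \in e.1, e.1 \notin S & e.1 :\ e.2 \in S']].

Definition deviation (K s : R) X (E : {set pt * 'I_n}) :=
  `|#|edges_in X E|%:R - p ^+ 2 * #|E|%:R| <= K * s * n%:R ^+ 3.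

(** The errors are measured by the number s of sample points, because the number of samples, at most
    2^(n s), is what the tail bound must overcome. As s is about q |A|, an edge error K s n^3 is a
    small multiple of |A| when K q n^3 is small. *)
Definition good_coarse (q K : R) k X := [forall A0 : fam, forall B0 : fam,
  let S := coarse k p q A0 in let S' := coarse k.-1 p q B0 in
  let s : R := (#|A0| + #|B0|)%:R in
  [&& `|#|S :&: X|%:R - p * #|S|%:R| <= K * s * n%:R ^+ 2,
      deviation K s X (edges_out k S S') & deviation K s X (edges_into k S S')]].

(** The threshold in [coarse] is positive, so nothing is coarse for an empty sample. This allows
    [good_coarse] to be used with a single sample. *)
Lemma coarse0 k (q g : R) : 0 < p -> 0 < q -> 0 < g -> (0 < n)%N ->
  (forall x : pt, #|x| = k -> g * n%:R ^+ 4 <= #|Gam x|%:R) ->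
  coarse k p q set0 = set0 :> fam.
Proof.
move=> p0 q0 g0 n0 Hg; apply/setP => v; rewrite !inE setI0 cards0.
case: eqP => //= vk; apply/negbTE; rewrite -ltNge divr_gt0 // !mulr_gt0 //.
by apply: lt_le_trans (Hg v vk); rewrite mulr_gt0 // exprn_gt0 // ltr0n.
Qed.

Lemma card_edges_dep (P : pred pt) (Q : pt -> pred 'I_n) :
  #|[set e : pt * 'I_n | P e.1 && Q e.1 e.2]| = (\sum_(x | P x) #|[set i | Q x i]|)%N.
Proof.
rewrite -sum1dep_card (eq_bigr (fun x => \sum_(i | Q x i) 1)%N); last first.
  by move=> x _; rewrite sum1dep_card.
by rewrite pair_big_dep.
Qed.

Variables (M K3 C0 k : nat) (c g eps q K e0 : R) (X A B : fam).
Hypotheses (p_gt0 : 0 < p) (p_le1 : p <= 1) (c_gt0 : 0 < c) (g_gt0 : 0 < g).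
Hypotheses (n_gt0 : (0 < n)%N) (eps_le1 : eps <= 1) (eps_ge0 : 0 <= eps).
Hypotheses (q_gt0 : 0 < q) (q_le1 : q <= 1) (K_ge0 : 0 <= K).
Hypothesis Hg : forall x : pt, #|x| = k -> g * n%:R ^+ 4 <= #|Gam x|%:R.
Hypothesis Hg' : forall x : pt, #|x| = k.-1 -> g * n%:R ^+ 4 <= #|Gam x|%:R.
Hypothesis Hn3 : (K3 * n ^ 3)%:R <= p * g * n%:R ^+ 4 / 32.
Hypothesis Hq : 2 * ((n.+1 ^ 4).+1%:R * n%:R ^+ 2) *
  expR (- (q * p * (g * n%:R ^+ 4) / 64)) <= 1.
Hypothesis C0_gt0 : (0 < C0)%N.
Hypothesis HC0 : 192 * C0%:R * 16 <= p * g * c * n%:R.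
Hypothesis Heps : eps * 192 * 16 <= p * g * c.
Hypothesis He0 : n%:R^-1 + 2 * n%:R * C0%:R * q + 4 * K * q * n%:R ^+ 3 <= e0.
Hypotheses (X1 : good_deg M k X) (X2 : good_gam k X) (X3 : good_path M K3 c k X).
Hypotheses (X4 : good_coarse q K k X) (X5 : good_bad C0 eps X).
Hypothesis AX : A \subset X.
Hypothesis Ak : forall x, x \in A -> #|x| = k.
Hypothesis BX : B \subset X.

Local Notation defect x := (p * k%:R - (deg X x)%:R : R).

(** The sum equals k p times the deviation of |S \cap X| from p |S|, minus the deviation of the
    number of edges of X below S from p^2 k |S|; [good_coarse] with an empty second sample bounds
    both. *)
Lemma sum_defect_coarse (A0 : fam) :
  `|\sum_(x in coarse k p q A0 :&: X) defect x| <= 2 * K * #|A0|%:R * n%:R ^+ 3.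
Proof.
have /forallP /(_ A0) /forallP /(_ set0) := X4.
rewrite /= (coarse0 p_gt0 q_gt0 g_gt0 n_gt0 Hg') cards0 addn0.
set S := coarse k p q A0; set s := #|A0|%:R => /and3P[h1 h2 _].
(* No bound on [k] is assumed: it is read off an element of [S], and an empty [S] gives a zero
   sum. *)
have kn : k%:R <= n%:R :> R \/ S = set0.
  have [e|/set0Pn[x]] := eqVneq S set0; first by right.
  rewrite /S inE => /andP[/eqP <- _]; left.
  by rewrite ler_nat (leq_trans (max_card _)) // card_ord.
case: kn => [kn|->]; last by rewrite set0I big_set0 normr0 !mulr_ge0 // exprn_ge0.
have cE : #|edges_out k S set0| = (k * #|S|)%N.
  rewrite (_ : edges_out k S set0 = [set e : pt * 'I_n | (e.1 \in S) && (e.2 \in e.1)]).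
    rewrite (@card_edges_dep (fun x => x \in S) (fun x i => i \in x)).
    rewrite mulnC -sum_nat_const; apply: eq_bigr => x.
    by rewrite /S inE => /andP[/eqP <- _]; apply: eq_card => i; rewrite inE.
  apply/setP => e; rewrite /S !inE; case: (#|e.1| == k) => //=.
  by case: (e.2 \in e.1); rewrite ?andbT ?andbF.
have cX : #|edges_in X (edges_out k S set0)| = (\sum_(x in S :&: X) deg X x)%N.
  rewrite (_ : edges_in _ _ = [set e : pt * 'I_n | (e.1 \in S :&: X) &&
     ((e.2 \in e.1) && (e.1 :\ e.2 \in X))]).
    rewrite (@card_edges_dep (fun x => x \in S :&: X)
      (fun x i => (i \in x) && (x :\ i \in X))).
    by [].
  apply/setP => e; rewrite !inE andbT.
  by case: (#|e.1| == k); case: (e.2 \in _); case: (e.1 \in X); rewrite ?andbF ?andbT.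
have -> : \sum_(x in S :&: X) defect x =
   k%:R * p * (#|S :&: X|%:R - p * #|S|%:R) -
   (#|edges_in X (edges_out k S set0)|%:R - p ^+ 2 * #|edges_out k S set0|%:R).
  rewrite sumrB sumr_const -mulr_natr cX cE natr_sum natrM; ring.
apply: (le_trans (ler_normB _ _)).
have h3 : `|k%:R * p * (#|S :&: X|%:R - p * #|S|%:R)| <= K * s * n%:R ^+ 3.
  have kp0 : 0 <= k%:R * p by rewrite mulr_ge0 // ltW.
  rewrite normrM (ger0_norm kp0).
  have -> : K * s * n%:R ^+ 3 = n%:R * (K * s * n%:R ^+ 2) by ring.
  apply: ler_pM => //; apply: le_trans kn.
  by rewrite -[leRHS]mulr1 ler_wpM2l.
move: h2; rewrite /deviation => h2; lra.
Qed.

Local Notation CE := (cut_edges k X A B).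

(** The misplaced and the bad misplaced sets each contribute at most |CE|/16, by the choice of [eps]
    and by n being large against [C0]; this is the term |CE|/8. All remaining errors are
    proportional to |A| and make up [e0]. *)
Lemma core_bound : exists A0 : fam, [/\ #|A0|%:R <= 2 * q * #|A|%:R,
  `|\sum_(x in A :\: thin p X A B M eps) defect x| <= #|CE|%:R / 8 + e0 * #|A|%:R &
  (#|A :\: coarse k p q A0| + #|(coarse k p q A0 :&: X) :\: A|)%:R * n%:R <=
     192 / (p * g * c) * #|CE|%:R + #|A|%:R / n%:R].
Proof.
have Hdeg (x : pt) : #|x| = k -> (n <= M * deg X x)%N.
  by move=> xk; have /forallP /(_ x) := X1; rewrite xk eqxx.
have Hgam (x : pt) : #|x| = k -> 15 / 16 * p * #|Gam x|%:R <= #|Gam x :&: X|%:R.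
  by move=> xk; have /forallP /(_ x) := X2; rewrite xk eqxx.
have Hpath (v D : pt) : #|v| = k -> D \subset v -> (n <= M * #|D|)%N ->
    (#|few_paths c X v D| <= K3 * n ^ 3)%N.
  move=> vk Dv nD; have /forallP /(_ v) /forallP /(_ D) := X3.
  by rewrite vk eqxx Dv nD.
have Hbad (u : pt) : (#|Bal u :&: bad p eps X| <= C0)%N by have /forallP /(_ u) := X5.
have [A0 [_ cA0 cmr]] := sampling X A p_gt0 g_gt0 n_gt0 Hg q_gt0 q_le1 Hq.
have h1 := card_misplaced B p_gt0 c_gt0 n_gt0 Hdeg Hgam Hpath Hg Hn3 AX.
have h2 := card_bad_misplaced p_gt0 c_gt0 n_gt0 Hgam Hpath Hbad Hg Hn3 AX BX.
have h3 := sum_coarse_close B M p_gt0 p_le1 g_gt0 n_gt0 eps_ge0 Hbad Hg AX Ak q_gt0 A0.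
have h4 := coarse_close p AX Ak q A0.
have h5 := sum_defect_coarse A0.
exists A0; move: h1 h2 h3 h4 h5 cmr cA0.
set m := #|misplaced _ _ _ _|; set b := #|bad_misplaced _ _ _ _ _ _ _|.
set r := #|misread _ _ _ _ _ _|; set E := #|CE|%:R; set a := #|A|%:R.
set T := (_ + #|_ :\: A|)%N; set sA := \sum_(x in A :\: _) _; set sC := \sum_(x in _ :&: X) _.
set s := #|A0|%:R; set N := n%:R => h1 h2 h3 h4 h5 cmr cA0.
have N0 : 0 < N by rewrite ltr0n.
have pgc : 0 < p * g * c by rewrite !mulr_gt0.
have m0 : 0 <= m%:R :> R by []. have b0 : 0 <= b%:R :> R by [].
have r0 : 0 <= r%:R :> R by []. have E0 : 0 <= E by []. have a0 : 0 <= a by [].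
have hm : m%:R * N <= 192 / (p * g * c) * E.
  by rewrite mulrAC ler_pdivlMr // mulrAC -mulrA.
have hr : r%:R * N <= a / N by rewrite ler_pdivlMr // -mulrA -expr2.
split => //; last first.
  have : T%:R * N <= (m + r)%:R * N by rewrite ler_wpM2r ?ler_nat // ltW.
  rewrite natrD mulrDl; lra.
have hm' : N * (eps * m%:R) <= E / 16.
  have : (eps * 192 * 16) * (m%:R * N) <= (p * g * c) * (m%:R * N).
    by apply: ler_wpM2r => //; rewrite mulr_ge0 // ltW.
  have : (p * g * c) * (m%:R * N) <= 192 * E by apply: le_trans h1; rewrite le_eqVlt; apply/orP; left; apply/eqP; ring.
  lra.
have hb : N * b%:R <= E / 16.
  have C00 : 0 < C0%:R :> R by rewrite ltr0n.
  have : (192 * C0%:R * 16) * (b%:R * N) <= (p * g * c * N) * (b%:R * N).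
    by apply: ler_wpM2r => //; rewrite mulr_ge0 // ltW.
  have e : (p * g * c * N) * (b%:R * N) = b%:R * (p * g * c * N ^+ 2) by ring.
  rewrite e => /le_trans /(_ h2) h.
  rewrite -(ler_pM2l C00); lra.
have hs : N * (C0%:R * s) <= 2 * N * C0%:R * q * a.
  have : N * C0%:R * s <= N * C0%:R * (2 * q * a).
    by apply: ler_wpM2l => //; rewrite mulr_ge0 // ltW.
  lra.
have hK : 2 * K * s * N ^+ 3 <= 4 * K * q * N ^+ 3 * a.
  have : (2 * K * N ^+ 3) * s <= (2 * K * N ^+ 3) * (2 * q * a).
    by apply: ler_wpM2l => //; rewrite !mulr_ge0 // exprn_ge0 // ltW.
  lra.
have he : (N^-1 + 2 * N * C0%:R * q + 4 * K * q * N ^+ 3) * a <= e0 * a.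
  exact: ler_wpM2r.
have : `|sA| <= `|sA - sC| + `|sC| by rewrite -{1}(subrK sC sA) ler_normD.
have eN : a / N = N^-1 * a by rewrite mulrC.
rewrite eN in hr; lra.
Qed.

End Good.

(** * Complementation and lower shadows *)

Section Complement.
Variable n : nat.
Local Notation pt := {set 'I_n}.
Local Notation fam := {set {set 'I_n}}.
Implicit Types (X A B F : fam) (x y : pt).

Lemma card_le_n x : (#|x| <= n)%N.
Proof. by rewrite (leq_trans (max_card _)) // card_ord. Qed.

Definition cpl F : fam := [set ~: x | x in F].

Lemma mem_cpl F x : (x \in cpl F) = (~: x \in F).
Proof.
apply/imsetP/idP => [[y yF ->]|h]; first by rewrite setCK.
by exists (~: x) => //; rewrite setCK.
Qed.

Lemma cplK : involutive cpl.
Proof. by move=> F; apply/setP => x; rewrite !mem_cpl setCK. Qed.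

Lemma card_cpl F : #|cpl F| = #|F|.
Proof. by rewrite card_imset //; exact: setC_inj. Qed.

Lemma cpl_sub A B : (cpl A \subset cpl B) = (A \subset B).
Proof.
apply/subsetP/subsetP => h x xA; last by rewrite mem_cpl h // -mem_cpl.
by have := h (~: x); rewrite !mem_cpl setCK; apply.
Qed.

Lemma setC_D1 x (i : 'I_n) : ~: (x :\ i) = i |: ~: x.
Proof. by apply/setP => z; rewrite !inE negb_and negbK. Qed.

(** The same edge seen in the complemented cube, where the complement of the lower end becomes the
    upper end. *)
Definition flip (e : pt * 'I_n) : pt * 'I_n := (~: (e.1 :\ e.2), e.2).

Lemma flipK (e : pt * 'I_n) : e.2 \in e.1 -> flip (flip e) = e.
Proof.
by case: e => x i /= xi; rewrite /flip /= setC_D1 setCK setD1K.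
Qed.

Lemma card_flip (P Q : {set pt * 'I_n}) :
  (forall e, e \in P -> e.2 \in e.1 /\ flip e \in Q) -> (#|P| <= #|Q|)%N.
Proof.
move=> h; rewrite -(@card_in_imset _ _ flip P).
  by apply: subset_leq_card; apply/subsetP => _ /imsetP[e eP ->]; have [] := h e eP.
move=> e e' eP e'P E; have [h1 _] := h e eP; have [h2 _] := h e' e'P.
by rewrite -(flipK h1) -(flipK h2) E.
Qed.

Definition nbr X A : fam := [set y in X | [exists i, (i \notin y) && (i |: y \in A)]].

Lemma mem_nbr X A x i : x \in A -> i \in x -> x :\ i \in X -> x :\ i \in nbr X A.
Proof.
move=> xA ix xX; rewrite inE xX /=; apply/existsP; exists i.
by rewrite setD11 setD1K.
Qed.

Lemma nbr_sub X A : nbr X A \subset X.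
Proof. by apply/subsetP => y; rewrite inE => /andP[]. Qed.

Variables (X A : fam) (k : nat).
Hypothesis AX : A \subset X.
Hypothesis Ak : forall x, x \in A -> #|x| = k.
Hypotheses (k_gt0 : (0 < k)%N) (k_len : (k <= n)%N).
Local Notation N := (nbr X A).
Local Notation X' := (cpl X).
Local Notation N' := (cpl N).
Local Notation A' := (cpl A).
Local Notation k' := (n - k).+1.

Lemma card_nbr_elt y : y \in N -> #|y| = k.-1.
Proof.
rewrite inE => /andP[_ /existsP[i /andP[iy /Ak]]].
by rewrite cardsU1 iy => <-.
Qed.

Lemma card_cpl_nbr_elt x : x \in N' -> #|x| = k'.
Proof.
rewrite mem_cpl => /card_nbr_elt; rewrite cardsCs setCK card_ord => h.
have := card_le_n x; move: h k_gt0 k_len; lia.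
Qed.

Lemma down_in_nbr x : x \in A -> down_in N x = deg X x.
Proof.
move=> xA; apply: eq_card => i; rewrite !inE.
case: (boolP (i \in x)) => //= ix; case: (boolP (x :\ i \in X)) => //= xiX.
by apply/existsP; exists i; rewrite setD11 setD1K.
Qed.

(** Both sides count the edges of X between A and its shadow, once from below and once from
    above. *)
Lemma sum_down_in : (\sum_(x in N') down_in A' x = \sum_(x in A) deg X x)%N.
Proof.
have e1 := @card_edges_dep _ (fun x => x \in N') (fun x i => (i \in x) && (x :\ i \in A')).
have e2 := @card_edges_dep _ (fun x => x \in A) (fun x i => (i \in x) && (x :\ i \in X)).
rewrite -[LHS]e1 -[RHS]e2; apply/eqP; rewrite eqn_leq; apply/andP; split; apply: card_flip.
  move=> [x i]; rewrite in_set /= => /and3P[xN ix xA]; split => //.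
  rewrite in_set /= -mem_cpl xA setC_D1 setU11 setU1K ?in_setC ?negbK //=.
  by apply: (subsetP (nbr_sub X A)); rewrite -mem_cpl.
move=> [x i]; rewrite in_set /= => /and3P[xA ix xX]; split => //.
rewrite in_set /= mem_cpl setCK mem_nbr //= setC_D1 setU11 setU1K ?in_setC ?negbK //=.
by rewrite mem_cpl setCK.
Qed.

(** N contains every neighbour of A in X below it, so a cut edge must have its lower end in N and
    its upper end outside A. Nothing leaves the cut on the other side. *)
Lemma card_cut_nbr : #|cut_edges k' X' N' A'| =
  (\sum_(x in N') (deg X' x - down_in A' x))%N.
Proof.
have e1 := @card_edges_dep _ (fun x => x \in N')
  (fun x i => [&& i \in x, x :\ i \in X' & x :\ i \notin A']).
transitivity #|[set e : pt * 'I_n | (e.1 \in N') &&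
   [&& e.2 \in e.1, e.1 :\ e.2 \in X' & e.1 :\ e.2 \notin A']]|; last first.
  rewrite [LHS]e1; apply: eq_bigr => x xN.
  have -> : deg X' x = (down_in A' x + #|[set i | [&& i \in x, x :\ i \in X' & x :\ i \notin A']]|)%N.
    rewrite /deg -(cardsID [set i | x :\ i \in A']); congr (_ + _)%N; apply: eq_card => i.
      rewrite in_setI !in_set -andbA; case: (boolP (x :\ i \in A')) => h; rewrite ?andbF //.
      by rewrite (_ : x :\ i \in X') //; apply: (subsetP _ _ h); rewrite cpl_sub.
    by rewrite in_setD !in_set; case: (i \in x); case: (x :\ i \in X'); case: (x :\ i \in A').
  by rewrite addKn.
apply: eq_card => [[x i]]; rewrite 2!in_set /=.
case: (boolP (x \in N')) => [xN|xN].
  rewrite (card_cpl_nbr_elt xN) eqxx /=.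
  have -> : x \in X' by apply: (subsetP _ _ xN); rewrite cpl_sub nbr_sub.
  by rewrite /=; case: (i \in x); case: (x :\ i \in X'); case: (x :\ i \in A').
apply/negP => /and5P[xX _ ix xiX]; rewrite eq_sym eqbF_neg negbK => xiA.
move: xN; rewrite mem_cpl => /negP; apply; rewrite mem_cpl in xX.
rewrite in_set xX /=; apply/existsP; exists i; rewrite in_setC ix /=.
by move: xiA; rewrite mem_cpl setC_D1.
Qed.

Lemma card_cut_flip : (#|cut_edges k X A N| <= #|cut_edges k' X' N' A'|)%N.
Proof.
apply: card_flip => [[x i]]; rewrite in_set /= => /and5P[xX /eqP xk ix xiX ne]; split => //.
rewrite in_set /= !mem_cpl setCK xiX.
have -> : ~: (x :\ i) :\ i = ~: x by rewrite setC_D1 setU1K // in_setC negbK.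
have ne' : (x :\ i \in N) != (x \in A) by rewrite eq_sym.
rewrite setCK xX setC_D1 setU11 ne' !andbT /= -setC_D1 cardsCs setCK card_ord.
have := cardsD1 i x; rewrite ix xk add1n => h; apply/eqP; rewrite h subnS.
by rewrite prednK // subn_gt0; move: k_len; rewrite h.
Qed.

End Complement.

(** * Expansion far above the middle *)

Section Far.
Variables (R : realType) (n : nat) (p eps : R) (M C0 : nat).
Local Notation pt := {set 'I_n}.
Local Notation fam := {set {set 'I_n}}.

(** The sets [x :\ i], and so their complements, differ pairwise in one exchange; all of them lie in
    the ball around any one of them. *)
Lemma bad_nbrs (X : fam) (x : pt) : good_bad p C0 eps X ->
  (#|[set i in x | ~: (x :\ i) \in bad p eps X]| <= C0)%N.
Proof.
move=> /forallP G; set S := [set i in x | _].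
have [->|[i0 i0S]] := set_0Vmem S; first by rewrite cards0.
have inj : {in S &, injective (fun i => ~: (x :\ i))}.
  move=> i j /setIdP[ix _] /setIdP[jx _] /setC_inj E; apply/eqP.
  have : i \notin x :\ i by rewrite setD11.
  by rewrite E !inE ix andbT negbK.
rewrite -(card_in_imset inj); apply: leq_trans (G (~: (x :\ i0))).
apply: subset_leq_card; apply/subsetP => _ /imsetP[i /setIdP[ix ib] ->].
rewrite in_setI ib andbT inE; case/setIdP: i0S => i0x _.
have ci j : j \in x -> #|~: (x :\ j)| = (n - #|x|).+1.
  move=> jx; rewrite cardsCs setCK card_ord.
  have := cardsD1 j x; rewrite jx add1n => h; rewrite h subnS prednK // subn_gt0.
  by rewrite -h card_le_n.
rewrite !ci // eqxx /=; apply: (@leq_trans #|[set i0]|); last by rewrite cards1.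
apply: subset_leq_card; apply/subsetP => z; rewrite !inE.
by case: (z \in x); rewrite ?andbT ?andbF ?orbT ?negbK //= => /andP[].
Qed.

(** Weighted count of the edges from A to N. Edges with a bad lower end are dropped, at most [C0]
    per set of A. Bad sets of A get the larger weight [w], which costs each set of N at most
    [w * C0]. Apart from small errors this compares p k |A| with p k' |N|. *)
Lemma hall_far (X A : fam) (k : nat) :
  3 / 4 < p -> p <= 1 -> 0 <= eps -> (0 < n)%N -> (0 < M)%N -> (0 < k)%N -> (k <= n)%N ->
  4 * M%:R * eps <= 1 -> (M * C0 * (1 + 2 * M) <= n)%N ->
  (2 * n < M * (k - (n - k).+1))%N ->
  good_deg M k X -> good_bad p C0 eps X -> good_bad p C0 eps (cpl X) ->
  A \subset X -> (forall x, x \in A -> #|x| = k) -> A != set0 ->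
  (#|A| < #|nbr X A|)%N.
Proof.
move=> p34 p1 e0 n0 M0 k0 kn heps hC far G1 G5 G5' AX Ak A0.
set N := nbr X A; set k' := (n - k).+1.
rewrite ltnNge; apply/negP => NA.
(* A bad set keeps at least n/M - C0 >= n/(2M) edges, so with this weight it contributes at least n,
   no less than a set of typical degree. *)
pose w : R := 2 * M%:R.
have w0 : 0 <= w by rewrite mulr_ge0.
pose f (x : pt) : R := if x \in bad p eps X then w else 1.
pose P := [set e : pt * 'I_n | [&& e.1 \in A, e.2 \in e.1, e.1 :\ e.2 \in X &
   (flip e).1 \notin bad p eps (cpl X)]].
pose Lam : R := p * k%:R - eps * n%:R - C0%:R.
have nR : 0 < n%:R :> R by rewrite ltr0n.
have MR : 0 < M%:R :> R by rewrite ltr0n.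
have low : Lam * #|A|%:R <= \sum_(e in P) f e.1.
  have -> : \sum_(e in P) f e.1 = \sum_(x in A) \sum_(i | (x, i) \in P) f x.
    rewrite pair_big_dep /=; apply: eq_bigl => [[x i]] /=.
    by rewrite !inE /=; case: (x \in A).
  rewrite mulr_natr -sumr_const; apply: ler_sum => x xA.
  rewrite sumr_const -mulr_natl.
  have cP : (deg X x - C0 <= #|[pred i | (x, i) \in P]|)%N.
    rewrite leq_subLR /deg -(cardsID [set i | ~: (x :\ i) \in bad p eps (cpl X)]).
    apply: leq_add.
      apply: leq_trans (bad_nbrs x G5'); apply: subset_leq_card.
      by apply/subsetP => i; rewrite !inE => /andP[/andP[-> _] ->].
    apply: subset_leq_card; apply/subsetP => i /setDP[].
    rewrite in_set => /andP[h2 h3]; rewrite in_set => h1.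
    by rewrite unfold_in /= in_set /= xA h2 h3.
  have cP' : (deg X x)%:R - C0%:R <= #|[pred i | (x, i) \in P]|%:R :> R.
    have : (deg X x <= #|[pred i | (x, i) \in P]| + C0)%N by rewrite addnC -leq_subLR.
    by rewrite -(ler_nat R) natrD; lra.
  have xk := Ak x xA; rewrite /f; case: ifP => xb.
    have /forallP /(_ x) := G1; rewrite xk eqxx /= => h.
    have h1 : n%:R <= M%:R * (deg X x)%:R :> R by rewrite -natrM ler_nat.
    have h2 : 2 * M%:R * C0%:R <= n%:R :> R.
      rewrite -!natrM ler_nat; apply: leq_trans hC.
      have -> : (2 * M * C0 = M * C0 * 2)%N by rewrite -mulnA mulnC.
      by rewrite leq_mul2l add1n ltnS muln_gt0 M0 orbT.
    have h3 : M%:R * ((deg X x)%:R - C0%:R) <= M%:R * #|[pred i | (x, i) \in P]|%:R :> R.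
      by rewrite ler_pM2l.
    have h4 : p * k%:R <= n%:R.
      have : k%:R <= n%:R :> R by rewrite ler_nat.
      have : p * k%:R <= 1 * k%:R by rewrite ler_wpM2r.
      lra.
    have h5 : 0 <= C0%:R :> R by [].
    have he : 0 <= eps * n%:R by rewrite mulr_ge0.
    rewrite /Lam /w; lra.
  have : `|(deg X x)%:R - p * #|x|%:R| <= eps * n%:R by move/negbT: xb; rewrite inE -leNgt.
  rewrite xk ler_norml /Lam => /andP[h _]; lra.
have up : \sum_(e in P) f e.1 <= (p * k'%:R + eps * n%:R + w * C0%:R) * #|N|%:R.
  pose Q := cpl N :\: bad p eps (cpl X).
  have PQ e : e \in P -> (flip e).1 \in Q.
    rewrite inE => /and4P[eA ee eX eb]; rewrite in_setD eb /= mem_cpl setCK.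
    exact: mem_nbr.
  rewrite (partition_big (fun e => (flip e).1) (fun x => x \in Q)) //=.
  have -> : #|N| = #|cpl N| by rewrite card_cpl.
  have U0 : 0 <= p * k'%:R + eps * n%:R + w * C0%:R.
    by rewrite !addr_ge0 // mulr_ge0 //; lra.
  apply: (@le_trans _ _ (\sum_(x in Q) (p * k'%:R + eps * n%:R + w * C0%:R))); last first.
    rewrite sumr_const -[leLHS]mulr_natr ler_wpM2l // ler_nat subset_leq_card //.
    exact: subsetDl.
  apply: ler_sum => x /setDP[xN xb].
  have xk' : #|x| = k' by exact: card_cpl_nbr_elt xN.
  pose F1 := [set e in P | (flip e).1 == x].
  pose F2 := [set e in F1 | e.1 \in bad p eps X].
  have F1P e : e \in F1 -> [/\ e.2 \in x, ~: (x :\ e.2) = e.1 & e.1 \in A].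
    rewrite !inE => /andP[/and4P[eA ee _ _] /eqP <-]; rewrite /flip /= setC_D1 setU11.
    by rewrite setU1K ?inE ?negbK // setCK.
  have inj : {in F1 &, injective (fun e : pt * 'I_n => e.2)}.
    move=> [y i] [y' j] /F1P[/= _ <- _] /F1P[/= _ <- _] ->; by [].
  have c1 : (#|F1| <= deg (cpl X) x)%N.
    rewrite -(card_in_imset inj); apply: subset_leq_card.
    apply/subsetP => _ /imsetP[e /F1P[h1 h2 h3] ->]; rewrite inE h1 mem_cpl h2.
    exact: (subsetP AX).
  have c2 : (#|F2| <= C0)%N.
    have inj2 : {in F2 &, injective (fun e : pt * 'I_n => e.2)}.
      by move=> e e' /setIdP[h _] /setIdP[h' _]; exact: inj.
    apply: leq_trans (bad_nbrs x G5); rewrite -(card_in_imset inj2).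
    apply: subset_leq_card; apply/subsetP => _ /imsetP[e /setIdP[/F1P[h1 h2 h3] h4] ->].
    by rewrite inE h1 h2.
  apply: (@le_trans _ _ (#|F1|%:R + w * #|F2|%:R)).
    have -> : #|F1|%:R = \sum_(e in F1) 1 :> R by rewrite -sum1_card natr_sum.
    have -> : w * #|F2|%:R = \sum_(e in F1) (if e.1 \in bad p eps X then w else 0).
      rewrite -big_mkcondr /= (eq_bigl (fun e => e \in F2)) => [|e]; last by rewrite [in RHS]in_set.
      by rewrite sumr_const mulr_natr.
    rewrite (eq_bigl (fun e => e \in F1)) => [|e]; last by rewrite [in RHS]in_set.
    rewrite -big_split /=; apply: ler_sum => e _.
    by rewrite /f; case: ifP => _; rewrite ?addr0 // lerDr.
  apply: lerD; last by rewrite ler_wpM2l // ler_nat.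
  apply: (@le_trans _ _ (deg (cpl X) x)%:R); first by rewrite ler_nat.
  move: xb; rewrite inE -leNgt xk' ler_norml => /andP[_ h]; lra.
have a0 : 0 < #|A|%:R :> R by rewrite ltr0n card_gt0.
have U0 : 0 <= p * k'%:R + eps * n%:R + w * C0%:R.
  by rewrite !addr_ge0 // mulr_ge0 //; lra.
have : (p * k'%:R + eps * n%:R + w * C0%:R) * #|N|%:R <=
    (p * k'%:R + eps * n%:R + w * C0%:R) * #|A|%:R.
  by rewrite ler_wpM2l // ler_nat.
move=> /(le_trans (le_trans low up)); rewrite ler_pM2r //.
have h1 : M%:R * C0%:R * (1 + 2 * M%:R) <= n%:R :> R.
  by rewrite -[1]/(1%:R) -!natrM -natrD -!natrM ler_nat.
have kk : (k' <= k)%N.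
  rewrite leqNgt; apply/negP => /ltnW; rewrite -subn_eq0 => /eqP h.
  by move: far; rewrite -/k' h muln0.
have h2 : 2 * n%:R < M%:R * (k%:R - k'%:R) :> R.
  by rewrite -natrB // -!natrM ltr_nat.
have h3 : M%:R * (k%:R - k'%:R) * (3 / 4) <= M%:R * (k%:R - k'%:R) * p.
  by apply: ler_wpM2l; lra.
have h4 : 4 * M%:R * eps * n%:R <= 1 * n%:R by rewrite ler_wpM2r.
(* After multiplication by M the gap p (k - k') exceeds 3n/2, while the degree errors total at most
   n/2 and the terms with [C0] at most n. *)
rewrite /Lam /w -(ler_pM2l MR); lra.
Qed.

End Far.

(** * Edge isoperimetry between consecutive levels, by averaging over permutations *)

Section Isoperimetry.
Variables (n k : nat).
Local Notation pt := {set 'I_n}.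
Local Notation fam := {set {set 'I_n}}.
Implicit Types (S : fam) (x y : pt) (s : 'S_n).

Lemma card_perm_imset s x : #|s @: x| = #|x|.
Proof. exact/card_imset/perm_inj. Qed.

Lemma imset_perm_D1 s x i : s @: (x :\ i) = (s @: x) :\ s i.
Proof.
apply/setP => z; apply/imsetP/setD1P => [[w /setD1P[wi wx] ->]|[zs /imsetP[w wx zw]]].
  by rewrite (inj_eq perm_inj) imset_f.
by exists w => //; apply/setD1P; split => //; apply: contraNneq zs => <-; rewrite zw.
Qed.

Lemma imset_permM s t x : (s * t)%g @: x = t @: (s @: x).
Proof. by rewrite -imset_comp; apply: eq_imset => z; rewrite permM. Qed.

Lemma imset_perm_inj s : injective (fun x => s @: x).
Proof. exact/imset_inj/perm_inj. Qed.

(** Permutations act transitively on pairs of a set and one of its elements. List the chosen element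
    first, then the rest of the set, then its complement, and match the two lists position by
    position. *)
Lemma perm_flag x y (i j : 'I_n) : #|x| = #|y| -> i \in x -> j \in y ->
  exists s : 'S_n, s @: x = y /\ s i = j.
Proof.
move=> xy ix jy.
pose l (z : pt) (a : 'I_n) := a :: enum (z :\ a) ++ enum (~: z).
have ul (z : pt) a : a \in z -> uniq (l z a).
  move=> az; rewrite /= mem_cat !mem_enum !inE eqxx az /= cat_uniq !enum_uniq andbT /=.
  apply/hasPn => b; rewrite !mem_enum !inE => /negbTE ->; by rewrite andbF.
have sl (z : pt) a : a \in z -> size (l z a) = n.
  move=> az; rewrite /= size_cat -!cardE.
  by have := cardsC z; rewrite (cardsD1 a z) az add1n card_ord addSn.
pose f (a : 'I_n) := nth j (l y j) (index a (l x i)).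
have mem_l a : a \in l x i.
  rewrite /= inE mem_cat !mem_enum !inE; case: (a == i) => //=.
  by case: (a \in x).
have idx a : (index a (l x i) < size (l y j))%N.
  by rewrite (sl y j jy) -[X in (_ < X)%N](sl x i ix) index_mem mem_l.
have f_inj : injective f.
  move=> a b /eqP; rewrite (nth_uniq j (idx a) (idx b) (ul y j jy)) => /eqP e.
  by rewrite -(nth_index i (mem_l a)) e nth_index.
have fi : f i = j by rewrite /f /= eqxx.
exists (perm f_inj); split; last by rewrite permE.
apply/eqP; rewrite eqEcard card_perm_imset xy leqnn andbT.
apply/subsetP => _ /imsetP[a ax ->]; rewrite permE.
have [->|ai] := eqVneq a i; first by rewrite fi.
have am : a \in enum (x :\ i) by rewrite mem_enum !inE ai.
rewrite /f /= eq_sym (negbTE ai) /= index_cat am nth_cat.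
have cc : size (enum (x :\ i)) = size (enum (y :\ j)).
  rewrite -!cardE; have := cardsD1 i x; have := cardsD1 j y.
  by rewrite ix jy !add1n xy => -> [].
have lt : (index a (enum (x :\ i)) < size (enum (y :\ j)))%N by rewrite -cc index_mem.
rewrite lt; have := mem_nth j lt; rewrite mem_enum !inE => /andP[_].
by [].
Qed.

Variables (S S' : fam).
Hypothesis Sk : forall x, x \in S -> #|x| = k.
Hypothesis k_gt0 : (0 < k)%N.
Local Notation L := (layer n k).

Definition cross_set : {set pt * 'I_n} :=
  [set e : pt * 'I_n | [&& #|e.1| == k, e.2 \in e.1 & (e.1 \in S) != (e.1 :\ e.2 \in S')]].

(** The permutations that carry the edge from [x] to [x :\ i] into the boundary; by transitivity
    their number is the same for all edges between the two levels. *)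
Definition cross_perms x i := [set s : 'S_n | (s @: x \in S) != (s @: (x :\ i) \in S')].

Definition split_perms x y := [set s : 'S_n | (s @: x \in S) && (s @: y \notin S)].

Lemma card_cross_perms x y i j : #|x| = #|y| -> i \in x -> j \in y ->
  (#|cross_perms x i| <= #|cross_perms y j|)%N.
Proof.
move=> xy ix jy; have [t [<- <-]] := perm_flag xy ix jy.
rewrite -(@card_imset _ _ (fun s => (t^-1 * s)%g)); last exact: mulgI.
apply: subset_leq_card; apply/subsetP => _ /imsetP[s hs ->].
by move: hs; rewrite !in_set -!imset_permM -imset_perm_D1 -imset_permM !mulKVg.
Qed.

Lemma sum_cross_perms :
  (\sum_(e : pt * 'I_n | (#|e.1| == k) && (e.2 \in e.1)) #|cross_perms e.1 e.2|
     <= n`! * #|cross_set|)%N.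
Proof.
rewrite (eq_bigr (fun e : pt * 'I_n => \sum_(s : 'S_n | s \in cross_perms e.1 e.2) 1)%N);
  last by move=> e _; rewrite sum1_card.
rewrite (exchange_big_dep predT) //=.
apply: (@leq_trans (\sum_(s : 'S_n) #|cross_set|)); last by rewrite sum_nat_const card_Sn.
apply: leq_sum => s _; rewrite sum1dep_card.
have inj : injective (fun e : pt * 'I_n => (s @: e.1, s e.2)).
  by move=> [x i] [y j] [/imset_perm_inj -> /perm_inj ->].
rewrite -(card_imset _ inj); apply: subset_leq_card.
apply/subsetP => _ /imsetP[[x i] /= h ->]; move: h; rewrite !in_set /=.
move=> /andP[/andP[/eqP xk xi] h]; rewrite card_perm_imset xk eqxx /=.
by rewrite imset_f //= -imset_perm_D1.
Qed.

(** Turn [x] into [y] by exchanging one element at a time. An exchange passes through two edges, and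
    a permutation that separates the ends must send one of the edges used into the boundary. *)
Lemma split_perms_le c x y : (forall (z : pt) i, #|z| = k -> i \in z -> #|cross_perms z i| <= c)%N ->
  #|x| = k -> #|y| = k -> (#|split_perms x y| <= 2 * c * #|x :\: y|)%N.
Proof.
move=> hc xk yk; move e : #|x :\: y| => m.
elim: m x xk e => [|m IH] x xk e.
  have xy : x \subset y by rewrite -setD_eq0 -cards_eq0 e.
  have -> : x = y by apply/eqP; rewrite eqEcard xy xk yk leqnn.
  rewrite muln0 leqn0 cards_eq0; apply/eqP/setP => s; rewrite !in_set.
  by case: (_ \in S).
have /card_gt0P[i /setDP[ix iy]] : (0 < #|x :\: y|)%N by rewrite e.
have /card_gt0P[j /setDP[jy jx]] : (0 < #|y :\: x|)%N.
  by rewrite cardsD yk setIC -xk -cardsD e.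
pose z := j |: (x :\ i).
have jxi : j \notin x :\ i by rewrite !inE negb_and jx orbT.
have zk : #|z| = k by rewrite /z cardsU1 jxi add1n -xk (cardsD1 i x) ix.
have zj : z :\ j = x :\ i by rewrite /z setU1K.
have ez : #|z :\: y| = m.
  have -> : z :\: y = (x :\: y) :\ i.
    apply/setP => w; rewrite !inE; have [->|_] := eqVneq w j; first by rewrite jy (negbTE jx) andbF.
    by case: (w \in y); case: (w == i); rewrite ?andbF.
  by move: e; rewrite (cardsD1 i) inE iy ix => -[].
apply: (@leq_trans (#|cross_perms x i :|: cross_perms z j| + #|split_perms z y|)).
  apply: leq_trans (_ : #|(cross_perms x i :|: cross_perms z j) :|: split_perms z y| <= _)%N.
    apply: subset_leq_card; apply/subsetP => s; rewrite !in_setU !in_set zj.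
    by case: (s @: x \in S); case: (s @: z \in S); case: (s @: y \in S);
       case: (s @: (x :\ i) \in S').
  by rewrite cardsU leq_subr.
rewrite mulnS leq_add ?IH // mul2n -addnn.
apply: (@leq_trans (#|cross_perms x i| + #|cross_perms z j|)).
  by rewrite cardsU leq_subr.
by rewrite leq_add // hc // /z setU11.
Qed.

(** Count triples of a permutation and two k-sets that it separates. Each permutation separates |S|
    (|L| - |S|) ordered pairs, and each pair is joined by a path of at most 2k edges, all of which
    are equally often sent into the boundary. [S'] is arbitrary, so the bound covers every choice of
    lower family. *)
Lemma isoperimetry : (#|S| * (#|L| - #|S|) <= 2 * #|L| * #|cross_set|)%N.
Proof.
have SL : S \subset L by apply/subsetP => x /Sk xk; rewrite in_set xk.
have [S0|[x0 x0S]] := set_0Vmem S; first by rewrite S0 cards0.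
have x0k := Sk x0S.
have /card_gt0P[i0 i0x] : (0 < #|x0|)%N by rewrite x0k.
pose c := #|cross_perms x0 i0|.
have hc (z : pt) i : #|z| = k -> i \in z -> (#|cross_perms z i| <= c)%N.
  by move=> zk iz; apply: card_cross_perms => //; rewrite zk.
have cE : (#|L| * k * c <= n`! * #|cross_set|)%N.
  apply: leq_trans sum_cross_perms.
  rewrite -(pair_big_dep (fun x : pt => #|x| == k) (fun x i => i \in x)
     (fun x i => #|cross_perms x i|)) /=.
  rewrite -mulnA -sum_nat_const.
  rewrite [leqLHS](eq_bigl (fun x : pt => #|x| == k)) => [|x]; last by rewrite in_set.
  apply: leq_sum => x /eqP xk; rewrite -{1}xk -sum_nat_const; apply: leq_sum => i ix.
  by apply: card_cross_perms => //; rewrite xk.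
have up : (\sum_(x in L) \sum_(y in L) #|split_perms x y| <= #|L| * #|L| * (2 * c * k))%N.
  rewrite -mulnA -sum_nat_const; apply: leq_sum => x xL.
  rewrite -sum_nat_const; apply: leq_sum => y yL.
  have xk : #|x| = k by move: xL; rewrite in_set => /eqP.
  have yk : #|y| = k by move: yL; rewrite in_set => /eqP.
  apply: leq_trans (split_perms_le hc xk yk) _.
  by rewrite leq_mul2l -xk subset_leq_card ?orbT // subsetDl.
have low : (n`! * (#|S| * (#|L| - #|S|)) <= \sum_(x in L) \sum_(y in L) #|split_perms x y|)%N.
  rewrite (eq_bigr (fun x => \sum_(s : 'S_n) \sum_(y in L) (s \in split_perms x y))%N); last first.
    move=> x _; rewrite exchange_big /=; apply: eq_bigr => y _.
    by rewrite -sum1_card big_mkcond; apply: eq_bigr => s _; case: (_ \in _).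
  rewrite exchange_big /= -card_Sn -sum_nat_const; apply: leq_sum => s _.
  have im (T : fam) : T \subset L -> #|[set x in L | s @: x \in T]| = #|T|.
    move=> TL; rewrite -(card_imset _ (@imset_perm_inj s)); apply: eq_card => y.
    apply/imsetP/idP => [[x /setIdP[_ h] ->]//|yT].
    have e : s @: (s^-1%g @: y) = y.
      rewrite -imset_permM mulVg; apply/setP => w.
      by apply/imsetP/idP => [[w' wy ->]|wy]; [rewrite perm1|exists w => //; rewrite perm1].
    exists (s^-1%g @: y) => //; rewrite in_set e yT andbT in_set card_perm_imset.
    by have := subsetP TL _ yT; rewrite in_set.
  rewrite -(im S SL) (_ : (#|L| - _ = #|[set y in L | s @: y \in L :\: S]|)%N); last first.
    by rewrite (im S SL) (im _ (subsetDl _ _)) cardsD (setIidPr SL).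
  rewrite -cardsX -sum1_card big_mkcond /=.
  rewrite pair_big /= [leqRHS]big_mkcond /=; apply: leq_sum => [[x y]] _ /=.
  case: ifP => //; rewrite in_setX /= => /andP[/setIdP[xL xS] /setIdP[yL /setDP[_ yS]]].
  by rewrite xL yL /= in_set xS yS.
have fact0 : (0 < n`!)%N by exact: fact_gt0.
have := leq_trans low up.
have -> : (#|L| * #|L| * (2 * c * k) = 2 * #|L| * (#|L| * k * c))%N.
  by ring.
move=> h; rewrite -(leq_pmul2l fact0); apply: (leq_trans h).
by rewrite [leqRHS]mulnCA leq_mul2l cE orbT.
Qed.

End Isoperimetry.

(** Degrees are at least n/M; [g] n^4 bounds [Gam] from below; [c] n is the number of usable
    detours, outside [K3] n^3 quadruples; [eps] is the tolerance for degrees, with at most [C0]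
    exceptions per ball; [q] is the sampling rate, [K] the allowed deviation per sample point, and
    [e0] the final relative error. *)
Record numeric (R : realType) (n : nat) (p : R) (M K3 C0 : nat) (c g eps q K e0 : R) :
  Prop := Numeric {
  num_p34 : 3 / 4 < p; num_p1 : p <= 1; num_c : 0 < c; num_g : 0 < g;
  num_n : (0 < n)%N; num_eps1 : eps <= 1; num_eps0 : 0 <= eps;
  num_q0 : 0 < q; num_q1 : q <= 1; num_K : 0 <= K; num_M : (12 <= M)%N;
  num_gam : forall x : {set 'I_n}, (n <= 6 * #|x|)%N -> (6 * #|x| <= 5 * n)%N ->
    g * n%:R ^+ 4 <= #|Gam x|%:R;
  num_n3 : (K3 * n ^ 3)%:R <= p * g * n%:R ^+ 4 / 32;
  num_q : 2 * ((n.+1 ^ 4).+1%:R * n%:R ^+ 2) *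
    expR (- (q * p * (g * n%:R ^+ 4) / 64)) <= 1;
  num_C0 : (0 < C0)%N;
  num_C0n : 192 * C0%:R * 16 <= p * g * c * n%:R;
  num_epsc : eps * 192 * 16 <= p * g * c;
  num_e0 : n%:R^-1 + 2 * n%:R * C0%:R * q + 4 * K * q * n%:R ^+ 3 <= e0;
  num_odd : (6144 / (p * g * c) + 10) * e0 + 4 / n%:R <= 1 / 25;
  num_epsM : 4 * M%:R * eps <= 1;
  num_far : (M * C0 * (1 + 2 * M) <= n)%N }.

(** * Expansion near the middle *)

Section Near.
Variables (R : realType) (n : nat) (p : R) (M K3 C0 : nat) (c g eps q K e0 : R).
Local Notation pt := {set 'I_n}.
Local Notation fam := {set {set 'I_n}}.
Hypothesis num : numeric n p M K3 C0 c g eps q K e0.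

Definition regular k (X : fam) := [&& good_deg M k X, good_gam p k X,
  good_path M K3 c k X, good_coarse p q K k X & good_bad p C0 eps X].

Definition midl k := (n <= 6 * k)%N && (6 * k <= 5 * n)%N.

Lemma regular_core (X A B : fam) k : regular k X -> midl k -> midl k.-1 ->
  A \subset X -> (forall x, x \in A -> #|x| = k) -> B \subset X ->
  exists A0 : fam, [/\ #|A0|%:R <= 2 * q * #|A|%:R,
  `|\sum_(x in A :\: thin p X A B M eps) (p * k%:R - (deg X x)%:R : R)| <=
     #|cut_edges k X A B|%:R / 8 + e0 * #|A|%:R &
  (#|A :\: coarse k p q A0| + #|(coarse k p q A0 :&: X) :\: A|)%:R * n%:R <=
     192 / (p * g * c) * #|cut_edges k X A B|%:R + #|A|%:R / n%:R].
Proof.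
case: num => p34 p1 c0 g0 n0 e1 e00 q0 q1 K0 _ hg h3 hq C00 hC he he0 _ _ _.
move=> /and5P[X1 X2 X3 X4 X5] /andP[m1 m2] /andP[m3 m4] AX Ak BX.
have p0 : 0 < p by lra.
have Hg (x : pt) : #|x| = k -> g * n%:R ^+ 4 <= #|Gam x|%:R.
  by move=> xk; apply: hg; rewrite xk.
have Hg' (x : pt) : #|x| = k.-1 -> g * n%:R ^+ 4 <= #|Gam x|%:R.
  by move=> xk; apply: hg; rewrite xk.
exact: (core_bound p0 p1 c0 g0 n0 e00 q0 q1 K0 Hg Hg' h3 hq C00 hC he he0
  X1 X2 X3 X4 X5 AX Ak BX).
Qed.

Variables (X A : fam) (k : nat).
Hypothesis AX : A \subset X.
Hypothesis Ak : forall x, x \in A -> #|x| = k.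
Hypotheses (k_gt0 : (0 < k)%N) (k_len : (k <= n)%N).
Local Notation N := (nbr X A).
Local Notation k' := (n - k).+1.
Local Notation E := (#|cut_edges k' (cpl X) (cpl N) (cpl A)|).
Hypotheses (mk : midl k) (mk1 : midl k.-1) (mk' : midl k') (mk1' : midl k'.-1).
Hypotheses (reg : regular k X) (reg' : regular k' (cpl X)).

(** [regular_core] is applied to (A, N) in X and to (N, A) in the complement. Both sums contain the
    number of edges between A and N, which cancels. Counted from N, the cut appears as a gain E;
    half of it pays for the thin sets and two eighths for the errors, which leaves E/4. *)
Lemma near_core : exists A0 N0 : fam, [/\
  #|A0|%:R <= 2 * q * #|A|%:R /\ #|N0|%:R <= 2 * q * #|N|%:R,
  (#|A :\: coarse k p q A0| + #|(coarse k p q A0 :&: X) :\: A|)%:R * n%:R <=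
     192 / (p * g * c) * E%:R + #|A|%:R / n%:R,
  (#|cpl N :\: coarse k' p q N0| + #|(coarse k' p q N0 :&: cpl X) :\: cpl N|)%:R * n%:R <=
     192 / (p * g * c) * E%:R + #|N|%:R / n%:R &
  E%:R / 4 - e0 * (#|A|%:R + #|N|%:R) <= p * (k'%:R * #|N|%:R - k%:R * #|A|%:R)].
Proof.
have NX : N \subset X by exact: nbr_sub.
have [A0 [a1 a2 a3]] := regular_core reg mk mk1 AX Ak NX.
have NX' : cpl N \subset cpl X by rewrite cpl_sub.
have AX' : cpl A \subset cpl X by rewrite cpl_sub.
have Nk' x : x \in cpl N -> #|x| = k' by exact: card_cpl_nbr_elt.
have [N0 [b1 b2 b3]] := regular_core reg' mk' mk1' NX' Nk' AX'.
rewrite card_cpl in b1 b2 b3.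
(* All lower neighbours in X of a set of A lie in N, and by [good_deg] there are at least n/M of
   them. *)
have thinA : thin p X A N M eps = set0.
  apply/setP => x; rewrite !in_set; apply/negP => /and3P[xA _].
  rewrite down_in_nbr // ltnNge; case/and5P: reg => /forallP /(_ x) G _ _ _ _.
  by move: G; rewrite (Ak xA) eqxx /= => ->.
rewrite thinA setD0 in a2.
have cutle : #|cut_edges k X A N|%:R <= E%:R :> R by rewrite ler_nat card_cut_flip.
have pgc : 0 < p * g * c.
  by case: num => p34 p1 c0 g0 *; rewrite !mulr_gt0 //; lra.
exists A0, N0; split => //.
  apply: (le_trans a3); rewrite lerD2r ler_wpM2l // divr_ge0 // ltW //.
move: b2; set T := thin _ _ _ _ _ _ => b2.
have eE : E%:R = \sum_(x in cpl N) ((deg (cpl X) x)%:R - (down_in (cpl A) x)%:R) :> R.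
  rewrite card_cut_nbr // natr_sum; apply: eq_bigr => x xN; rewrite natrB //.
  apply: subset_leq_card; apply/subsetP => i; rewrite !in_set => /andP[-> h] /=.
  by apply: (subsetP _ _ h); rewrite cpl_sub.
(* Only E/2 is claimed so that thin sets can be absorbed: there [down_in] is at most n/12 <= k'/2,
   by M >= 12 and n <= 6 k', so 3k'/4 - down_in is at least half of k' - down_in. *)
have low : \sum_(x in cpl N :\: T) (p * k'%:R - (deg (cpl X) x)%:R) + E%:R / 2 <=
   \sum_(x in cpl N) (p * k'%:R - (down_in (cpl A) x)%:R).
  have -> : \sum_(x in cpl N :\: T) (p * k'%:R - (deg (cpl X) x)%:R) =
    \sum_(x in cpl N) (if x \notin T then p * k'%:R - (deg (cpl X) x)%:R else 0).
    rewrite -big_mkcondr /=; apply: eq_bigl => x; by rewrite in_setD andbC.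
  rewrite eE mulr_suml -big_split /=; apply: ler_sum => x xN.
  have h1 : (down_in (cpl A) x)%:R <= (deg (cpl X) x)%:R :> R.
    rewrite ler_nat; apply: subset_leq_card; apply/subsetP => i; rewrite !in_set => /andP[-> h] /=.
    by apply: (subsetP _ _ h); rewrite cpl_sub.
  case: ifP => [_|/negbFE xT]; first by lra.
  have h2 : (deg (cpl X) x)%:R <= k'%:R :> R.
    have xk : #|x| = k' by exact: card_cpl_nbr_elt xN.
    by rewrite ler_nat -xk; apply: subset_leq_card; apply/subsetP => i; rewrite in_set => /andP[].
  have h3 : 12 * (down_in (cpl A) x)%:R <= n%:R :> R.
    move: xT; rewrite in_set => /and3P[_ _ hlt].
    rewrite -natrM ler_nat; apply: leq_trans (ltnW hlt).
    by rewrite leq_mul2r; case: num => *; apply/orP; right.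
  have h4 : n%:R <= 6 * k'%:R :> R by rewrite -natrM ler_nat; case/andP: mk'.
  have h5 : 3 / 4 * k'%:R <= p * k'%:R by rewrite ler_wpM2r //; case: num => *; exact: ltW.
  lra.
have sumA : \sum_(x in A) (p * k%:R - (deg X x)%:R) =
   p * k%:R * #|A|%:R - (\sum_(x in A) deg X x)%N%:R.
  by rewrite sumrB sumr_const natr_sum -[X in X - _ = _]mulr_natr.
have sumN : \sum_(x in cpl N) (p * k'%:R - (down_in (cpl A) x)%:R) =
   p * k'%:R * #|N|%:R - (\sum_(x in A) deg X x)%N%:R.
  by rewrite sumrB sumr_const -(sum_down_in X A) natr_sum card_cpl -[X in X - _ = _]mulr_natr.
rewrite sumN in low; rewrite sumA in a2.
move: a2 b2; rewrite !ler_norml => /andP[_ a2] /andP[b2 _].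
lra.
Qed.

(** If |N| <= |A|, the difference of the levels makes the right side of [near_core] at most -3|A|/4,
    while the left side is at least -2 e0 |A|, and e0 <= 1/250. *)
Lemma hall_near : ((n - k).+1 < k)%N -> A != set0 -> (#|A| < #|N|)%N.
Proof.
move=> kk A0; rewrite ltnNge; apply/negP => NA.
have [_ [_ [_ _ _ h]]] := near_core.
have a0 : 0 < #|A|%:R :> R by rewrite ltr0n card_gt0.
have h1 : #|N|%:R <= #|A|%:R :> R by rewrite ler_nat.
have h2 : k'%:R + 1 <= k%:R :> R by rewrite natr1 ler_nat.
have E0 : 0 <= E%:R :> R by [].
have k0 : 0 <= k'%:R :> R by [].
case: num => p34 p1 c0 g0 n0 _ _ q0 _ K0 _ _ _ _ C00 _ _ he0 hodd _ _.
have pgc : 0 < p * g * c by rewrite !mulr_gt0 //; lra.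
have he0' : 0 <= e0.
  apply: le_trans he0; rewrite !addr_ge0 ?invr_ge0 ?mulr_ge0 ?exprn_ge0 //; exact: ltW.
have e025 : e0 <= 1 / 250.
  have : 0 <= 6144 / (p * g * c) * e0 by rewrite mulr_ge0 // divr_ge0 // ltW.
  have : 0 <= 4 / n%:R :> R by rewrite divr_ge0.
  lra.
have h3 : k'%:R * #|N|%:R - k%:R * #|A|%:R <= - #|A|%:R :> R.
  have : k'%:R * #|N|%:R <= k'%:R * #|A|%:R :> R by rewrite ler_wpM2l.
  have : (k'%:R + 1) * #|A|%:R <= k%:R * #|A|%:R :> R by rewrite ler_wpM2r.
  lra.
have h4 : p * (k'%:R * #|N|%:R - k%:R * #|A|%:R) <= p * - #|A|%:R.
  by rewrite ler_wpM2l //; lra.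
have h5 : p * - #|A|%:R <= 3 / 4 * - #|A|%:R by nra.
have h6 : e0 * (#|A|%:R + #|N|%:R) <= 1 / 250 * (#|A|%:R + #|N|%:R).
  by rewrite ler_wpM2r // addr_ge0.
lra.
Qed.

End Near.

(** The closing computation of [hall_middle], with cardinalities as real variables. When both levels
    have the same size, b <= a forces E <= 8 e0 a. So the coarse family S, close to A, has few
    boundary edges in X, and by regularity few in the cube; isoperimetry forbids this because S
    fills at most 7/10 of the layer. *)
Lemma middle_arith (R : realFieldType)
    (p q K e0 C1 n a b E t1 t2 sa sb SX S L eo ei xo xi cr k : R) :
  3 / 4 < p -> 0 < q -> 0 <= K -> 1 <= n -> 0 <= C1 -> 0 <= e0 -> 0 <= k ->
  0 <= t1 -> 0 <= t2 -> 0 <= sa -> 0 <= sb -> 0 <= cr -> 0 <= S -> 0 <= L -> 0 <= E ->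
  4 * K * q * n ^+ 3 <= e0 -> 32 * C1 * e0 + 10 * e0 + 4 * n^-1 <= 1 / 25 ->
  b <= a -> 0 < a -> sa <= 2 * q * a -> sb <= 2 * q * b ->
  t1 * n <= C1 * E + a / n -> t2 * n <= C1 * E + b / n ->
  E / 4 - e0 * (a + b) <= p * (k * b - k * a) ->
  `|SX - p * S| <= K * (sa + sb) * n ^+ 2 ->
  `|xo - p ^+ 2 * eo| <= K * (sa + sb) * n ^+ 3 ->
  `|xi - p ^+ 2 * ei| <= K * (sa + sb) * n ^+ 3 ->
  xo <= (t1 + t2) * n -> xi <= (t1 + t2) * n + E -> cr <= eo + ei ->
  S * (L - S) <= 2 * L * cr -> a <= S + t1 -> SX <= a + t1 -> a <= 6 / 10 * p * L ->
  False.
Proof.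
move=> p34 q0 K0 n1 C10 he0' k0 t10 t20 sa0 sb0 cr0 S0 L0 E0 he hodd ba a0 hsa hsb cA cN ineq.
move=> dS dout dinto inO inI cross isoR Slow' Sup' AL.
have p0 : 0 < p by lra.
have n0 : 0 < n by lra.
have inv0 : 0 <= n^-1 by rewrite invr_ge0 ltW.
have E8 : E <= 8 * e0 * a.
  have h1 : p * (k * b - k * a) <= 0.
    rewrite -mulrBr; apply: mulr_ge0_le0; first exact: ltW.
    by apply: mulr_ge0_le0 => //; rewrite subr_le0.
  have h2 : e0 * (a + b) <= e0 * (2 * a) by apply: ler_wpM2l => //; lra.
  lra.
have C1E : C1 * E <= C1 * (8 * e0 * a) by rewrite ler_wpM2l.
have an : a / n = n^-1 * a by rewrite mulrC.
have invN : b / n <= n^-1 * a by rewrite [leLHS]mulrC ler_wpM2l.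
pose rho := 8 * C1 * e0 + n^-1.
have ra : rho * a = C1 * (8 * e0 * a) + n^-1 * a by rewrite /rho; ring.
have rho4 : 4 * rho + 10 * e0 <= 1 / 25 by rewrite /rho; lra.
have Ce0 : 0 <= C1 * e0 by rewrite mulr_ge0.
have rho0 : 0 <= rho by rewrite /rho; lra.
have T1 : t1 * n <= rho * a by lra.
have T2 : t2 * n <= rho * a by lra.
set s := sa + sb in dS dout dinto.
have s0 : 0 <= s by rewrite addr_ge0.
have ss : s <= 4 * q * a.
  have : 2 * q * b <= 2 * q * a by rewrite ler_wpM2l // mulr_ge0 // ltW.
  rewrite /s; lra.
have K3' : K * s * n ^+ 3 <= e0 * a.
  apply: (@le_trans _ _ ((4 * K * q * n ^+ 3) * a)).
    have : (K * n ^+ 3) * s <= (K * n ^+ 3) * (4 * q * a).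
      by apply: ler_wpM2l => //; apply: mulr_ge0 => //; apply: exprn_ge0; exact: ltW.
    lra.
  by apply: ler_wpM2r => //; exact: ltW.
have K2 : K * s * n ^+ 2 <= K * s * n ^+ 3.
  apply: ler_wpM2l; first exact: mulr_ge0.
  by rewrite [leRHS]exprS ler_peMl // exprn_ge0 // ltW.
move: dS dout dinto; rewrite !ler_norml => /andP[dS _] /andP[dout _] /andP[dinto _].
have pC : cr * p ^+ 2 <= (4 * rho + 10 * e0) * a.
  have : cr * p ^+ 2 <= (eo + ei) * p ^+ 2 by rewrite ler_wpM2r // exprn_ge0 // ltW.
  lra.
have ra100 : rho * a <= 1 / 100 * a by apply: ler_wpM2r; [exact: ltW|lra].
have ea100 : e0 * a <= 1 / 100 * a by apply: ler_wpM2r; [exact: ltW|lra].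
have t1a : t1 <= 1 / 100 * a.
  have : t1 * 1 <= t1 * n by rewrite ler_wpM2l.
  lra.
have Slow : a / 2 <= S by lra.
have Sup : p * S <= 103 / 100 * a by lra.
have SL : S <= 7 / 10 * L.
  rewrite -(ler_pM2l p0).
  have : 0 <= p * L by rewrite mulr_ge0 // ltW.
  lra.
have L1 : 0 < L by lra.
have low : 3 / 10 * S <= 2 * cr.
  rewrite -(ler_pM2r L1).
  have : S * (3 / 10 * L) <= S * (L - S) by rewrite ler_wpM2l //; lra.
  lra.
(* The boundary is at least 3S/20 >= 3a/40. Times 9/16 this is 27a/640, just above the upper bound
   a/25, whence the 1/25 in [numeric]. *)
have p2 : 9 / 16 <= p ^+ 2 by nra.
have : cr * (9 / 16) <= cr * p ^+ 2 by rewrite ler_wpM2l.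
have : (4 * rho + 10 * e0) * a <= 1 / 25 * a by rewrite ler_wpM2r // ltW.
lra.
Qed.

(** * Expansion between the two middle layers of an odd cube *)

Section Middle.
Variables (R : realType) (n : nat) (p : R) (M K3 C0 : nat) (c g eps q K e0 : R).
Local Notation pt := {set 'I_n}.
Local Notation fam := {set {set 'I_n}}.
Hypothesis num : numeric n p M K3 C0 c g eps q K e0.

Lemma Gam_cpl (v : pt) : Gam (~: v) = cpl (Gam v).
Proof.
apply/setP => u; rewrite mem_cpl !in_set.
have ev : #|~: v| = (n - #|v|)%N by rewrite cardsCs setCK card_ord.
have eu : #|~: u| = (n - #|u|)%N by rewrite cardsCs setCK card_ord.
have -> : (#|u| == #|~: v|) = (#|~: u| == #|v|).
  have := card_le_n u; have := card_le_n v; rewrite ev eu => h1 h2.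
  by apply/eqP/eqP => h; [rewrite h subKn|rewrite -h subKn].
have -> : ~: v :\: u = ~: u :\: v by apply/setP => z; rewrite !inE andbC.
case: eqP => //= e; congr (_ == _).
by rewrite !cardsD setIC e.
Qed.

Lemma cpl_coarse k (N0 : fam) : (k <= n)%N ->
  cpl (coarse k p q N0) = coarse (n - k) p q (cpl N0).
Proof.
move=> kn; apply/setP => v; rewrite mem_cpl !in_set Gam_cpl.
have -> : (#|~: v| == k) = (#|v| == (n - k)%N).
  have h := card_le_n v; have -> : #|~: v| = (n - #|v|)%N by rewrite cardsCs setCK card_ord.
  by apply/eqP/eqP => h'; [rewrite -h' subKn|rewrite h' subKn].
rewrite card_cpl; congr (_ && (_ <= _%:R)).
rewrite -[RHS]card_cpl; apply: eq_card => z.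
by rewrite !(mem_cpl, in_setI) setCK.
Qed.

Lemma card_edges_top (T : fam) (Q : {set pt * 'I_n}) :
  (forall e, e \in Q -> e.1 \in T) -> (#|Q| <= #|T| * n)%N.
Proof.
move=> h; apply: (@card_fiber_le _ _ _ _ (fun e : pt * 'I_n => e.1)) => // x xT.
apply: (@card_le_inj _ _ _ (fun e : pt * 'I_n => e.2)); last by rewrite card_ord.
by move=> [y i] [z j]; rewrite !inE /= => /andP[_ /eqP ->] /andP[_ /eqP ->] ->.
Qed.

Lemma card_edges_bottom (T : fam) (Q : {set pt * 'I_n}) :
  (forall e, e \in Q -> e.2 \in e.1 /\ e.1 :\ e.2 \in T) -> (#|Q| <= #|T| * n)%N.
Proof.
move=> h; rewrite -(card_cpl T); apply: (@leq_trans #|[set flip e | e in Q]|).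
  apply: card_flip => e eQ; have [h1 h2] := h e eQ.
  by split => //; apply: imset_f.
apply: card_edges_top => _ /imsetP[e /h[h1 h2] ->].
by rewrite mem_cpl setCK.
Qed.

Lemma card_split (T : finType) (P : {set T}) (b : pred T) :
  #|P| = (#|[set e in P | ~~ b e]| + #|[set e in P | b e]|)%N.
Proof.
rewrite -(cardsID [set e | b e] P) addnC.
by congr addn; apply: eq_card => e; rewrite !inE // andbC.
Qed.

Variables (X A : fam) (k : nat).
Hypothesis AX : A \subset X.
Hypothesis Ak : forall x, x \in A -> #|x| = k.
Hypotheses (k_gt0 : (0 < k)%N) (k_len : (k <= n)%N) (kk : ((n - k).+1 = k)%N).
Local Notation N := (nbr X A).
Hypotheses (mk : midl n k) (mk1 : midl n k.-1).
Local Notation regular := (regular p M K3 C0 c eps q K).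
Hypotheses (reg : regular k X) (reg' : regular k (cpl X)).
Local Notation L := (layer n k).

Lemma hall_middle : A != set0 -> #|A|%:R <= 6 / 10 * p * #|L|%:R -> (#|A| < #|N|)%N.
Proof.
move=> A0 AL; rewrite ltnNge; apply/negP => NA.
have mk2 : midl n (n - k).+1 by rewrite kk.
have mk3 : midl n (n - k).+1.-1 by rewrite kk.
have reg2 : regular (n - k).+1 (cpl X) by rewrite kk.
have [A1 [N1 [[sA sN] cA cN ineq]]] :=
  near_core num AX Ak k_gt0 k_len mk mk1 mk2 mk3 reg reg2.
rewrite kk in cA cN ineq.
set S := coarse k p q A1 in cA; set E := #|cut_edges _ _ _ _| in cA cN ineq.
set t1 := (_ + _)%N in cA; set t2 := (_ + _)%N in cN.
pose S' := coarse k.-1 p q (cpl N1).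
have nk : (n - k = k.-1)%N by rewrite -[in RHS]kk.
have eS' : S' = cpl (coarse k p q N1) by rewrite cpl_coarse // nk.
(* If the upper end is in A, the lower end is in N but outside the coarse family for N; otherwise
   the upper end is in S but not in A. So every such edge meets an approximation error, and a set
   lies on at most n of these edges. *)
have inO : (#|edges_in X (edges_out k S S')| <= (t1 + t2) * n)%N.
  rewrite (card_split _ (fun e => e.1 \in A)).
  rewrite mulnDl; apply: leq_add.
    apply: (@leq_trans (#|(S :&: X) :\: A| * n)); last by rewrite leq_mul2r leq_addl orbT.
    apply: card_edges_top => e; rewrite in_set => /andP[h eA]; move: h.
    rewrite in_set => /and3P[]; rewrite in_set => /and4P[_ _ h1 _] h2 _.
    by rewrite in_setD in_setI eA h1 h2.
  apply: (@leq_trans (#|cpl N :\: coarse k p q N1| * n)); last by rewrite leq_mul2r leq_addr orbT.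
  rewrite -card_cpl; apply: card_edges_bottom => e; rewrite in_set => /andP[h eA]; move: h.
  rewrite in_set => /and3P[]; rewrite in_set => /and4P[_ h1 _ h2] h3 h4; split => //.
  rewrite mem_cpl in_setD [_ \in cpl N]mem_cpl setCK mem_nbr // andbT.
  by move: h2; rewrite eS' mem_cpl.
(* In this direction a third case arises: the upper end is outside A and the lower end in N. These
   are true cut edges and account for the term E. *)
have inI : (#|edges_in X (edges_into k S S')| <= (t1 + t2) * n + E)%N.
  rewrite (card_split _ (fun e => e.1 \in A)) addnC.
  rewrite (card_split [set e in _ | _ \notin A] (fun e => e.1 :\ e.2 \in N)) addnA.
  apply: leq_add.
    rewrite mulnDl; apply: leq_add.
      apply: (@leq_trans (#|A :\: S| * n)); last by rewrite leq_mul2r leq_addr orbT.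
      apply: card_edges_top => e; rewrite in_set => /andP[h eA]; move: h.
      rewrite in_set => /and3P[]; rewrite in_set => /and4P[_ _ h1 _] _ _.
      by rewrite in_setD eA h1.
    apply: (@leq_trans (#|(coarse k p q N1 :&: cpl X) :\: cpl N| * n));
      last by rewrite leq_mul2r leq_addl orbT.
    rewrite -card_cpl; apply: card_edges_bottom => e; rewrite in_set => /andP[h eA]; move: h.
    rewrite in_set => /andP[h _]; move: h.
    rewrite in_set => /and3P[]; rewrite in_set => /and4P[_ h1 _ h2] h3 h4; split => //.
    rewrite mem_cpl in_setD in_setI ![_ \in cpl _]mem_cpl setCK eA h4 andbT /=.
    by move: h2; rewrite eS' mem_cpl.
  apply: (@leq_trans #|cut_edges k X A N|).
    apply: subset_leq_card; apply/subsetP => e; rewrite in_set => /andP[h eN].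
    move: h; rewrite in_set => /andP[h eA]; move: h; rewrite in_set => /and3P[]; rewrite in_set => /and4P[h0 h1 _ h2] h3 h4.
    by rewrite in_set h3 h0 h1 h4 (negbTE eA) eN.
  by rewrite /E -{2}kk; apply: card_cut_flip.
have cross : (#|cross_set k S S'| <= #|edges_out k S S'| + #|edges_into k S S'|)%N.
  apply: (@leq_trans #|edges_out k S S' :|: edges_into k S S'|).
    apply: subset_leq_card; apply/subsetP => e; rewrite in_set => /and3P[h1 h2 h3].
    rewrite in_setU; apply/orP; case E1: (e.1 \in S) h3; case E2: (e.1 :\ e.2 \in S') => // _.
      by left; rewrite in_set h1 h2 E1 E2.
    by right; rewrite in_set h1 h2 E1 E2.
  by rewrite cardsU leq_subr.
have Sk x : x \in S -> #|x| = k by rewrite in_set => /andP[/eqP].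
have iso := isoperimetry S' Sk k_gt0.
have Sle : (#|S| <= #|L|)%N.
  by apply: subset_leq_card; apply/subsetP => x /Sk xk; rewrite in_set xk.
case: num => p34 p1 c0 g0 n0 _ _ q0 _ K0 _ _ _ _ _ _ _ he0 hodd _ _.
have p0 : 0 < p by apply: lt_trans p34; rewrite divr_gt0.
have pgc : 0 < p * g * c by rewrite !mulr_gt0.
have nR : 0 < n%:R :> R by rewrite ltr0n.
have C10 : 0 <= 192 / (p * g * c) by apply: divr_ge0 => //; exact: ltW.
have Kq0 : 0 <= 4 * K * q * n%:R ^+ 3.
  by apply: mulr_ge0; rewrite ?exprn_ge0 //; apply: mulr_ge0; [by rewrite !mulr_ge0|exact: ltW].
have Cq0 : 0 <= n%:R^-1 + 2 * n%:R * C0%:R * q.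
  by apply: addr_ge0; rewrite ?invr_ge0 //; apply: mulr_ge0; [by rewrite !mulr_ge0|exact: ltW].
have he1 : 4 * K * q * n%:R ^+ 3 <= e0 by apply: le_trans he0; rewrite lerDr.
have he2 : 0 <= e0 by exact: le_trans he1.
have hodd' : 32 * (192 / (p * g * c)) * e0 + 10 * e0 + 4 * n%:R^-1 <= 1 / 25.
  apply: le_trans hodd; rewrite le_eqVlt; apply/orP; left; apply/eqP.
  by field; rewrite !gt_eqF.
case/and5P: reg => _ _ _ /forallP /(_ A1) /forallP /(_ (cpl N1)) /and3P[] + + + _.
rewrite -/S -/S' /deviation card_cpl natrD => dS dout dinto.
apply: (@middle_arith R p q K e0 (192 / (p * g * c)) n%:R #|A|%:R #|N|%:R E%:R t1%:R t2%:R
  #|A1|%:R #|N1|%:R #|S :&: X|%:R #|S|%:R #|L|%:R #|edges_out k S S'|%:R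
  #|edges_into k S S'|%:R #|edges_in X (edges_out k S S')|%:R
  #|edges_in X (edges_into k S S')|%:R #|cross_set k S S'|%:R k%:R) => //.
- by rewrite ler1n.
- by rewrite ler_nat.
- by rewrite ltr0n card_gt0.
- by rewrite -natrD -natrM ler_nat.
- by rewrite -natrD -natrM -natrD ler_nat.
- by rewrite -natrD ler_nat.
- by rewrite -natrB // -!natrM ler_nat.
- rewrite -natrD ler_nat -(cardsID S A) leq_add //; first by rewrite subset_leq_card // subsetIr.
  exact: leq_addr.
- rewrite -natrD ler_nat -(cardsID A (S :&: X)) leq_add //.
    by rewrite subset_leq_card // subsetIr.
  exact: leq_addl.
Qed.

End Middle.

(** * Growth estimates *)

Section Asymptotics.
Variable R : realType.

(** Raising b n <= exp(b n) to the power a + 1, with b = h/(a + 1), leaves one spare factor n to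
    absorb the constant. *)
Lemma poly_le_exp (a : nat) (C h : R) : 0 < h ->
  exists n0, forall n, (n0 <= n)%N -> C * n%:R ^+ a <= expR (h * n%:R).
Proof.
move=> h0; pose b := h / a.+1%:R.
have b0 : 0 < b by rewrite divr_gt0.
have bb0 : 0 < b ^+ a.+1 by rewrite exprn_gt0.
exists (Num.bound `|C / b ^+ a.+1|) => n nn.
have e1 : expR (h * n%:R) = expR (b * n%:R) ^+ a.+1.
  by rewrite -expRM_natr; congr expR; rewrite /b mulrAC divfK // pnatr_eq0.
have e2 : (b * n%:R) ^+ a.+1 <= expR (h * n%:R).
  rewrite e1; apply: lerXn2r; rewrite ?nnegrE ?expR_ge0 //.
    by rewrite mulr_ge0 // ltW.
  by apply: le_trans (expR_ge1Dx _); rewrite lerDr.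
apply: le_trans e2; rewrite exprMn [X in _ <= _ * X]exprSr mulrA mulrAC ler_wpM2r ?exprn_ge0 //.
have hn : C / b ^+ a.+1 < n%:R.
  apply: le_lt_trans (ler_norm _) _.
  by apply: lt_le_trans (archi_boundP (normr_ge0 _)) _; rewrite ler_nat.
by move: hn; rewrite ltr_pdivrMr // mulrC => /ltW.
Qed.

Lemma natr_ge (C : R) : exists n0, forall n, (n0 <= n)%N -> C <= n%:R.
Proof.
exists (Num.bound `|C|) => n nn; apply: le_trans (ler_norm _) _.
by apply: le_trans (ltW (archi_boundP (normr_ge0 _))) _; rewrite ler_nat.
Qed.

Lemma natr_lt_exp2 n : 2 ^+ n <= expR n%:R :> R.
Proof.
rewrite -[n%:R]mul1r expRM_natr lerXn2r ?nnegrE ?expR_ge0 //.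
by have := expR_ge1Dx (1 : R); lra.
Qed.

Lemma card_pts_le n (P : pred {set 'I_n}) : #|P|%:R <= expR n%:R :> R.
Proof.
apply: le_trans (natr_lt_exp2 n); rewrite -natrX ler_nat.
by apply: leq_trans (max_card _) _; rewrite -cardsT -powersetT card_powerset cardsT card_ord.
Qed.

Lemma bin_leq_exp b m : ('C(b, m) <= b ^ m)%N.
Proof.
elim: m => [|m IH]; first by rewrite bin0.
apply: (@leq_trans (m.+1 * 'C(b, m.+1))); first by rewrite leq_pmull.
by rewrite mul_bin_left expnS leq_mul // leq_subr.
Qed.

Lemma exists_subset_card (T : finType) (S : {set T}) m : (m <= #|S|)%N ->
  exists2 S' : {set T}, S' \subset S & #|S'| = m.
Proof.
rewrite -bin_gt0 -cards_draws => /card_gt0P[S']; rewrite in_set => /andP[h /eqP].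
by exists S'.
Qed.

End Asymptotics.

(** * All degrees are linear *)

Section DegreeEvent.
Variables (R : realType) (p : R).
Hypotheses (p34 : 3 / 4 < p) (p1 : p <= 1).

(** Here [l] may be large, unlike in [Hoeffding]: the base must come arbitrarily close to 1 - p. *)
Lemma Pr_deg_small n (x : {set 'I_n}) (M : nat) (l : R) : (0 < M)%N -> 0 <= l ->
  Pr p (fun X : {set {set 'I_n}} => (M * deg X x < n)%N) <=
    expR (l * n%:R / M%:R) * (1 - p + p * expR (- l)) ^+ #|x|.
Proof.
move=> M0 l0; have p0 : 0 <= p by move: p34; lra.
pose U := [set x :\ i | i in x].
have cU : #|U| = #|x|.
  apply: card_in_imset => i j ix jx e; apply/eqP.
  have : i \notin x :\ i by rewrite setD11.
  by rewrite e !inE ix andbT negbK.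
have dU X : deg X x = #|X :&: U|.
  rewrite /deg; have inj : {in [set i in x | x :\ i \in X] &, injective (fun i => x :\ i)}.
    move=> i j /setIdP[ix _] /setIdP[jx _] e; apply/eqP.
    have : i \notin x :\ i by rewrite setD11.
    by rewrite e !inE ix andbT negbK.
  rewrite -(card_in_imset inj); apply: eq_card => y; rewrite in_setI.
  apply/imsetP/andP => [[i /setIdP[ix iX] ->]|[yX /imsetP[i ix e]]].
    by split => //; apply: imset_f.
  by exists i => //; rewrite in_set ix -e.
have MR : 0 < M%:R :> R by rewrite ltr0n.
apply: (@le_trans _ _ (Ex p (fun X => expR (l * n%:R / M%:R) * expR (- l * #|X :&: U|%:R)))).
  apply: Pr_le_Ex => // X; first by rewrite mulr_ge0 ?expR_ge0.
  rewrite dU => h; rewrite -expRD -[leLHS]expR0 ler_expR.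
  have h1 : #|X :&: U|%:R <= n%:R / M%:R :> R.
    by rewrite ler_pdivlMr // mulrC -natrM ler_nat ltnW.
  have := ler_wpM2l l0 h1; rewrite mulrA; lra.
rewrite ExZ Ex_exp_card cU.
by rewrite (_ : 1 + (expR (- l) - 1) * p = 1 - p + p * expR (- l)) //; ring.
Qed.

(** The condition on [k] says k >= n/2 - n/M, so the 2^n sets of the union bound are at most 4^k
    exp(2n/M). The result decays exponentially as soon as 4 rho < 1 and M is large; rho exceeds 1 -
    p only slightly, and here p > 3/4 is decisive. *)
Lemma Pr_good_deg : exists M0 : nat, forall M, (M0 <= M)%N ->
  exists n0, forall n, (n0 <= n)%N -> forall k, ((M - 2) * n <= 2 * M * k)%N ->
  Pr p (fun X : {set {set 'I_n}} => ~~ good_deg M k X) * n%:R ^+ 2 <= 1.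
Proof.
have p0 : 0 <= p by move: p34; lra.
(* This makes 1 - 4 rho equal to (p - 3/4)(4 - 2p), which is positive. *)
have [z ez] : exists z, expR z = (p - 3 / 4) / 2 by apply: expR_total; move: p34; lra.
have z0 : z <= 0 by rewrite -expR_le1 ez; move: p1; lra.
pose l := - z; have l0 : 0 <= l by rewrite oppr_ge0.
pose rho := 1 - p + p * expR (- l).
have erho : rho = 1 - p + p * ((p - 3 / 4) / 2) by rewrite /rho opprK ez.
pose h := 1 - 4 * rho.
have h0 : 0 < h by rewrite /h erho; move: p34 p1; nra.
have rho0 : 0 <= rho by rewrite erho; move: p34 p1; nra.
have rhoh : 4 * rho <= expR (- h).
  have -> : 4 * rho = 1 + - h by rewrite /h; ring.
  exact: expR_ge1Dx.
have [m0 hm0] := natr_ge (8 * (2 + l) / h).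
exists (maxn m0 4) => M; rewrite geq_max => /andP[mM M4].
have MR : 0 < M%:R :> R by rewrite ltr0n (leq_trans _ M4).
have hM : (2 + l) / M%:R <= h / 8.
  have := hm0 M mM; rewrite ler_pdivrMr // => hh.
  rewrite ler_pdivrMr // ; lra.
have [n0 hn0] := poly_le_exp 2 1 (divr_gt0 h0 (ltr0n R 8)).
exists n0 => n nn k hk.
have hk2 : (n <= 4 * k)%N.
  have h1 : (M * n <= M * (4 * k))%N.
    apply: leq_trans (_ : 2 * ((M - 2) * n) <= _)%N.
      rewrite mulnA leq_mul2r; apply/orP; right; clear -M4; lia.
    rewrite (_ : M * (4 * k) = 2 * (2 * M * k))%N; last by ring.
    by rewrite leq_mul2l hk orbT.
  by move: h1; rewrite leq_mul2l => /orP[/eqP M0|//]; move: M4; rewrite M0.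
have pw : 2 ^+ n * rho ^+ k <= expR (2 * n%:R / M%:R) * expR (- h * k%:R).
  have e1 : 2 ^+ n <= 4 ^+ k * expR (2 * n%:R / M%:R) :> R.
    apply: (@le_trans _ _ (2 ^+ (2 * k + (n - 2 * k)))).
      by rewrite ler_eXn2l ?ltr1n // -leq_subLR.
    rewrite exprD exprM -[2 ^+ 2]/(2 ^+ 2) (_ : 2 ^+ 2 = 4 :> R); last by rewrite expr2; lra.
    rewrite ler_wpM2l ?exprn_ge0 //; apply: le_trans (natr_lt_exp2 R _) _.
    rewrite ler_expR ler_pdivlMr //; rewrite -!natrM ler_nat.
    by clear -hk M4; nia.
  apply: (@le_trans _ _ (4 ^+ k * expR (2 * n%:R / M%:R) * rho ^+ k)).
    by rewrite ler_wpM2r ?exprn_ge0.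
  rewrite mulrAC -exprMn mulrC ler_wpM2l ?expR_ge0 // expRM_natr.
  by rewrite lerXn2r ?nnegrE ?expR_ge0 // mulr_ge0.
pose b := expR (l * n%:R / M%:R) * rho ^+ k.
have U : Pr p (fun X : {set {set 'I_n}} => ~~ good_deg M k X) <= 2 ^+ n * b.
  pose P := [pred x : {set 'I_n} | #|x| == k].
  apply: (@le_trans _ _ (#|P|%:R * b)).
    apply: (@Pr_union_le R n p p0 p1 _ P _ (fun x X => (M * deg X x < n)%N) _) => [X|x /eqP xk].
      rewrite negb_forall => /existsP[x]; rewrite negb_imply -ltnNge => /andP[xk hx].
      by exists x.
    by rewrite /b -xk Pr_deg_small // (leq_trans _ M4).
  apply: ler_wpM2r; first by rewrite mulr_ge0 ?expR_ge0 ?exprn_ge0.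
  rewrite -natrX ler_nat.
  by apply: leq_trans (max_card _) _; rewrite -cardsT -powersetT card_powerset cardsT card_ord.
apply: (@le_trans _ _ (2 ^+ n * b * n%:R ^+ 2)); first by rewrite ler_wpM2r ?exprn_ge0.
have := hn0 n nn; rewrite mul1r => hn2.
apply: (@le_trans _ _ (2 ^+ n * b * expR (h / 8%:R * n%:R))).
  by rewrite ler_wpM2l // mulr_ge0 ?exprn_ge0 // mulr_ge0 ?expR_ge0 ?exprn_ge0.
have -> : 2 ^+ n * b * expR (h / 8%:R * n%:R) =
  (2 ^+ n * rho ^+ k) * (expR (l * n%:R / M%:R) * expR (h / 8%:R * n%:R)) by rewrite /b; ring.
apply: (@le_trans _ _ ((expR (2 * n%:R / M%:R) * expR (- h * k%:R)) *
   (expR (l * n%:R / M%:R) * expR (h / 8%:R * n%:R)))).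
  by rewrite ler_wpM2r // mulr_ge0 ?expR_ge0.
rewrite -!expRD -[leRHS]expR0 ler_expR.
have hk4 : n%:R <= 4 * k%:R :> R by rewrite -natrM ler_nat.
have h1 : h * n%:R <= h * (4 * k%:R) by rewrite ler_wpM2l // ltW.
have h2 : (2 + l) / M%:R * n%:R <= h / 8 * n%:R by rewrite ler_wpM2r.
have -> : 2 * n%:R / M%:R + - h * k%:R + (l * n%:R / M%:R + h / 8%:R * n%:R) =
  (2 + l) / M%:R * n%:R - h * k%:R + h / 8 * n%:R by ring.
lra.
Qed.

End DegreeEvent.

(** * Neighbourhoods at distance two and layer sizes *)

Section GammaEvents.
Variables (R : realType) (p : R).
Hypotheses (p34 : 3 / 4 < p) (p1 : p <= 1).

(** Both the set and its complement have j >= n/6 elements, and a j-set has at least j^2/4 >=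
    n^2/144 pairs; 20736 is the square of 144. *)
Lemma card_Gam_mid n (x : {set 'I_n}) : (12 <= n)%N ->
  (n <= 6 * #|x|)%N -> (6 * #|x| <= 5 * n)%N ->
  1 / 20736 * n%:R ^+ 4 <= #|Gam x|%:R :> R.
Proof.
move=> n12 h1 h2.
have bin (j : nat) : (n <= 6 * j)%N -> n%:R ^+ 2 / 144 <= 'C(j, 2)%:R :> R.
  move=> hj; have j2 : (2 <= j)%N by clear -hj n12; lia.
  have e : ('C(j, 2) * 2 = j * j.-1)%N by rewrite mulnC -mul_bin_diag bin1.
  have e2 : 'C(j, 2)%:R * 2 = j%:R * (j%:R - 1) :> R.
    by rewrite -natrM e natrM -subn1 natrB // ltnW.
  have hR : n%:R <= 6 * j%:R :> R by rewrite -natrM ler_nat.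
  have jR : 2 <= j%:R :> R by rewrite ler_nat.
  have : n%:R ^+ 2 <= (6 * j%:R) ^+ 2 :> R by rewrite lerXn2r ?nnegrE ?mulr_ge0.
  nra.
have b1 := bin _ h1.
have b2 : n%:R ^+ 2 / 144 <= 'C(n - #|x|, 2)%:R :> R by apply: bin; clear -h1 h2; lia.
apply: (@le_trans _ _ ('C(#|x|, 2) * 'C(n - #|x|, 2))%:R); last by rewrite ler_nat card_Gam_ge.
have s0 : 0 <= n%:R ^+ 2 / 144 :> R by rewrite divr_ge0 ?exprn_ge0.
rewrite natrM; apply: le_trans (ler_pM s0 s0 b1 b2).
rewrite le_eqVlt; apply/orP; left; apply/eqP.
by field.
Qed.

(** The tail is exponential in |Gam x|, of order n^4, so the union over 2^n sets costs nothing. *)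
Lemma Pr_good_gam (g : R) : 0 < g -> exists n0, forall n, (n0 <= n)%N -> forall k,
  (forall x : {set 'I_n}, #|x| = k -> g * n%:R ^+ 4 <= #|Gam x|%:R) ->
  Pr p (fun X : {set {set 'I_n}} => ~~ good_gam p k X) * n%:R ^+ 2 <= 1.
Proof.
move=> g0; have p0 : 0 < p by move: p34; lra.
pose h := p ^+ 2 * g / 2048.
have h0 : 0 < h by rewrite /h divr_gt0 // mulr_gt0 // exprn_gt0.
have [n1 hn1] := natr_ge (2 / h).
have [n2 hn2] := @poly_le_exp R 2 2 1 ltr01.
exists (maxn 1 (maxn n1 n2)) => n; rewrite !geq_max => /and3P[n0 /hn1 h1 /hn2 h2] k Hg.
have nR : 1 <= n%:R :> R by rewrite ler1n.
have hn : 2 * n%:R <= h * n%:R ^+ 4.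
  move: h1; rewrite ler_pdivrMr // => h1.
  have : n%:R ^+ 1 <= n%:R ^+ 3 :> R by rewrite ler_weXn2l.
  rewrite expr1 => h3.
  have : (n%:R * h) * n%:R <= (n%:R ^+ 3 * h) * n%:R.
    by rewrite ler_wpM2r // ler_wpM2r // ltW.
  have : 2 * n%:R <= n%:R * h * n%:R by rewrite ler_wpM2r.
  have -> : n%:R ^+ 3 * h * n%:R = h * n%:R ^+ 4 by ring.
  lra.
apply: (@le_trans _ _ (expR n%:R * (2 * expR (- (2 * n%:R))) * n%:R ^+ 2)).
  rewrite ler_wpM2r ?exprn_ge0 //.
  pose P := [pred x : {set 'I_n} | #|x| == k].
  apply: (@le_trans _ _ (#|P|%:R * (2 * expR (- (2 * n%:R))))); last first.
    by rewrite ler_wpM2r ?card_pts_le // mulr_ge0 ?expR_ge0.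
  apply: (@Pr_union_le R n p (ltW p0) p1 _ P _ (fun x X => p * #|Gam x|%:R / 16 <=
      `|#|Gam x :&: X|%:R - p * #|Gam x|%:R|) _).
    move=> X; rewrite negb_forall => /existsP[x]; rewrite negb_imply -ltNge => /andP[xk hx].
    by exists x => //; rewrite ler_normr; apply/orP; right; lra.
  move=> x /eqP xk; have gx := Hg x xk.
  have G0 : 0 < #|Gam x|%:R :> R.
    by apply: lt_le_trans gx; rewrite mulr_gt0 // exprn_gt0 //; lra.
  apply: le_trans (Hoeffding_card (ltW p0) p1 (lexx _) G0 _ _) _.
  - by rewrite divr_ge0 // mulr_ge0 // ltW.
  - have : p * #|Gam x|%:R <= 1 * #|Gam x|%:R by rewrite ler_wpM2r.
    by move: G0; lra.
  rewrite ler_wpM2l // ler_expR lerN2; apply: (le_trans hn).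
  have -> : (p * #|Gam x|%:R / 16) ^+ 2 / (8 * #|Gam x|%:R) = p ^+ 2 / 2048 * #|Gam x|%:R.
    by field; rewrite gt_eqF.
  have -> : h * n%:R ^+ 4 = p ^+ 2 / 2048 * (g * n%:R ^+ 4) by rewrite /h; ring.
  by rewrite ler_wpM2l // divr_ge0 // exprn_ge0 // ltW.
have -> : expR n%:R * (2 * expR (- (2 * n%:R))) * n%:R ^+ 2 =
  (2 * n%:R ^+ 2) * (expR n%:R * expR (- (2 * n%:R))) :> R by ring.
apply: (@le_trans _ _ (expR (1 * n%:R) * (expR n%:R * expR (- (2 * n%:R))))).
  by rewrite ler_wpM2r // mulr_ge0 ?expR_ge0.
by rewrite -!expRD -[leRHS]expR0 ler_expR; lra.
Qed.

Lemma Pr_layer_large (g : R) : 0 < g -> exists n0, forall n, (n0 <= n)%N -> forall k,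
  (forall x : {set 'I_n}, #|x| = k -> g * n%:R ^+ 4 <= #|Gam x|%:R) ->
  Pr p (fun X : {set {set 'I_n}} =>
    ~~ (#|layer n k :&: X|%:R <= 11 / 10 * p * #|layer n k|%:R)) * n%:R ^+ 2 <= 1.
Proof.
move=> g0; have p0 : 0 < p by move: p34; lra.
pose h := p ^+ 2 * g / 800.
have h0 : 0 < h by rewrite /h divr_gt0 // mulr_gt0 // exprn_gt0.
have [n2 hn2] := @poly_le_exp R 2 2 h h0.
exists (maxn 1 n2) => n; rewrite !geq_max => /andP[n0 /hn2 h2] k Hg.
have nR : 1 <= n%:R :> R by rewrite ler1n.
have [L0|[x xL]] := set_0Vmem (layer n k).
  rewrite (_ : Pr _ _ = 0) ?mul0r // Pr_Ex -[RHS](@Ex_cst R n p 0); apply: eq_Ex => X.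
  by rewrite L0 set0I cards0 mulr0 lexx.
have xk : #|x| = k by move: xL; rewrite in_set => /eqP.
have GL : #|Gam x|%:R <= #|layer n k|%:R :> R.
  rewrite ler_nat subset_leq_card //; apply/subsetP => u; rewrite !in_set xk.
  by case/andP.
set L := #|layer n k|%:R in GL *.
have gx := le_trans (Hg x xk) GL.
have n4 : n%:R <= n%:R ^+ 4 :> R by rewrite -[leLHS]expr1 ler_weXn2l.
have L0 : 0 < L by apply: lt_le_trans gx; rewrite mulr_gt0 // exprn_gt0 //; lra.
apply: (@le_trans _ _ (2 * expR (- (h * n%:R)) * n%:R ^+ 2)).
  rewrite ler_wpM2r ?exprn_ge0 //.
  apply: (@le_trans _ _ (Pr p (fun X : {set {set 'I_n}} =>
     p * L / 10 <= `|#|layer n k :&: X|%:R - p * L|))).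
    apply: Pr_mono => [||X]; [exact: ltW|by []|].
    by rewrite -ltNge => hX; rewrite ler_normr; apply/orP; left; lra.
  apply: le_trans (Hoeffding_card (ltW p0) p1 (lexx _) L0 _ _) _.
  - by rewrite divr_ge0 // mulr_ge0 // ltW.
  - have : p * L <= 1 * L by rewrite ler_wpM2r // ltW.
    by move: L0; lra.
  rewrite ler_wpM2l // ler_expR lerN2.
  have -> : (p * L / 10) ^+ 2 / (8 * L) = p ^+ 2 / 800 * L by field; rewrite gt_eqF.
  apply: (@le_trans _ _ (p ^+ 2 / 800 * (g * n%:R ^+ 4))).
    have -> : p ^+ 2 / 800 * (g * n%:R ^+ 4) = h * n%:R ^+ 4 by rewrite /h; ring.
    by rewrite ler_wpM2l // ltW.
  by rewrite ler_wpM2l // divr_ge0 // exprn_ge0 // ltW.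
have -> : 2 * expR (- (h * n%:R)) * n%:R ^+ 2 = (2 * n%:R ^+ 2) * expR (- (h * n%:R)) :> R by ring.
apply: (@le_trans _ _ (expR (h * n%:R) * expR (- (h * n%:R)))).
  by rewrite ler_wpM2r // expR_ge0.
by rewrite -expRD subrr expR0.
Qed.

End GammaEvents.

(** * Sets of exceptional degree are locally sparse *)

Section BadEvent.
Variables (R : realType) (p : R).
Hypotheses (p34 : 3 / 4 < p) (p1 : p <= 1).

Section Overlap.
Variable n : nat.
Local Notation pt := {set 'I_n}.
Local Notation fam := {set {set 'I_n}}.

Definition down (x : pt) : fam := [set x :\ i | i in x].

Lemma deg_down (X : fam) x : deg X x = #|down x :&: X|.
Proof.
rewrite /deg; have inj : {in [set i in x | x :\ i \in X] &, injective (fun i => x :\ i)}.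
  move=> i j /setIdP[ix _] /setIdP[jx _] e; apply/eqP.
  have : i \notin x :\ i by rewrite setD11.
  by rewrite e !inE ix andbT negbK.
rewrite -(card_in_imset inj); apply: eq_card => y; rewrite in_setI.
apply/imsetP/andP => [[i /setIdP[ix iX] ->]|[/imsetP[i ix e] yX]].
  by split => //; apply: imset_f.
by exists i => //; rewrite in_set ix -e.
Qed.

Lemma down_cap (x x' : pt) : #|x| = #|x'| -> x != x' -> (#|down x :&: down x'| <= 1)%N.
Proof.
move=> c xx'; apply: (@leq_trans #|[set x :&: x']|); last by rewrite cards1.
apply: subset_leq_card; apply/subsetP => y /setIP[/imsetP[i ix ->] /imsetP[j jx' e]].
rewrite in_set1 eqEcard; apply/andP; split.
  by rewrite subsetI {2}e !subD1set.
have lt : (#|x :&: x'| < #|x|)%N.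
  apply: proper_card; rewrite properE subsetIl /=; apply: contra xx' => h.
  by rewrite eqEcard c leqnn andbT; apply: subset_trans h _; exact: subsetIr.
by move: lt; rewrite [X in (_ < X)%N](cardsD1 i x) ix add1n ltnS.
Qed.

(** Two sets of equal size have at most one common lower neighbour, namely their intersection, so
    passing from the union to the sum overcounts by less than |T|^2. *)
Lemma card_bigcup_down (T : fam) (S : fam) k : (forall x, x \in T -> #|x| = k) ->
  (\sum_(x in T) #|down x :&: S| <= #|(\bigcup_(x in T) down x) :&: S| + #|T| ^ 2)%N.
Proof.
move: {2}#|T| (erefl #|T|) => m; elim: m T => [|m IH] T cT Tk.
  by move/eqP: cT; rewrite cards_eq0 => /eqP ->; rewrite big_set0.
have /card_gt0P[x xT] : (0 < #|T|)%N by rewrite cT.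
have cT' : #|T :\ x| = m by move: cT; rewrite (cardsD1 x) xT => -[].
have := IH (T :\ x) cT'; rewrite cT' => IH'.
have /IH' {}IH' : forall y, y \in T :\ x -> #|y| = k by move=> y /setD1P[_ /Tk].
rewrite (big_setD1 x) //= [in leqRHS](big_setD1 x) //= setIUl cT.
set V := \bigcup_(y in T :\ x) down y in IH' *.
have ov : (#|(down x :&: S) :&: (V :&: S)| <= m)%N.
  apply: (@leq_trans #|\bigcup_(y in T :\ x) (down x :&: down y)|).
    apply: subset_leq_card; apply/subsetP => z /setIP[/setIP[zx _] /setIP[/bigcupP[y yT zy] _]].
    by apply/bigcupP; exists y => //; rewrite in_setI zx.
  rewrite -cT' -[#|T :\ x|]sum1_card.
  have small y : y \in T :\ x -> (#|down x :&: down y| <= 1)%N.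
    by move=> /setD1P[yx yT]; apply: down_cap; rewrite ?Tk // eq_sym.
  elim/big_rec2: _ => [|y a U yT h]; first by rewrite cards0.
  by rewrite cardsU (leq_trans (leq_subr _ _)) // leq_add // small.
have e := cardsUI (down x :&: S) (V :&: S).
have : (#|down x :&: S| + #|V :&: S| <= #|down x :&: S :|: V :&: S| + m)%N by rewrite -e leq_add2l.
move=> h2; apply: (@leq_trans (#|down x :&: S| + (#|V :&: S| + m ^ 2))); first by rewrite leq_add2l.
rewrite addnA; apply: (@leq_trans (#|down x :&: S :|: V :&: S| + m + m ^ 2)).
  by rewrite leq_add2r.
by rewrite -addnA leq_add2l; clear; nia.
Qed.

End Overlap.

(** A single bad degree is too likely for a union bound over 2^n sets. Among 2m bad sets in a ball,
    however, m deviate in the same direction; their lower neighbourhoods are nearly disjoint, so the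
    deviations add up to an event of probability at most 2 exp(-4n), while only 2^n times a
    polynomial number of such m-sets exist. *)
Lemma Pr_good_bad (eps : R) : 0 < eps -> eps <= 1 -> exists C0 : nat, (0 < C0)%N /\
  exists n0, forall n, (n0 <= n)%N ->
  Pr p (fun X : {set {set 'I_n}} => ~~ good_bad p C0 eps X) * n%:R ^+ 2 <= 1.
Proof.
move=> e0 e1; have p0 : 0 < p by move: p34; lra.
(* The exponent below is m eps^2 n/32, which has to reach 4n. *)
have [D hD] := natr_ge (128 / eps ^+ 2 + 1).
pose m := maxn 1 D.
have m0 : (0 < m)%N by rewrite leq_max.
have mR : 0 < m%:R :> R by rewrite ltr0n.
have hm : 128 / eps ^+ 2 <= m%:R.
  by have := hD m (leq_maxr _ _); lra.
have hm' : 128 <= m%:R * eps ^+ 2 by rewrite -ler_pdivrMr // exprn_gt0.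
exists (2 * m)%N; split; first by rewrite muln_gt0.
have [n1 hn1] := natr_ge (2 * m%:R / eps).
have [n2 hn2] := @poly_le_exp R (4 * m + 2) (4 * 16 ^+ m) 1 ltr01.
exists (maxn (maxn 1 n1) n2) => n; rewrite !geq_max => /andP[/andP[n0 /hn1 h1] /hn2 h2].
have nR : 1 <= n%:R :> R by rewrite ler1n.
have nm : 2 * m%:R <= eps * n%:R by move: h1; rewrite ler_pdivrMr // [eps * _]mulrC.
pose dev (T X : {set {set 'I_n}}) := m%:R * (eps * n%:R) / 2 <=
  `|#|(\bigcup_(x in T) down x) :&: X|%:R - p * #|\bigcup_(x in T) down x|%:R|.
pose I := [pred uT : {set 'I_n} * {set {set 'I_n}} |
  (uT.2 \subset Bal uT.1) && (#|uT.2| == m)].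
have cI : #|I|%:R <= expR n%:R * (16 ^+ m * n%:R ^+ (4 * m)) :> R.
  have -> : #|I| = (\sum_(u : {set 'I_n}) 'C(#|Bal u|, m))%N.
    rewrite -sum1_card; transitivity (\sum_(u : {set 'I_n})
       \sum_(T : {set {set 'I_n}} | (T \subset Bal u) && (#|T| == m)) 1)%N.
      by rewrite pair_big_dep.
    by apply: eq_bigr => u _; rewrite sum1dep_card cards_draws.
  apply: (@le_trans _ _ (2 ^ n * (16 * n ^ 4) ^ m)%:R); last first.
    rewrite natrM !natrX natrM natrX exprMn -exprM.
    by rewrite ler_wpM2r ?natr_lt_exp2 // mulr_ge0 ?exprn_ge0.
  rewrite ler_nat; apply: (@leq_trans (\sum_(u : {set 'I_n}) (16 * n ^ 4) ^ m)).
    apply: leq_sum => u _; apply: (@leq_trans (#|Bal u| ^ m)).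
      exact: bin_leq_exp.
    rewrite leq_exp2r //; apply: leq_trans (card_Bal u) _.
    rewrite -[16%N]/(2 ^ 4)%N -expnMn leq_exp2r // mul2n -addnn -addn1 leq_add2l //.
  rewrite sum_nat_const leq_mul2r; apply/orP; right.
  by rewrite -cardsT -powersetT card_powerset cardsT card_ord.
have one (T : {set {set 'I_n}}) : (exists k, forall x, x \in T -> #|x| = k) -> #|T| = m ->
    Pr p (dev T) <= 2 * expR (- (4 * n%:R)).
  move=> [k Tk] cT; set V := \bigcup_(x in T) down x.
  have cV : (#|V| <= m * n)%N.
    rewrite -cT -sum_nat_const /V.
    elim/big_ind2: _ => [|x1 x2 y1 y2 g1 g2|x _]; first by rewrite cards0.
      by apply: leq_trans (leq_add g1 g2); rewrite cardsU leq_subr.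
    by apply: leq_trans (leq_imset_card _ _) _; rewrite (leq_trans (max_card _)) // card_ord.
  have nR0 : 0 < n%:R :> R by lra.
  have cVR : #|V|%:R <= m%:R * n%:R :> R by rewrite -natrM ler_nat.
  apply: le_trans (Hoeffding_card (ltW p0) p1 cVR (mulr_gt0 mR nR0) _ _) _.
  - by rewrite divr_ge0 // mulr_ge0 // mulr_ge0 // ltW.
  - have : eps * n%:R <= 1 * n%:R by rewrite ler_wpM2r.
    have mn : 0 <= m%:R * n%:R :> R by rewrite mulr_ge0.
    move=> h3; have : m%:R * (eps * n%:R) <= m%:R * (1 * n%:R) by rewrite ler_wpM2l.
    by move: mn; lra.
  rewrite ler_wpM2l // ler_expR lerN2.
  have -> : (m%:R * (eps * n%:R) / 2) ^+ 2 / (8 * (m%:R * n%:R)) = m%:R * eps ^+ 2 * n%:R / 32.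
    by field; rewrite !gt_eqF.
  have : 128 * n%:R <= m%:R * eps ^+ 2 * n%:R by rewrite ler_wpM2r.
  by lra.
pose I' := [pred uT : {set 'I_n} * {set {set 'I_n}} |
  I uT && [forall x in uT.2, #|x| == #|uT.1|]].
have bnd : Pr p (fun X : {set {set 'I_n}} => ~~ good_bad p (2 * m) eps X) <=
    #|I'|%:R * (2 * expR (- (4 * n%:R))).
  apply: (@Pr_union_le R n p (ltW p0) p1 _ I' _ (fun uT X => dev uT.2 X) _); last first.
    move=> [u T] /= /andP[/andP[_ /eqP cT] /forallP hT]; apply: one => //.
    by exists #|u| => x xT; apply/eqP; have := hT x; rewrite xT.
  move=> X; rewrite negb_forall => /existsP[u]; rewrite -ltnNge => hu.
  pose hi := [set x in Bal u | eps * n%:R < (deg X x)%:R - p * #|x|%:R].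
  pose lo := [set x in Bal u | eps * n%:R < p * #|x|%:R - (deg X x)%:R].
  have sub : (#|Bal u :&: bad p eps X| <= #|hi| + #|lo|)%N.
    apply: (@leq_trans #|hi :|: lo|); last by rewrite cardsU leq_subr.
    apply: subset_leq_card; apply/subsetP => x /setIP[xB]; rewrite in_set ltr_normr opprB.
    by rewrite in_setU => /orP[h|h]; apply/orP; [left|right]; rewrite in_set xB.
  have kB x : x \in Bal u -> #|x| = #|u| by rewrite in_set => /andP[/eqP].
  have cap (T : {set {set 'I_n}}) : T \subset Bal u -> #|T| = m ->
      (m%:R * (eps * n%:R) <= \sum_(x in T) ((deg X x)%:R - p * #|x|%:R) \/
       m%:R * (eps * n%:R) <= \sum_(x in T) (p * #|x|%:R - (deg X x)%:R)) ->
      exists2 uT, I' uT & dev uT.2 X.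
    move=> TB cT hsum; exists (u, T) => /=.
      rewrite TB cT eqxx /=; apply/forallP => x; apply/implyP => xT.
      by apply/eqP/kB/(subsetP TB).
    have Tk x : x \in T -> #|x| = #|u| by move=> xT; apply/kB/(subsetP TB).
    rewrite /dev; set V := \bigcup_(x in T) down x.
    have cd x : #|down x| = #|x|.
      apply: card_in_imset => i j ix jx e; apply/eqP.
      have : i \notin x :\ i by rewrite setD11.
      by rewrite e !inE ix andbT negbK.
    have b1 := card_bigcup_down X Tk; have b2 := card_bigcup_down setT Tk.
    rewrite -/V cT in b1 b2.
    have s1 : (\sum_(x in T) #|down x :&: X|)%:R = \sum_(x in T) (deg X x)%:R :> R.
      by rewrite natr_sum; apply: eq_bigr => x _; rewrite deg_down.
    have s2 : (\sum_(x in T) #|down x :&: setT|)%:R = m%:R * #|u|%:R :> R.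
      rewrite (eq_bigr (fun=> #|u|)) ?sum_nat_const ?cT ?natrM // => x xT.
      by rewrite setIT cd Tk.
    have s3 : \sum_(x in T) (p * #|x|%:R) = p * (m%:R * #|u|%:R) :> R.
      rewrite (eq_bigr (fun=> p * #|u|%:R)) ?sumr_const ?cT => [|x xT]; last by rewrite Tk.
      by rewrite -[LHS]mulr_natr; ring.
    have u1 : (#|V :&: X| <= \sum_(x in T) #|down x :&: X|)%N.
      rewrite /V big_distrl /=.
      elim/big_ind2: _ => [|x1 x2 y1 y2 g1 g2|//]; first by rewrite cards0.
      by apply: leq_trans (leq_add g1 g2); rewrite cardsU leq_subr.
    have u2 : (#|V| <= \sum_(x in T) #|down x :&: setT|)%N.
      rewrite /V; elim/big_ind2: _ => [|x1 x2 y1 y2 g1 g2|x _]; first by rewrite cards0.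
        by apply: leq_trans (leq_add g1 g2); rewrite cardsU leq_subr.
      by rewrite setIT.
    rewrite setIT in b2.
    move: b1 b2 u1 u2; rewrite -!(ler_nat R) !natrD !natrX s1 s2 => b1 b2 u1 u2.
    move: hsum; rewrite !sumrB s3; move: b1 b2 u1 u2.
    set dg := \sum_(x in T) (deg X x)%:R; set v := #|V|%:R; set vx := #|V :&: X|%:R.
    set U := #|u|%:R => b1 b2 u1 u2.
    have mm : m%:R ^+ 2 <= m%:R * (eps * n%:R) / 2 :> R.
      have : m%:R * (2 * m%:R) <= m%:R * (eps * n%:R) :> R by rewrite ler_wpM2l.
      by lra.
    have pm : p * m%:R ^+ 2 <= m%:R ^+ 2 :> R by rewrite ler_piMl ?exprn_ge0.
    have pv1 : p * v <= p * (m%:R * U) by rewrite ler_wpM2l // ltW.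
    have pv2 : p * (m%:R * U) <= p * (v + m%:R ^+ 2) by rewrite ler_wpM2l // ltW.
    rewrite ler_normr => -[h|h]; apply/orP; [left|right].
      by move: h b1 mm pv1; lra.
    by move: h u1 mm pv2 pm; lra.
  have [hm1|hm1] := leqP m #|hi|.
    have [T Th cT] := exists_subset_card hm1; apply: (cap T) => //.
      by apply: (subset_trans Th); apply/subsetP => x /setIdP[].
    left; rewrite -cT mulr_natl -sumr_const; apply: ler_sum => x xT.
    by have /setIdP[_ /ltW] := subsetP Th x xT.
  have hm2 : (m <= #|lo|)%N.
    have h3 := leq_trans hu sub; move: h3 hm1; clear; lia.
  have [T Th cT] := exists_subset_card hm2; apply: (cap T) => //.
    by apply: (subset_trans Th); apply/subsetP => x /setIdP[].
  right; rewrite -cT mulr_natl -sumr_const; apply: ler_sum => x xT.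
  by have /setIdP[_ /ltW] := subsetP Th x xT.
apply: (@le_trans _ _ (expR n%:R * (16 ^+ m * n%:R ^+ (4 * m)) * (2 * expR (- (4 * n%:R))) * n%:R ^+ 2)).
  rewrite ler_wpM2r ?exprn_ge0 //; apply: (le_trans bnd).
  rewrite ler_wpM2r ?mulr_ge0 ?expR_ge0 //; apply: le_trans cI.
  rewrite ler_nat; apply: subset_leq_card; apply/subsetP => uT.
  by rewrite !unfold_in /= => /andP[].
have -> : expR n%:R * (16 ^+ m * n%:R ^+ (4 * m)) * (2 * expR (- (4 * n%:R))) * n%:R ^+ 2 =
  (2 * 16 ^+ m * n%:R ^+ (4 * m + 2)) * (expR n%:R * expR (- (4 * n%:R))) :> R.
  by rewrite exprD; ring.
apply: (@le_trans _ _ (expR (1 * n%:R) * (expR n%:R * expR (- (4 * n%:R))))).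
  rewrite ler_wpM2r ?mulr_ge0 ?expR_ge0 //; apply: le_trans h2.
  by rewrite ler_wpM2r ?exprn_ge0 // ler_wpM2r ?exprn_ge0 // ler_nat.
rewrite -!expRD -[leRHS]expR0 ler_expR; move: nR; lra.
Qed.

End BadEvent.

(** * Most quadruples have many usable paths *)

Section PathEvent.
Variables (R : realType) (p : R).
Hypotheses (p34 : 3 / 4 < p) (p1 : p <= 1).

Section Blocks.
Variable n : nat.
Local Notation pt := {set 'I_n}.
Local Notation fam := {set {set 'I_n}}.
Local Notation quad := ('I_n * 'I_n * 'I_n * 'I_n)%type.

(** Every set of [path4 v d t] contains b1 and adds to v nothing but b1 and b2, so this condition
    keeps the paths of different quadruples disjoint. *)
Definition separated (T : {set quad}) :=
  [forall t in T, forall t' in T, (t != t') ==> (qb1 t != qb1 t') && (qb1 t != qb2 t')].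

Lemma card_quad_fiber (f : quad -> 'I_n) (g : quad -> 'I_n * 'I_n * 'I_n) (B : {set 'I_n}) :
  (forall t t', f t = f t' -> g t = g t' -> t = t') ->
  (#|[set t | f t \in B]| <= #|B| * n ^ 3)%N.
Proof.
move=> inj; apply: (@card_fiber_le _ _ _ _ f) => [t|b bB]; first by rewrite in_set.
apply: (@card_le_inj _ _ _ g); last by rewrite !card_prod card_ord !expnS expn0 muln1 mulnA.
by move=> t t' /setIdP[_ /eqP e] /setIdP[_ /eqP e']; apply: inj; rewrite e e'.
Qed.

(** Greedy choice: m chosen quadruples occupy at most 2m values, and at most 4 m n^3 quadruples use
    one of them as b1 or b2. *)
Lemma exists_separated (F : {set quad}) m : (4 * m * n ^ 3 < #|F|)%N ->
  exists2 T : {set quad}, (T \subset F) && (#|T| == m) & separated T.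
Proof.
elim: m => [|m IH] hF.
  exists set0; first by rewrite sub0set cards0.
  by apply/forallP => t; rewrite inE.
have [|T /andP[TF /eqP cT] sT] := IH.
  by apply: leq_ltn_trans hF; rewrite leq_mul2r leq_mul2l leqnSn !orbT.
pose B := [set qb1 t | t in T] :|: [set qb2 t | t in T].
have cB : (#|B| <= 2 * m)%N.
  rewrite cardsU (leq_trans (leq_subr _ _)) // mul2n -addnn -cT.
  by rewrite leq_add // leq_imset_card.
pose bd := [set t : quad | qb1 t \in B] :|: [set t : quad | qb2 t \in B].
have cbd : (#|bd| <= 4 * m * n ^ 3)%N.
  rewrite cardsU (leq_trans (leq_subr _ _)) //.
  have f1 : (#|[set t : quad | qb1 t \in B]| <= #|B| * n ^ 3)%N.
    apply: (@card_quad_fiber _ (fun t => (qa1 t, qa2 t, qb2 t))).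
    by move=> [[[a b] c] d] [[[a' b'] c'] d']; rewrite /qb1 /qb2 /qa1 /qa2 /= => -> [-> -> ->].
  have f2 : (#|[set t : quad | qb2 t \in B]| <= #|B| * n ^ 3)%N.
    apply: (@card_quad_fiber _ (fun t => (qa1 t, qa2 t, qb1 t))).
    by move=> [[[a b] c] d] [[[a' b'] c'] d']; rewrite /qb1 /qb2 /qa1 /qa2 /= => -> [-> -> ->].
  apply: (leq_trans (leq_add f1 f2)); rewrite addnn -mul2n mulnA leq_mul2r; apply/orP; right.
  by rewrite -[4%N]/(2 * 2)%N -mulnA leq_mul2l cB orbT.
have /subsetPn[t tF tb] : ~~ (F \subset bd).
  apply/negP => /subset_leq_card h; move: hF; rewrite ltnNge => /negP; apply.
  by apply: (leq_trans h); apply: (leq_trans cbd); rewrite leq_mul2r leq_mul2l leqnSn !orbT.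
move: tb; rewrite in_setU negb_or => /andP[h1 h2].
have tb1 : qb1 t \notin B by apply: contra h1 => h; rewrite in_set.
have tb2 : qb2 t \notin B by apply: contra h2 => h; rewrite in_set.
have inB1 y : y \in T -> qb1 y \in B.
  by move=> yT; apply/setUP; left; apply/imsetP; exists y.
have inB2 y : y \in T -> qb2 y \in B.
  by move=> yT; apply/setUP; right; apply/imsetP; exists y.
have tT : t \notin T by apply: contra tb1 => /inB1.
exists (t |: T).
  by rewrite subUset sub1set tF TF cardsU1 tT cT add1n eqxx.
apply/forallP => x; apply/implyP => /setU1P hx; apply/forallP => y; apply/implyP => /setU1P hy.
apply/implyP => xy; case: hx hy => [ex|xT] [ey|yT].
- by move: xy; rewrite ex ey eqxx.
- by rewrite ex; apply/andP; split; apply: contra tb1 => /eqP ->; [exact: inB1|exact: inB2].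
- rewrite ey; apply/andP; split.
    by apply: contra tb1 => /eqP <-; exact: inB1.
  by apply: contra tb2 => /eqP <-; exact: inB1.
by move/forallP: sT => /(_ x) /implyP /(_ xT) /forallP /(_ y) /implyP /(_ yT) /implyP; apply.
Qed.

(** These facts recover the walk from one of its inner sets: the elements added to [v] identify [t]
    within a separated family, and then [d] is the removed element other than a1 and a2. *)
Lemma path4_facts (v : pt) d t w : shape v t -> d \in v -> d != qa1 t -> d != qa2 t ->
  w \in path4 v d t ->
  [/\ qb1 t \in w, w :\: v \subset [set qb1 t; qb2 t], d \notin w &
      v :\: w \subset [set d; qa1 t; qa2 t]].
Proof.
case/and5P=> a1v a2v a12 b1v /andP[b2v b12] dv da1 da2.
have db1 : d != qb1 t by apply: contraNneq b1v => <-.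
have db2 : d != qb2 t by apply: contraNneq b2v => <-.
rewrite !in_setU !in_set1 => h.
have [P [Q [-> hQ hP dP Psub]]] : exists P Q : pt, [/\ w = shift v P Q,
   (qb1 t \in Q) && (Q \subset [set qb1 t; qb2 t]), d \notin Q, d \in P &
   P \subset [set d; qa1 t; qa2 t]].
  case/orP: h => [/orP[/orP[]|]|] /eqP ->.
  - exists [set d], [set qb1 t]; split; [by []|apply/andP; split; [by rewrite !inE eqxx|]| | |].
    - by apply/subsetP => z; rewrite !inE; case: (z == qb1 t); case: (z == qb2 t).
    - by rewrite !inE ?negb_or ?db1 ?db2.
    - by rewrite !inE eqxx.
    by apply/subsetP => z; rewrite !inE; case: (z == d); case: (z == qa1 t); case: (z == qa2 t).
  - exists [set d; qa1 t], [set qb1 t]; split; [by []|apply/andP; split; [by rewrite !inE eqxx|]| | |].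
    - by apply/subsetP => z; rewrite !inE; case: (z == qb1 t); case: (z == qb2 t).
    - by rewrite !inE ?negb_or ?db1 ?db2.
    - by rewrite !inE eqxx.
    by apply/subsetP => z; rewrite !inE; case: (z == d); case: (z == qa1 t); case: (z == qa2 t).
  - exists [set d; qa1 t], [set qb1 t; qb2 t]; split; [by []|apply/andP; split; [by rewrite !inE eqxx|]| | |].
    - by apply/subsetP => z; rewrite !inE; case: (z == qb1 t); case: (z == qb2 t).
    - by rewrite !inE ?negb_or ?db1 ?db2.
    - by rewrite !inE eqxx.
    by apply/subsetP => z; rewrite !inE; case: (z == d); case: (z == qa1 t); case: (z == qa2 t).
  - exists [set d; qa1 t; qa2 t], [set qb1 t; qb2 t]; split; [by []|apply/andP; split; [by rewrite !inE eqxx|]| | |].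
    - by apply/subsetP => z; rewrite !inE; case: (z == qb1 t); case: (z == qb2 t).
    - by rewrite !inE ?negb_or ?db1 ?db2.
    - by rewrite !inE eqxx.
    by apply/subsetP => z; rewrite !inE; case: (z == d); case: (z == qa1 t); case: (z == qa2 t).
case/andP: hQ => b1Q Qs; split.
- by rewrite /shift in_setU b1Q orbT.
- apply/subsetP => z /setDP[zw zv]; apply: (subsetP Qs); move: zw.
  by rewrite /shift !inE (negbTE zv) andbF.
- by rewrite /shift !inE dP (negbTE hP).
- apply/subsetP => z /setDP[zv zw]; apply: (subsetP Psub); move: zw.
  by rewrite /shift !inE zv andbT negb_or negbK => /andP[].
Qed.

Lemma card_path4 (v : pt) d t : (#|path4 v d t| <= 4)%N.
Proof.
by rewrite /path4 !cardsU !cards1; apply: leq_trans (leq_subr _ _) _; rewrite addn1 ltnS;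
  apply: leq_trans (leq_subr _ _) _; rewrite addn1 ltnS; apply: leq_trans (leq_subr _ _) _.
Qed.

(** Lower tail, with parameter -1, for the number of intact blocks over all pairs of a quadruple in
    T and a deletion in D. Each block survives with probability at least p^4, and the -2 accounts
    for the deletions a1 and a2. *)
Lemma Pr_few_paths (v D : pt) (T : {set quad}) (c : R) :
  D \subset v -> separated T ->
  Pr p (fun X => T \subset few_paths c X v D) <=
   expR (#|T|%:R * c * n%:R) * expR (- (p ^+ 4 / 2 * (#|T|%:R * (#|D|%:R - 2)))).
Proof.
move=> Dv sT; have p0 : 0 < p by move: p34; lra.
have [shT|/forallPn[t0]] := boolP [forall t in T, shape v t]; last first.
  rewrite negb_imply => /andP[tT ns].
  apply: (@le_trans _ _ 0); last by rewrite mulr_ge0 ?expR_ge0.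
  rewrite Pr_Ex -[leRHS](@Ex_cst R n p 0); apply: ler_Ex; [exact: ltW|by []|move=> X].
  case: (boolP (T \subset _)) => // /subsetP /(_ t0 tT).
  by rewrite in_set (negbTE ns).
have sh t : t \in T -> shape v t by move=> tT; have /forallP /(_ t) := shT; rewrite tT.
pose P := [set td : quad * 'I_n | [&& td.1 \in T, td.2 \in D, td.2 != qa1 td.1 & td.2 != qa2 td.1]].
pose S (td : quad * 'I_n) := path4 v td.2 td.1.
have dis : {in P &, forall i j, i != j -> [disjoint S i & S j]}.
  move=> [t d] [t' d']; rewrite !in_set /= => /and4P[tT dD da1 da2] /and4P[tT' dD' da1' da2'].
  apply: contraNT => /pred0Pn[w /andP[/= w1 w2']].
  have [f1 f2 f3 f4] := path4_facts (sh t tT) (subsetP Dv d dD) da1 da2 w1.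
  have [g1 g2 g3 g4] := path4_facts (sh t' tT') (subsetP Dv d' dD') da1' da2' w2'.
  have b1v : qb1 t \notin v by case/and5P: (sh t tT).
  have /(subsetP g2) : qb1 t \in w :\: v by rewrite in_setD b1v.
  have et : t = t'.
    apply/eqP; apply: contraT => tt'; move: sT => /forallP /(_ t) /implyP /(_ tT) /forallP /(_ t').
    move=> /implyP /(_ tT') /implyP /(_ tt') /andP[h1 h2].
    have : qb1 t \in [set qb1 t'; qb2 t'] by apply: (subsetP g2); rewrite in_setD b1v.
    by rewrite in_set2 (negbTE h1) (negbTE h2).
  move=> _; rewrite et; suff -> : d = d' by [].
  have : d \in [set d'; qa1 t'; qa2 t'].
    by apply: (subsetP g4); rewrite in_setD f3 (subsetP Dv).
  by rewrite !inE -et (negbTE da1) (negbTE da2) !orbF => /eqP.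
have e1 : expR (- 1) <= 1 / 2 :> R.
  rewrite expRN -[1 / 2]/(1 * 2^-1) mul1r lef_pV2 ?posrE ?expR_gt0 //.
  by have := expR_ge1Dx (1 : R); lra.
apply: (@le_trans _ _ (Ex p (fun X => expR (#|T|%:R * c * n%:R) *
    expR (- 1 * #|[set j in P | S j \subset X]|%:R)))).
  apply: Pr_le_Ex; [exact: ltW|by []|by move=> X; rewrite mulr_ge0 ?expR_ge0|move=> X hX].
  rewrite -expRD -[leLHS]expR0 ler_expR mulN1r subr_ge0.
  have -> : #|[set j in P | S j \subset X]| = (\sum_(t in T) #|[set d in D | okd X v t d]|)%N.
    rewrite (eq_bigr (fun t => \sum_(d | (d \in D) && okd X v t d) 1)%N); last first.
      by move=> t _; rewrite sum1dep_card.
    rewrite pair_big_dep /= sum1dep_card; apply: eq_card => [[t d]].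
    by rewrite !in_set /= /okd -!andbA.
  rewrite natr_sum -mulrA mulr_natl -sumr_const; apply: ler_sum => t tT.
  by have := subsetP hX t tT; rewrite in_set => /andP[_ /ltW].
rewrite ExZ ler_wpM2l ?expR_ge0 // Ex_exp_blocks //.
have p4 : 0 <= p ^+ 4 by rewrite exprn_ge0 // ltW.
apply: (@le_trans _ _ (\prod_(j in P) expR (- (p ^+ 4 / 2)))).
  apply: ler_prod => j _; apply/andP; split.
    have : p ^+ #|S j| <= 1 by rewrite exprn_ile1 // ltW.
    have : 0 <= p ^+ #|S j| by rewrite exprn_ge0 // ltW.
    have := expR_ge0 (- 1 : R).
    move: (p ^+ #|S j|) (expR (- 1)) => s a a0 s0 s1.
    have : 0 <= a * s by exact: mulr_ge0.
    by rewrite mulrBl mul1r; lra.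
  apply: le_trans (expR_ge1Dx _).
  have h4 : p ^+ 4 <= p ^+ #|S j| by rewrite ler_wiXn2l ?card_path4 // ltW.
  move: h4 e1 p4; move: (p ^+ #|S j|) (expR (- 1)) => s a h4 e1 p4.
  have : a * s <= 1 / 2 * s by rewrite ler_wpM2r // (le_trans p4).
  by rewrite mulrBl mul1r; lra.
rewrite prodr_const -expRM_natr ler_expR mulNr lerN2 ler_wpM2l ?divr_ge0 //.
have cP : (#|T| * (#|D| - 2) <= #|P|)%N.
  have -> : #|P| = (\sum_(t in T) #|[set d in D | (d != qa1 t) && (d != qa2 t)]|)%N.
    rewrite (eq_bigr (fun t => \sum_(d | (d \in D) && ((d != qa1 t) && (d != qa2 t))) 1)%N); last first.
      by move=> t _; rewrite sum1dep_card.
    by rewrite pair_big_dep /= sum1dep_card; apply: eq_card => [[t d]]; rewrite !in_set.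
  rewrite -sum_nat_const; apply: leq_sum => t _.
  have -> : [set d in D | (d != qa1 t) && (d != qa2 t)] = D :\: [set qa1 t; qa2 t].
    by apply/setP => d; rewrite !inE negb_or andbC.
  rewrite cardsD leq_sub2l // (leq_trans (subset_leq_card (subsetIr _ _))) // cards2.
  by case: (_ != _).
apply: (@le_trans _ _ (#|T| * (#|D| - 2))%:R); last by rewrite ler_nat.
by rewrite natrM ler_wpM2l // lerBlDr -natrD ler_nat addnC -leq_subLR.
Qed.

End Blocks.

(** More than 4 m n^3 exceptional quadruples contain m separated ones. This has probability
    O(exp(-5n)) for a large constant m, against 4^n choices of v and D and polynomially many m-sets.
    The density [c] is half of the guaranteed mean p^4/(2M). *)
Lemma Pr_good_path (M : nat) : (0 < M)%N -> exists K3 : nat,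
  exists n0, forall n, (n0 <= n)%N -> forall k,
  Pr p (fun X : {set {set 'I_n}} => ~~ good_path M K3 (p ^+ 4 / (4 * M%:R)) k X)
    * n%:R ^+ 2 <= 1.
Proof.
move=> M0; have p0 : 0 < p by move: p34; lra.
have MR : 0 < M%:R :> R by rewrite ltr0n.
set c := p ^+ 4 / (4 * M%:R).
have c0 : 0 < c by rewrite divr_gt0 ?exprn_gt0 // mulr_gt0.
have [m1 hm1] := natr_ge (5 / c).
pose m := m1; have hm : 5 <= m%:R * c by have := hm1 m (leqnn _); rewrite ler_pdivrMr.
have [n1 hn1] := @poly_le_exp R (4 * m + 2) (expR (p ^+ 4 * m%:R)) 1 ltr01.
exists (4 * m)%N, (maxn 1 n1) => n; rewrite geq_max => /andP[n0 /hn1 h1] k.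
have nR : 1 <= n%:R :> R by rewrite ler1n.
pose b := expR (- (5 * n%:R)) * expR (p ^+ 4 * m%:R) : R.
pose I := [pred z : {set 'I_n} * ({set 'I_n} * {set 'I_n * 'I_n * 'I_n * 'I_n}) |
  [&& #|z.2.2| == m, z.2.1 \subset z.1, (n <= M * #|z.2.1|)%N & separated z.2.2]].
have U : Pr p (fun X : {set {set 'I_n}} => ~~ good_path M (4 * m) c k X) <= #|I|%:R * b.
  apply: (@Pr_union_le R n p (ltW p0) p1 _ I _ (fun z X => z.2.2 \subset few_paths c X z.1 z.2.1) _).
    move=> X; rewrite negb_forall => /existsP[v]; rewrite negb_forall => /existsP[D].
    rewrite negb_imply -ltnNge => /andP[/and3P[_ Dv nD] h].
    have [T /andP[TF cT] sT] := exists_separated h.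
    by exists (v, (D, T)) => //=; rewrite cT Dv nD sT.
  move=> [v [D T]] /= /and4P[/eqP cT Dv nD sT].
  apply: le_trans (Pr_few_paths c Dv sT) _.
  rewrite cT /b -!expRD ler_expR.
  have nD' : n%:R / M%:R <= #|D|%:R :> R by rewrite ler_pdivrMr // mulrC -natrM ler_nat.
  have h2 : p ^+ 4 / 2 * (m%:R * (n%:R / M%:R - 2)) <= p ^+ 4 / 2 * (m%:R * (#|D|%:R - 2)).
    apply: ler_wpM2l; first by rewrite divr_ge0 // exprn_ge0 // ltW.
    by apply: ler_wpM2l => //; rewrite lerD2r.
  have e2 : p ^+ 4 / 2 * (m%:R * (n%:R / M%:R - 2)) = 2 * (m%:R * c) * n%:R - p ^+ 4 * m%:R.
    by rewrite /c; field; rewrite gt_eqF.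
  have h3 : 5 * n%:R <= m%:R * c * n%:R by rewrite ler_wpM2r.
  rewrite e2 in h2; move: h2 h3; lra.
have cI : #|I|%:R <= expR n%:R * expR n%:R * n%:R ^+ (4 * m) :> R.
  pose I1 := setX [set: {set 'I_n}] (setX [set: {set 'I_n}]
     [set T : {set 'I_n * 'I_n * 'I_n * 'I_n} | (T \subset setT) && (#|T| == m)]).
  apply: (@le_trans _ _ #|I1|%:R).
    rewrite ler_nat; apply: subset_leq_card; apply/subsetP => [[v [D T]]].
    by rewrite unfold_in /= !in_setX !in_setT in_set subsetT => /and4P[-> _ _ _].
  have cs : #|[set: {set 'I_n}]| = (2 ^ n)%N.
    by rewrite -powersetT card_powerset cardsT card_ord.
  rewrite !cardsX cs cards_draws cardsT !card_prod card_ord !natrM natrX mulrA.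
  have e2 := natr_lt_exp2 R n.
  apply: ler_pM; rewrite ?mulr_ge0 ?exprn_ge0 //; first by apply: ler_pM; rewrite ?exprn_ge0.
  rewrite -natrX ler_nat (leq_trans (bin_leq_exp _ _)) // expnM leq_eqVlt; apply/orP; left.
  by rewrite !expnS expn0 muln1 !mulnA.
apply: (@le_trans _ _ (expR n%:R * expR n%:R * n%:R ^+ (4 * m) * b * n%:R ^+ 2)).
  rewrite ler_wpM2r ?exprn_ge0 //; apply: (le_trans U).
  by rewrite ler_wpM2r // mulr_ge0 ?expR_ge0.
have -> : expR n%:R * expR n%:R * n%:R ^+ (4 * m) * b * n%:R ^+ 2 =
  (expR (p ^+ 4 * m%:R) * n%:R ^+ (4 * m + 2)) * (expR n%:R * expR n%:R * expR (- (5 * n%:R))).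
  by rewrite exprD /b; ring.
apply: (@le_trans _ _ (expR (1 * n%:R) * (expR n%:R * expR n%:R * expR (- (5 * n%:R))))).
  by rewrite ler_wpM2r // !mulr_ge0 ?expR_ge0.
rewrite -!expRD -[leRHS]expR0 ler_expR; move: nR; lra.
Qed.

End PathEvent.

(** * Regularity on all families determined by samples *)

Section CoarseEvent.
Variables (R : realType) (p : R).
Hypotheses (p34 : 3 / 4 < p) (p1 : p <= 1).

(** Double counting of pairs at distance two: a coarse set sees at least q p g n^4/2 sample points,
    and a sample point is seen by at most (n + 1)^4 <= 16 n^4 sets. *)
Lemma card_coarse n k (q g : R) (A0 : {set {set 'I_n}}) : 0 < q -> 0 < g -> (0 < n)%N ->
  (forall x : {set 'I_n}, #|x| = k -> g * n%:R ^+ 4 <= #|Gam x|%:R) ->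
  #|coarse k p q A0|%:R <= 32 / (q * p * g) * #|A0|%:R.
Proof.
move=> q0 g0 n0 Hg; have p0 : 0 < p by move: p34; lra.
have nR : 0 < n%:R :> R by rewrite ltr0n.
have n4 : 0 < n%:R ^+ 4 :> R by rewrite exprn_gt0.
have qpg : 0 < q * p * g by rewrite !mulr_gt0.
set S := coarse k p q A0.
have low : #|S|%:R * (q * p * (g * n%:R ^+ 4) / 2) <= \sum_(v in S) #|Gam v :&: A0|%:R.
  rewrite mulr_natl -sumr_const; apply: ler_sum => v; rewrite in_set => /andP[/eqP vk h].
  by apply: le_trans h; rewrite ler_pM2r ?invr_gt0 // ler_pM2l ?mulr_gt0 // Hg.
have up : (\sum_(v in S) #|Gam v :&: A0| <= #|A0| * n.+1 ^ 4)%N.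
  apply: (@leq_trans (\sum_(v : {set 'I_n}) #|Gam v :&: A0|)).
    by rewrite [leqRHS](bigID (fun v => v \in S)) /= leq_addr.
  rewrite (eq_bigr (fun v => \sum_(u in A0) (u \in Gam v))%N); last first.
    move=> v _; rewrite -sum1_card big_mkcond [RHS]big_mkcond /=.
    by apply: eq_bigr => u _; rewrite in_setI; case: (u \in Gam v); case: (u \in A0).
  rewrite exchange_big /= -sum_nat_const; apply: leq_sum => u _.
  apply: leq_trans (card_Bal u); apply: leq_trans (subset_leq_card (Gam_Bal u)).
  rewrite -sum1_card [leqRHS]big_mkcond; apply: leq_sum => v _.
  by rewrite Gam_sym; case: (v \in Gam u).
have up2 : (n.+1 ^ 4)%:R <= 16 * n%:R ^+ 4 :> R.
  rewrite -natrX -natrM ler_nat -[16%N]/(2 ^ 4)%N -expnMn leq_exp2r //.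
  by rewrite mul2n -addnn -addn1 leq_add2l.
rewrite mulrAC ler_pdivlMr // -(ler_pM2r n4).
move: up; rewrite -(ler_nat R) natr_sum natrM => up.
have h3 : #|A0|%:R * (n.+1 ^ 4)%:R <= #|A0|%:R * (16 * n%:R ^+ 4) :> R by rewrite ler_wpM2l.
have := le_trans low (le_trans up h3); lra.
Qed.

Lemma edges_in_split n (X : {set {set 'I_n}}) (E : {set {set 'I_n} * 'I_n}) :
  #|edges_in X E| = (\sum_(i : 'I_n)
    #|[set x in [set x | (x, i) \in E] | [set x; x :\ i] \subset X]|)%N.
Proof.
rewrite -sum1_card (partition_big (fun e : {set 'I_n} * 'I_n => e.2) predT) //=.
apply: eq_bigr => i _; rewrite sum1dep_card.
have inj : injective (fun x : {set 'I_n} => (x, i)) by move=> x y [].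
rewrite -(card_imset _ inj); apply: eq_card => [[x j]].
rewrite !in_set /=; apply/andP/imsetP => [[/and3P[h1 h2 h3] /eqP h4]|[y]].
  by exists x; rewrite ?h4 // in_set in_set -h4 h1 subUset !sub1set h2 h3.
rewrite in_set in_set subUset !sub1set => /and3P[h1 h2 h3] [-> ->].
by rewrite h1 h2 h3 eqxx.
Qed.

(** Edges that share a set are dependent. Those deleting one fixed element form a matching, so
    [Hoeffding] applies to blocks of size two in each of the n directions, with an n-th of the
    allowed error. *)
Lemma Pr_deviation n (E : {set {set 'I_n} * 'I_n}) (K s m : R) :
  (forall e, e \in E -> e.2 \in e.1) -> (0 < n)%N ->
  (forall i, #|[set x | (x, i) \in E]|%:R <= m) -> 0 < m -> 0 < K -> 0 < s ->
  K * s * n%:R ^+ 2 <= 2 * m ->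
  Pr p (fun X => ~~ deviation p K s X E) <=
    n%:R * (2 * expR (- ((K * s * n%:R ^+ 2) ^+ 2 / (8 * m)))).
Proof.
move=> Ei n0 Em m0 K0 s0 Km; have p0 : 0 < p by move: p34; lra.
set t := K * s * n%:R ^+ 2.
have t0 : 0 <= t by rewrite /t !mulr_ge0 ?exprn_ge0 // ltW.
pose Pi i := [set x : {set 'I_n} | (x, i) \in E].
pose F (i : 'I_n) (X : {set {set 'I_n}}) :=
  t <= `|#|[set x in Pi i | [set x; x :\ i] \subset X]|%:R - p ^+ 2 * #|Pi i|%:R|.
rewrite -[X in X%:R * _](card_ord n).
apply: (@Pr_union_le R n p (ltW p0) p1 _ predT _ F _) => [X|i _].
  rewrite -ltNge => h.
  have [/existsP[i hi]|] := boolP [exists i, F i X]; first by exists i.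
  rewrite negb_exists => /forallP hn; exfalso.
  have hall i : `|#|[set x in Pi i | [set x; x :\ i] \subset X]|%:R - p ^+ 2 * #|Pi i|%:R| <= t.
    by have := hn i; rewrite /F -ltNge => /ltW.
  move: h; rewrite ltNge => /negP; apply.
  have eE : #|E|%:R = \sum_(i : 'I_n) #|Pi i|%:R :> R.
    rewrite -natr_sum; congr _%:R; rewrite -sum1_card.
    rewrite (partition_big (fun e : {set 'I_n} * 'I_n => e.2) predT) //=.
    apply: eq_bigr => i _; rewrite sum1dep_card.
    have inj : injective (fun x : {set 'I_n} => (x, i)) by move=> x y [].
    rewrite -(card_imset _ inj); apply: eq_card => [[x j]].
    rewrite in_set /=; apply/andP/imsetP => [[h1 /eqP <-]|[y]]; first by exists x; rewrite ?in_set.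
    by rewrite in_set => h1 [-> ->].
  rewrite eE edges_in_split natr_sum mulr_sumr -sumrB.
  apply: (le_trans (ler_norm_sum _ _ _)).
  apply: (@le_trans _ _ (\sum_(i : 'I_n) t)); first by apply: ler_sum => i _; exact: hall.
  rewrite sumr_const card_ord -mulr_natr /t le_eqVlt; apply/orP; left; apply/eqP.
  by ring.
have dis : {in Pi i &, forall x y, x != y -> [disjoint [set x; x :\ i] & [set y; y :\ i]]}.
  move=> x y; rewrite !in_set => xE yE xy.
  have ix := Ei _ xE; have iy := Ei _ yE; rewrite /= in ix iy.
  rewrite -setI_eq0; apply/eqP/setP => z; rewrite !inE; apply/negP => /andP[].
  move=> /orP[/eqP ->|/eqP ->] /orP[/eqP e|/eqP e].
  - by move: xy; rewrite e eqxx.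
  - by move: ix; rewrite e setD11.
  - by move: iy; rewrite -e setD11.
  - by move: xy; rewrite -(setD1K ix) e setD1K // eqxx.
have card2 : {in Pi i, forall x, #|[set x; x :\ i]| = 2%N}.
  move=> x; rewrite in_set => xE; have ix := Ei _ xE; rewrite /= in ix.
  by rewrite cards2; case: eqP => // e; move: ix; rewrite e setD11.
exact: (@Hoeffding R n p (ltW p0) p1 _ (Pi i) (fun x => [set x; x :\ i]) 2 m t
  dis card2 (Em i) m0 t0 Km).
Qed.

Lemma sum_pow_card (T : finType) (x : R) : \sum_(A : {set T}) x ^+ #|A| = (1 + x) ^+ #|T|.
Proof.
have := @bigA_distr R 0 1 *%R +%R T (fun=> x) (fun=> 1); rewrite prodr_const addrC => ->.
apply: eq_big => [A|A _]; first by rewrite inE.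
by rewrite -big_mkcond prodr_const.
Qed.

Lemma coarse_exponent (K s N e1 g : R) : 0 < s -> 0 < N -> 0 < e1 -> 0 < p -> 0 < g ->
  (K * s * N ^+ 2) ^+ 2 / (8 * (32 / (e1 * p * g) * s * N ^+ 3)) =
  (K ^+ 2 * e1 * p * g) / 256 * (N * s).
Proof. by move=> s0 N0 e0 p0 g0; field; rewrite ?gt_eqF. Qed.

Lemma mul3_mul2 (a y : R) : 3%:R * (a * (2 * y)) <= 6 * a * y.
Proof. lra. Qed.

(** By K^2 e1 p g >= 1024, a pair of samples with s points in all fails with probability at most 6 n
    exp(-4 n s). Summing over pairs weighs each of the 2^n possible points by exp(-4n). The empty
    pair, excluded from the sum, has no deviation. *)
Lemma Pr_good_coarse (g e1 K : R) : 0 < g -> 0 < e1 -> 0 < K ->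
  1024 <= K ^+ 2 * e1 * p * g -> K * (e1 * p * g) <= 64 ->
  exists n0, forall n, (n0 <= n)%N -> forall k, (0 < k)%N ->
  (forall x : {set 'I_n}, #|x| = k -> g * n%:R ^+ 4 <= #|Gam x|%:R) ->
  (forall x : {set 'I_n}, #|x| = k.-1 -> g * n%:R ^+ 4 <= #|Gam x|%:R) ->
  Pr p (fun X : {set {set 'I_n}} => ~~ good_coarse p (e1 / n%:R ^+ 3) K k X)
    * n%:R ^+ 2 <= 1.
Proof.
move=> g0 e10 K0 hK hK2; have p0 : 0 < p by move: p34; lra.
have epg : 0 < e1 * p * g by rewrite !mulr_gt0.
have [n1 hn1] := @poly_le_exp R 3 24 1 ltr01.
exists (maxn 2 n1) => n; rewrite geq_max => /andP[n2 /hn1 h1] k k0 Hg Hg'.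
have n0 : (0 < n)%N by apply: leq_trans n2.
have nR : 1 <= n%:R :> R by rewrite ler1n.
have nR0 : 0 < n%:R :> R by rewrite ltr0n.
have n30 : 0 < n%:R ^+ 3 :> R by rewrite exprn_gt0.
set q := e1 / n%:R ^+ 3.
have q0 : 0 < q by rewrite divr_gt0.
pose Cs := 32 / (e1 * p * g).
have eCs : 32 / (q * p * g) = Cs * n%:R ^+ 3 by rewrite /q /Cs; field; rewrite !gt_eqF.
have Cs0 : 0 < Cs by rewrite divr_gt0.
pose x : R := expR (- (4 * n%:R)).
pose I := [pred AB : {set {set 'I_n}} * {set {set 'I_n}} | (0 < #|AB.1| + #|AB.2|)%N].
pose F (AB : {set {set 'I_n}} * {set {set 'I_n}}) (X : {set {set 'I_n}}) :=
  let S := coarse k p q AB.1 in let S' := coarse k.-1 p q AB.2 in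
  let s : R := (#|AB.1| + #|AB.2|)%:R in
  ~~ [&& `|#|S :&: X|%:R - p * #|S|%:R| <= K * s * n%:R ^+ 2,
      deviation p K s X (edges_out k S S') & deviation p K s X (edges_into k S S')].
have one AB : I AB -> Pr p (F AB) <= (6 * n%:R) * x ^+ (#|AB.1| + #|AB.2|).
  case: AB => A0 B0; rewrite /I /= => s1.
  set S := coarse k p q A0; set S' := coarse k.-1 p q B0.
  set s : R := (#|A0| + #|B0|)%:R.
  have s0 : 0 < s by rewrite ltr0n.
  pose m := Cs * s * n%:R ^+ 3.
  have m0 : 0 < m by rewrite /m mulr_gt0 // mulr_gt0.
  have cS : #|S|%:R <= m.
    apply: le_trans (card_coarse A0 q0 g0 n0 Hg) _; rewrite eCs /m mulrAC.
    apply: ler_wpM2r; first exact: ltW.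
    by apply: ler_wpM2l; [exact: ltW|rewrite ler_nat leq_addr].
  have cS' : #|S'|%:R <= m.
    apply: le_trans (card_coarse B0 q0 g0 n0 Hg') _; rewrite eCs /m mulrAC.
    apply: ler_wpM2r; first exact: ltW.
    by apply: ler_wpM2l; [exact: ltW|rewrite ler_nat leq_addl].
  have tm : K * s * n%:R ^+ 2 <= 2 * m.
    have KC : K <= 2 * Cs.
      by rewrite /Cs mulrA ler_pdivlMr //; lra.
    have h2 : n%:R ^+ 2 <= n%:R ^+ 3 :> R by rewrite ler_weXn2l.
    have -> : 2 * m = (2 * Cs) * (s * n%:R ^+ 3) by rewrite /m; ring.
    rewrite -mulrA; apply: ler_pM => //; [exact: ltW| |].
      by apply: mulr_ge0; [exact: ltW|exact: exprn_ge0].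
    by apply: ler_wpM2l; first exact: ltW.
  have ex : expR (- ((K * s * n%:R ^+ 2) ^+ 2 / (8 * m))) <= x ^+ (#|A0| + #|B0|).
    rewrite /x -expRM_natr ler_expR mulNr lerN2 -/s.
    have -> : (K * s * n%:R ^+ 2) ^+ 2 / (8 * m) = (K ^+ 2 * e1 * p * g) / 256 * (n%:R * s).
      exact: coarse_exponent.
    have : 4 * (n%:R * s) <= (K ^+ 2 * e1 * p * g) / 256 * (n%:R * s).
      apply: ler_wpM2r; first by apply: mulr_ge0; exact: ltW.
      by rewrite ler_pdivlMr //; move: hK; lra.
    by rewrite mulrA.
  pose G (b : 'I_3) (X : {set {set 'I_n}}) := match val b with
    | 0%N => K * s * n%:R ^+ 2 <= `|#|S :&: X|%:R - p * #|S|%:R|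
    | 1%N => ~~ deviation p K s X (edges_out k S S')
    | _ => ~~ deviation p K s X (edges_into k S S') end.
  apply: (@le_trans _ _ (#|(predT : pred 'I_3)|%:R * (n%:R * (2 * x ^+ (#|A0| + #|B0|))))); last first.
    have -> : #|(predT : pred 'I_3)| = 3%N by rewrite -[RHS](card_ord 3); apply: eq_card.
    exact: mul3_mul2.
  apply: (@Pr_union_le R n p (ltW p0) p1 _ predT _ G _).
    move=> X; rewrite /F /= -/S -/S' -/s !negb_and => /or3P[h|h|h].
    - by exists (@Ordinal 3 0 isT) => //; rewrite /G /=; apply: ltW; rewrite ltNge.
    - by exists (@Ordinal 3 1 isT).
    - by exists (@Ordinal 3 2 isT).
  have fin (E : {set {set 'I_n} * 'I_n}) : (forall e, e \in E -> e.2 \in e.1) ->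
      (forall i, #|[set y | (y, i) \in E]|%:R <= m) ->
      Pr p (fun X => ~~ deviation p K s X E) <= n%:R * (2 * x ^+ (#|A0| + #|B0|)).
    move=> Ei Em; apply: le_trans (Pr_deviation Ei n0 Em m0 K0 s0 tm) _.
    by rewrite ler_wpM2l // ler_wpM2l.
  move=> [[|[|j]] /= jb] _; rewrite /G /=.
  - apply: le_trans (Hoeffding_card (ltW p0) p1 cS m0 _ tm) _.
      by rewrite !mulr_ge0 ?exprn_ge0 // ltW.
    apply: (@le_trans _ _ (2 * x ^+ (#|A0| + #|B0|))); first by rewrite ler_wpM2l.
    by apply: ler_peMl => //; rewrite mulr_ge0 ?exprn_ge0 ?expR_ge0.
  - apply: fin => [e|i]; first by rewrite in_set => /and4P[].
    apply: le_trans cS; rewrite ler_nat; apply: subset_leq_card; apply/subsetP => y.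
    by rewrite in_set in_set => /and4P[].
  - apply: fin => [e|i]; first by rewrite in_set => /and4P[].
    apply: le_trans cS'; rewrite ler_nat.
    have inj : {in [set y : {set 'I_n} | (y, i) \in edges_into k S S'] &,
        injective (fun y => y :\ i)}.
      move=> y z; rewrite !(in_set (fun y => (y, i) \in _)) => hy hz e.
      have /and4P[_ iy _ _] : [&& #|y| == k, i \in y, y \notin S & y :\ i \in S'].
        by move: hy; rewrite in_set.
      have /and4P[_ iz _ _] : [&& #|z| == k, i \in z, z \notin S & z :\ i \in S'].
        by move: hz; rewrite in_set.
      by rewrite -(setD1K iy) e setD1K.
    rewrite -(card_in_imset inj); apply: subset_leq_card.
    apply/subsetP => _ /imsetP[y hy ->]; move: hy; rewrite in_set in_set.
    by case/and4P.
have U : Pr p (fun X : {set {set 'I_n}} => ~~ good_coarse p q K k X) <=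
    \sum_(AB | I AB) (6 * n%:R) * x ^+ (#|AB.1| + #|AB.2|).
  apply: le_trans (_ : \sum_(AB | I AB) Pr p (F AB) <= _); last exact: ler_sum.
  apply: (@Pr_union R n p (ltW p0) p1 _ I _ F) => X.
  rewrite negb_forall => /existsP[A0]; rewrite negb_forall => /existsP[B0] h.
  exists (A0, B0) => //; rewrite /I /= lt0n addn_eq0 negb_and.
  apply: contraTT h; rewrite negb_or !negbK !cards_eq0 => /andP[/eqP -> /eqP ->] /=.
  rewrite (coarse0 p0 q0 g0 n0 Hg) (coarse0 p0 q0 g0 n0 Hg') set0I cards0 addn0.
  have e0 : edges_out k set0 set0 = set0 :> {set {set 'I_n} * 'I_n}.
    by apply/setP => e; rewrite !inE !andbF.
  have e0' : edges_into k set0 set0 = set0 :> {set {set 'I_n} * 'I_n}.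
    by apply/setP => e; rewrite !inE !andbF.
  have e2 : edges_in X set0 = set0 by apply/setP => e; rewrite !inE.
  by rewrite /deviation e0 e0' e2 cards0 !mulr0 !mul0r subrr normr0 lexx.
pose N := #|{set 'I_n}|.
have x0 : 0 <= x by exact: expR_ge0.
have Nx : N%:R * x <= expR (- (3 * n%:R)).
  apply: (@le_trans _ _ (expR n%:R * x)).
    by rewrite ler_wpM2r // card_pts_le.
  by rewrite /x -expRD ler_expR; lra.
have y4 : expR (- (3 * n%:R)) <= 1 / 4 :> R.
  have : expR (3 * n%:R) >= 4 :> R by apply: le_trans (expR_ge1Dx _); lra.
  move=> h4; rewrite expRN -[1 / 4]/(1 * 4^-1) mul1r lef_pV2 // posrE //; exact: expR_gt0.
(* The generating function of all pairs of samples by total size, minus the empty pair; it is small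
   because N x is. *)
have sI : (1 + x) ^+ N * (1 + x) ^+ N - 1 <= 4 * expR (- (3 * n%:R)).
  apply: (@le_trans _ _ (expR (2 * (N%:R * x)) - 1)).
    rewrite lerD2r; have h2 : (1 + x) ^+ N <= expR (N%:R * x).
      by rewrite expRM_natl lerXn2r ?nnegrE ?expR_ge0 ?expR_ge1Dx // addr_ge0.
    have -> : 2 * (N%:R * x) = N%:R * x + N%:R * x by ring.
    by rewrite expRD ler_pM ?exprn_ge0 ?addr_ge0.
  have y0 : 0 <= N%:R * x by rewrite mulr_ge0.
  set y := N%:R * x in y0 Nx *.
  have hq : expR (2 * y) <= 1 + 2 * y + 2 * (2 * y) ^+ 2 by apply: expR_le_quadratic; lra.
  set z := expR (- (3 * n%:R)) in Nx y4 *.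
  nra.
apply: (@le_trans _ _ (6 * n%:R * (4 * expR (- (3 * n%:R))) * n%:R ^+ 2)).
  rewrite ler_wpM2r ?exprn_ge0 //; apply: (le_trans U).
  have sumI : \sum_(AB | I AB) x ^+ (#|AB.1| + #|AB.2|) = (1 + x) ^+ N * (1 + x) ^+ N - 1.
    apply/eqP; rewrite eq_sym subr_eq [X in _ == X]addrC; apply/eqP.
    rewrite /N -(sum_pow_card {set 'I_n} x) big_distrlr /= pair_big /=.
    rewrite (bigD1 (set0, set0)) //= !cards0 !expr0 mulr1; congr (1 + _).
    apply: eq_big => [[A0 B0]|[A0 B0] _] /=; last by rewrite exprD.
    by rewrite xpair_eqE negb_and addn_gt0 !card_gt0.
  by rewrite -mulr_sumr sumI ler_wpM2l // mulr_ge0.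
have -> : 6 * n%:R * (4 * expR (- (3 * n%:R))) * n%:R ^+ 2 =
  (24 * n%:R ^+ 3) * expR (- (3 * n%:R)) :> R by ring.
apply: (@le_trans _ _ (expR (1 * n%:R) * expR (- (3 * n%:R)))).
  by rewrite ler_wpM2r ?expR_ge0.
by rewrite -expRD -[leRHS]expR0 ler_expR mul1r subr_le0 ler_peMl // ler1n.
Qed.

End CoarseEvent.

(** * From expansion to maximum antichains *)

Section Antichains.
Variable n : nat.
Local Notation pt := {set 'I_n}.
Local Notation fam := {set {set 'I_n}}.
Implicit Types (X A B F : fam) (x y : pt).

Lemma antichainP F : reflect {in F &, forall x y, x \subset y -> x = y} (antichain F).
Proof.
apply: (iffP forall_inP) => [h x y xF yF xy|h x xF].
  apply/eqP/idPn => ne; have /forall_inP /(_ y yF) := h x xF.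
  by rewrite ne xy.
apply/forall_inP => y yF; apply/implyP => ne.
apply/andP; split; apply: contra ne => s; apply/eqP; first exact: h.
by apply/esym; exact: h.
Qed.

Lemma antichain_cpl F : antichain F -> antichain (cpl F).
Proof.
move=> /antichainP h; apply/antichainP => x y; rewrite !mem_cpl => xF yF xy.
by apply/setC_inj/esym/h => //; rewrite setCS.
Qed.

Lemma antichain_layer A k : (forall x, x \in A -> #|x| = k) -> antichain A.
Proof.
move=> Ak; apply/antichainP => x y xA yA xy; apply/eqP.
by rewrite eqEcard xy (Ak x xA) (Ak y yA) leqnn.
Qed.

Lemma width_ge X F : F \subset X -> antichain F -> (#|F| <= width X)%N.
Proof.
move=> FX Fa.
apply: (@leq_bigmax_cond _ (fun F : fam => (F \subset X) && antichain F) (fun F : fam => #|F|) F).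
by rewrite FX.
Qed.

Lemma width_cpl X : width (cpl X) = width X.
Proof.
have le (Y : fam) : (width (cpl Y) <= width Y)%N.
  apply/bigmax_leqP => F /andP[FY Fa]; have := @width_ge Y (cpl F); rewrite card_cpl.
  by apply; [rewrite -cpl_sub cplK|exact: antichain_cpl].
by apply/eqP; rewrite eqn_leq le -{1}(cplK X) le.
Qed.

Lemma maximum_antichain_cpl X F : maximum_antichain X F -> maximum_antichain (cpl X) (cpl F).
Proof.
move=> /and3P[FX Fa Fw]; apply/and3P; split; first by rewrite cpl_sub.
  exact: antichain_cpl.
by rewrite card_cpl width_cpl.
Qed.

Lemma exists_maximum_antichain X : exists F, maximum_antichain X F.
Proof.
have : (0 < #|[pred F : fam | (F \subset X) && antichain F]|)%N.
  apply/card_gt0P; exists set0; rewrite inE sub0set; apply/antichainP => x y.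
  by rewrite in_set0.
move=> /(eq_bigmax_cond (fun F : fam => #|F|))[F]; rewrite inE => /andP[FX Fa] e.
by exists F; apply/and3P; split => //; apply/eqP; rewrite -e; apply: eq_bigl => G; rewrite inE.
Qed.

Section Push.
Variables (X F : fam) (k : nat).
Hypotheses (k_gt0 : (0 < k)%N) (Fmax : maximum_antichain X F).
Hypothesis Fk : forall x, x \in F -> (#|x| <= k)%N.
Local Notation A := (F :&: layer n k).

Let Ak x : x \in A -> #|x| = k.
Proof. by rewrite !inE => /andP[_ /eqP]. Qed.

Lemma nbr_disjoint y : y \in nbr X A -> y \notin F.
Proof.
rewrite inE => /andP[_ /existsP[i /andP[iy /setIP[iF _]]]].
apply/negP => yF; have /and3P[_ /antichainP h _] := Fmax.
have e := h y (i |: y) yF iF (subsetUr _ _).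
by move: iy; rewrite e setU11.
Qed.

(** The exchange of A for its shadow keeps the antichain property: a remaining set of F inside a
    shadow set would lie inside a set of A, and it is too small to contain a shadow set properly. *)
Lemma nbr_top_leq : (#|nbr X A| <= #|A|)%N.
Proof.
have /and3P[FX Fa /eqP Fw] := Fmax; have /antichainP h := Fa.
set F' := (F :\: A) :|: nbr X A.
have F'X : F' \subset X.
  by rewrite subUset nbr_sub andbT (subset_trans _ FX) // subsetDl.
have low x : x \in F :\: A -> x \in F /\ (#|x| <= k.-1)%N.
  move=> /setDP[xF]; rewrite in_setI xF in_set /= => ne; split => //.
  by rewrite -ltnS prednK // ltn_neqAle ne Fk.
have F'a : antichain F'.
  apply/antichainP => x y /setUP[xF|xN] /setUP[yF|yN] xy.
  - by apply: h => //; [case: (low x xF)|case: (low y yF)].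
  - have [xF' xk] := low x xF.
    move: yN; rewrite inE => /andP[_ /existsP[i /andP[iy iA]]].
    have e : x = i |: y.
      apply: h => //; first by case/setIP: iA.
      by rewrite (subset_trans xy) // subsetUr.
    by case/setDP: xF => _; rewrite e iA.
  - have [_ yk] := low y yF.
    by apply/eqP; rewrite eqEcard xy (card_nbr_elt Ak xN).
  - by apply/eqP; rewrite eqEcard xy (card_nbr_elt Ak xN) (card_nbr_elt Ak yN) leqnn.
have := width_ge F'X F'a; rewrite -Fw cardsU.
have -> : (F :\: A) :&: nbr X A = set0.
  apply/setP => y; rewrite in_setI in_set0; apply/negP => /andP[/setDP[yF _] /nbr_disjoint].
  by rewrite yF.
rewrite cards0 subn0 -[leqRHS](cardsID (layer n k)) addnC.
by rewrite setDIr setDv set0U leq_add2r.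
Qed.
End Push.

Definition expanding X k := forall A, A \subset X -> (forall x, x \in A -> #|x| = k) ->
  A != set0 -> (#|A| < #|nbr X A|)%N.

Lemma maximum_antichain_le X F h : maximum_antichain X F ->
  (forall k, (h < k)%N -> (k <= n)%N -> expanding X k) ->
  forall x, x \in F -> (#|x| <= h)%N.
Proof.
move=> Fmax ex x xF; rewrite leqNgt; apply/negP => hx.
case: (@arg_maxnP _ x (fun y => y \in F) (fun y => #|y|) xF) => y yF ymax.
have hy : (h < #|y|)%N := leq_trans hx (ymax x xF).
have y0 : (0 < #|y|)%N by apply: leq_ltn_trans hy.
have := nbr_top_leq y0 Fmax ymax; rewrite leqNgt => /negP; apply.
have /and3P[FX _ _] := Fmax.
apply: (ex _ hy (card_le_n y)).
- by rewrite (subset_trans _ FX) // subsetIl.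
- by move=> z /setIP[_]; rewrite inE => /eqP.
- by apply/set0Pn; exists y; rewrite in_setI yF inE /=.
Qed.

Lemma maximum_antichain_layer X F k : maximum_antichain X F ->
  (forall x, x \in F -> #|x| = k) -> F = X :&: layer n k.
Proof.
move=> /and3P[FX Fa /eqP Fw] Fk; apply/eqP; rewrite eqEcard; apply/andP; split.
  by apply/subsetP => x xF; rewrite in_setI (subsetP FX) // inE Fk /=.
rewrite Fw width_ge ?subsetIl //.
by apply: (@antichain_layer _ k) => x; rewrite !inE => /andP[_ /eqP].
Qed.

Definition middle_layers X :=
  [forall F : fam, maximum_antichain X F ==>
     (F == X :&: layer n n./2) || (F == X :&: layer n (uphalf n))]
  && (width X == maxn #|X :&: layer n n./2| #|X :&: layer n (uphalf n)|).

Lemma middle_layersP X :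
  (forall F, maximum_antichain X F ->
     F = X :&: layer n n./2 \/ F = X :&: layer n (uphalf n)) -> middle_layers X.
Proof.
move=> h; apply/andP; split.
  apply/forall_inP => F /h[] /eqP ->; rewrite ?orbT //.
have lay k : (#|X :&: layer n k| <= width X)%N.
  rewrite width_ge ?subsetIl //.
  by apply: (@antichain_layer _ k) => x; rewrite !inE => /andP[_ /eqP].
rewrite eqn_leq geq_max !lay !andbT.
have [F Fmax] := exists_maximum_antichain X.
have /and3P[_ _ /eqP <-] := Fmax; rewrite leq_max.
by case: (h F Fmax) => ->; rewrite leqnn ?orbT.
Qed.

(** Between the two middle layers of an odd cube, expansion cannot hold for all families in both
    directions, since applied to both full layers it would make each larger than the other. *)
Definition expanding_upto X k t := forall A, A \subset X -> (forall x, x \in A -> #|x| = k) ->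
  A != set0 -> (#|A| <= t)%N -> (#|A| < #|nbr X A|)%N.

Lemma top_layer_large X F k t : maximum_antichain X F -> (0 < k)%N ->
  (forall x, x \in F -> (#|x| <= k)%N) -> expanding_upto X k t ->
  F :&: layer n k != set0 -> (t < #|F :&: layer n k|)%N.
Proof.
move=> Fmax k0 Fk ex A0; rewrite ltnNge; apply/negP => At.
have := nbr_top_leq k0 Fmax Fk; rewrite leqNgt => /negP; apply.
have /and3P[FX _ _] := Fmax; apply: ex => //.
  by rewrite (subset_trans _ FX) // subsetIl.
by move=> z /setIP[_]; rewrite inE => /eqP.
Qed.

(** For even n the bounds from above and from below meet. For odd n, suppose F meets both middle
    layers; then each part has more than t sets. A subfamily of t sets of the upper part has more
    than t lower neighbours, disjoint from the lower part of F, so the lower layer of X would have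
    more than 2t sets. *)
Lemma maximum_antichain_middle X t : (0 < n)%N ->
  (forall k, (uphalf n < k)%N -> (k <= n)%N -> expanding X k /\ expanding (cpl X) k) ->
  (odd n -> [/\ (0 < t)%N, expanding_upto X (uphalf n) t, expanding_upto (cpl X) (uphalf n) t
     & #|X :&: layer n n./2| <= t.*2]%N) ->
  middle_layers X.
Proof.
move=> n0 ex exm; apply: middle_layersP => F Fmax.
have Fc := maximum_antichain_cpl Fmax.
have up x : x \in F -> (#|x| <= uphalf n)%N.
  by apply: (maximum_antichain_le Fmax) => k k1 k2; case: (ex k k1 k2).
have upc x : x \in cpl F -> (#|x| <= uphalf n)%N.
  by apply: (maximum_antichain_le Fc) => k k1 k2; case: (ex k k1 k2).
have half : (n = n./2 + uphalf n)%N by rewrite uphalf_half -[LHS]odd_double_half; clear; lia.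
have cC x : #|~: x| = (n - #|x|)%N by rewrite cardsCs setCK card_ord.
have lo x : x \in F -> (n./2 <= #|x|)%N.
  move=> xF; have := upc (~: x); rewrite mem_cpl setCK cC => /(_ xF).
  by move: half (card_le_n x); clear; lia.
case: (boolP (odd n)) => on; last first.
  left; apply: maximum_antichain_layer => // x xF; apply/eqP.
  by rewrite eqn_leq lo // andbT (leq_trans (up x xF)) // uphalf_half (negbTE on).
have uE : uphalf n = n./2.+1 by rewrite uphalf_half on.
have [t0 ex1 ex2 lay] := exm on.
have u0 : (0 < uphalf n)%N by rewrite uE.
have [A0|An0] := eqVneq (F :&: layer n (uphalf n)) set0.
  left; apply: maximum_antichain_layer => // x xF; apply/eqP.
  rewrite eqn_leq lo // andbT -ltnS -uE ltn_neqAle up // andbT.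
  apply/negP => xu; have : x \in F :&: layer n (uphalf n) by rewrite in_setI xF inE.
  by rewrite A0 in_set0.
have [B0|Bn0] := eqVneq (cpl F :&: layer n (uphalf n)) set0.
  right; apply: maximum_antichain_layer => // x xF; apply/eqP.
  rewrite eqn_leq up // uE ltn_neqAle lo // andbT.
  apply/negP => /eqP xu.
  have : ~: x \in cpl F :&: layer n (uphalf n).
    rewrite in_setI mem_cpl setCK xF inE cC -xu /=; apply/eqP.
    by move: half; clear; lia.
  by rewrite B0 in_set0.
have lA := top_layer_large Fmax u0 up ex1 An0.
have lB := top_layer_large Fc u0 upc ex2 Bn0.
have [A' A'A cA'] := exists_subset_card (ltnW lA).
have /and3P[FX _ _] := Fmax.
have A'k x : x \in A' -> #|x| = uphalf n.
  by move=> /(subsetP A'A) /setIP[_]; rewrite inE => /eqP.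
have A'X : A' \subset X.
  by rewrite (subset_trans A'A) // (subset_trans _ FX) // subsetIl.
have A'0 : A' != set0 by rewrite -card_gt0 cA'.
have lN : (t < #|nbr X A'|)%N by rewrite -{1}cA'; apply: ex1; rewrite ?cA'.
set B := cpl (cpl F :&: layer n (uphalf n)).
have BF x : x \in B -> x \in F /\ #|x| = n./2.
  rewrite mem_cpl in_setI mem_cpl setCK inE cC => /andP[xF /eqP h]; split => //.
  by move: half h (card_le_n x); clear; lia.
have sub : B :|: nbr X A' \subset X :&: layer n n./2.
  apply/subsetP => x /setUP[/BF[xF xk]|xN]; rewrite in_setI inE.
    by rewrite (subsetP FX) // xk /=.
  by rewrite (subsetP (nbr_sub X A')) // (card_nbr_elt A'k xN) uE /=.
have dis : B :&: nbr X A' = set0.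
  apply/setP => x; rewrite in_setI in_set0; apply/negP => /andP[/BF[xF _] xN].
  suff /(nbr_disjoint Fmax) : x \in nbr X (F :&: layer n (uphalf n)) by rewrite xF.
  move: xN; rewrite !in_set => /andP[-> /existsP[i /andP[ix iA]]] /=.
  apply/existsP; exists i; rewrite ix /=; have := subsetP A'A _ iA.
  by rewrite !in_set.
have := subset_leq_card sub; rewrite cardsU dis cards0 subn0 card_cpl.
by move: lB lN lay; clear; lia.
Qed.

End Antichains.

(** * Choice of constants and the union of all exceptional events *)

Section GoodFamilies.
Variables (R : realType) (p : R).
Hypotheses (p34 : 3 / 4 < p) (p1 : p <= 1).

Lemma binomial_weight_cpl n (X : {set {set 'I_n}}) :
  binomial_weight p (cpl X) = binomial_weight p X.
Proof.
rewrite /binomial_weight [RHS](reindex_inj (inv_inj (@setCK 'I_n))) /=.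
by apply: eq_bigr => x _; rewrite mem_cpl.
Qed.

Lemma Pr_cpl n (E F : pred {set {set 'I_n}}) :
  (forall X, F X = E (cpl X)) -> Pr p F = Pr p E.
Proof.
move=> h; rewrite /Pr [RHS](reindex_inj (inv_inj (@cplK n))) /=.
by apply: eq_big => [X|X _]; [exact: h|rewrite binomial_weight_cpl].
Qed.

Lemma Pr_not_and n (E F : pred {set {set 'I_n}}) :
  Pr p (fun X => ~~ (E X && F X)) <= Pr p (fun X => ~~ E X) + Pr p (fun X => ~~ F X).
Proof.
have p0 : 0 <= p by move: p34; lra.
have := @Pr_union R n p p0 p1 bool predT (fun X => ~~ (E X && F X))
  (fun b X => if b then ~~ E X else ~~ F X).
rewrite big_bool /=; apply => X; rewrite negb_and => /orP[h|h]; first by exists true.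
by exists false.
Qed.

Lemma Pr_not_imply n (b : bool) (E : pred {set {set 'I_n}}) : (b -> Pr p (fun X => ~~ E X) * n%:R ^+ 2 <= 1) ->
  Pr p (fun X => ~~ (b ==> E X)) * n%:R ^+ 2 <= 1.
Proof.
case: b => [/(_ isT) //|_] /=; rewrite /Pr big_pred0 ?mul0r //.
Qed.

(** Degrees are controlled on the levels k >= n/2 - n/M, where the union bound holds; the rest is
    asked only near the middle, where [Gam] has order n^4. *)
Definition good_level n M K3 (c q K : R) (k : nat) (X : {set {set 'I_n}}) :=
  (((M - 2) * n <= 2 * M * k)%N ==> good_deg M k X) &&
  ([&& (0 < k)%N, midl n k & midl n k.-1] ==>
     (good_gam p k X && (good_path M K3 c k X && (good_coarse p q K k X &&
      (#|layer n k :&: X|%:R <= 11 / 10 * p * #|layer n k|%:R))))).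

Definition good_family n M K3 C0 (c eps q K : R) (X : {set {set 'I_n}}) :=
  good_bad p C0 eps X && [forall k : 'I_n.+1, good_level M K3 c q K k X].

Lemma bin_ge n m : (0 < m)%N -> (m < n)%N -> (n <= 'C(n, m))%N.
Proof.
elim: n m => // n IH [//|m] _; rewrite ltnS leq_eqVlt => /orP[/eqP <-|mn].
  by rewrite binSn.
by rewrite binS addnC -addn1 addnC leq_add ?bin_gt0 ?IH // ltnW // ltnW.
Qed.

Lemma card_layer n k : #|layer n k| = 'C(n, k).
Proof. by rewrite /layer card_draws card_ord. Qed.

Section Deterministic.
Variables (n M K3 C0 : nat) (c g eps q K e0 : R) (X : {set {set 'I_n}}).
Hypothesis num : numeric n p M K3 C0 c g eps q K e0.
Hypotheses (n40 : (40 <= n)%N) (M20 : (20 <= M)%N).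
Hypotheses (gX : good_family M K3 C0 c eps q K X) (gX' : good_family M K3 C0 c eps q K (cpl X)).

Let level (Y : {set {set 'I_n}}) k : good_family M K3 C0 c eps q K Y -> (k <= n)%N -> good_level M K3 c q K k Y.
Proof. by move=> /andP[_ /forallP h]; rewrite -ltnS => kn; have := h (Ordinal kn). Qed.

Let good_regular (Y : {set {set 'I_n}}) k : good_family M K3 C0 c eps q K Y -> (k <= n)%N -> (0 < k)%N ->
  midl n k -> midl n k.-1 -> ((M - 2) * n <= 2 * M * k)%N -> regular p M K3 C0 c eps q K k Y.
Proof.
move=> gY kn k0 m1 m2 hM; have /andP[] := level gY kn.
rewrite hM k0 m1 m2 /= => h1 /and4P[h2 h3 h4 _]; case/andP: gY => h5 _.
by apply/and5P.
Qed.

Lemma good_expanding k : (uphalf n < k)%N -> (k <= n)%N -> expanding X k.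
Proof.
move=> ku kn A AX Ak A0; case: num => _ _ _ _ n0 _ eps0 _ _ _ M12 _ _ _ _ _ _ _ _ hM hfar.
have k0 : (0 < k)%N by apply: leq_ltn_trans ku.
have kk : (n.+1 < k.*2)%N.
  by move: ku; rewrite uphalf_half; have := odd_double_half n; clear; case: (odd n); lia.
have deg_up j : (n <= j.*2)%N -> ((M - 2) * n <= 2 * M * j)%N.
  move=> hj; apply: (@leq_trans (M * n)); first by rewrite leq_mul2r leq_subr orbT.
  by rewrite (mulnC 2%N) -mulnA leq_mul2l mul2n hj orbT.
have dk : ((M - 2) * n <= 2 * M * k)%N by apply: deg_up; move: kk; clear; lia.
(* The case split is whether linear degrees are also known on the complemented level n - k + 1. If
   they are not, that level is so low that [hall_far] applies. *)
have [near|far] := leqP ((M - 2) * n)%N (2 * M * (n - k).+1)%N; last first.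
  case/andP: (gX) => b1 _; case/andP: (gX') => b2 _.
  have M0 : (0 < M)%N by apply: leq_trans M20.
  have /andP[d _] := level gX kn.
  rewrite dk in d.
  apply: (hall_far p34 p1 eps0 n0 M0 k0 kn hM hfar _ d b1 b2 AX Ak A0).
  have e : (k - (n - k).+1 + 2 * (n - k).+1 = n.+1)%N by move: kk kn; clear; lia.
  have : (M * (k - (n - k).+1) + 2 * M * (n - k).+1 = M * n.+1)%N.
    by rewrite -e mulnDr; congr (_ + _)%N; rewrite mulnA (mulnC 2%N).
  move: far M0; rewrite mulnBl; set a := (M * _)%N; set b := (2 * M * _)%N.
  rewrite mulnS; set d' := (M * n)%N; clear; lia.
have h9 : (9 * n <= 20 * (n - k).+1)%N.
  have M0 : (0 < M)%N by apply: leq_trans M20.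
  rewrite -(leq_pmul2l M0); apply: (@leq_trans (10 * ((M - 2) * n))).
    rewrite !mulnA leq_mul2r; apply/orP; right; move: M20; clear; lia.
  apply: (@leq_trans (10 * (2 * M * (n - k).+1))); first by rewrite leq_mul2l near orbT.
  by rewrite !mulnA leq_mul2r; apply/orP; right; clear; lia.
have [m1 m2 m3 m4] : [/\ midl n k, midl n k.-1, midl n (n - k).+1 & midl n (n - k).+1.-1].
  by rewrite /midl; split; move: kk kn h9 n40; clear; lia.
have kn' : ((n - k).+1 <= n)%N by move: k0 kn; clear; lia.
apply: (hall_near num AX Ak k0 kn m1 m2 m3 m4 _ _ _ A0).
- exact: good_regular.
- exact: good_regular.
- by move: kk kn; clear; lia.
Qed.

Lemma good_expanding_upto t : odd n -> t%:R <= 6 / 10 * p * #|layer n (uphalf n)|%:R ->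
  expanding_upto X (uphalf n) t.
Proof.
move=> on ht A AX Ak A0 At.
have e : n = (uphalf n).*2.-1.
  by rewrite uphalf_half on -{1}(odd_double_half n) on; clear; lia.
have k0 : (0 < uphalf n)%N by move: e n40; clear; lia.
have kn : (uphalf n <= n)%N by move: e n40; clear; lia.
have kk : ((n - uphalf n).+1 = uphalf n)%N by move: e n40; clear; lia.
have [m1 m2] : midl n (uphalf n) /\ midl n (uphalf n).-1.
  by rewrite /midl; split; move: e n40; clear; lia.
have dk : ((M - 2) * n <= 2 * M * uphalf n)%N.
  apply: (@leq_trans (M * n)); first by rewrite leq_mul2r leq_subr orbT.
  by rewrite (mulnC 2%N) -mulnA leq_mul2l; apply/orP; right; move: e n40; clear; lia.
apply: (hall_middle num AX Ak k0 kn kk m1 m2 _ _ A0); try exact: good_regular.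
by apply: le_trans ht; rewrite ler_nat.
Qed.
End Deterministic.

Lemma good_family_middle n M K3 C0 (c g eps q K e0 : R) (X : {set {set 'I_n}}) :
  numeric n p M K3 C0 c g eps q K e0 -> (40 <= n)%N -> (20 <= M)%N ->
  good_family M K3 C0 c eps q K X -> good_family M K3 C0 c eps q K (cpl X) ->
  middle_layers X.
Proof.
move=> num n40 M20 gX gX'.
have gX2 : good_family M K3 C0 c eps q K (cpl (cpl X)) by rewrite cplK.
have n0 : (0 < n)%N by apply: leq_trans n40.
(* The largest size covered by [hall_middle]. Since 2t > 12/10 p L - 2 and p L >= 30, twice [t]
   still covers a layer of X, which has at most 11/10 p L sets. *)
pose L := #|layer n (uphalf n)|; pose t := Num.truncn (6 / 10 * p * L%:R : R).
have pL0 : 0 <= 6 / 10 * p * L%:R by rewrite mulr_ge0 //; move: p34; lra.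
have /andP[t1 t2] := truncn_itv pL0.
rewrite -/t in t1 t2.
apply: (@maximum_antichain_middle _ _ t n0).
  move=> k k1 k2; split; first exact: (good_expanding num n40 M20 gX gX').
  exact: (good_expanding num n40 M20 gX' gX2).
move=> on.
have e : n = n./2.*2.+1 by rewrite -{1}(odd_double_half n) on.
have u : uphalf n = n./2.+1 by rewrite uphalf_half on.
have Lh : #|layer n n./2| = L.
  rewrite /L !card_layer u -bin_sub; last by move: e; clear; lia.
  by congr ('C(_, _)); move: e; clear; lia.
have L40 : 40 <= L%:R :> R.
  rewrite ler_nat (leq_trans n40) // -Lh card_layer bin_ge //; move: e n40; clear; lia.
have pL : 3 / 4 * L%:R <= p * L%:R by rewrite ler_wpM2r // ltW.
have tR : 6 / 10 * p * L%:R < t%:R + 1 by rewrite natr1.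
split.
- by rewrite lt0n; apply/eqP => t0; move: tR; rewrite t0; move: pL L40; lra.
- exact: (good_expanding_upto num n40 gX gX').
- exact: (good_expanding_upto num n40 gX' gX2).
have hn : (n./2 <= n)%N by move: e; clear; lia.
have /andP[_ /forallP /(_ (inord n./2))] := gX.
rewrite inordK ?ltnS // => /andP[_].
have -> : [&& (0 < n./2)%N, midl n n./2 & midl n n./2.-1].
  by rewrite /midl; move: e n40; clear; lia.
move=> /and4P[_ _ _]; rewrite Lh setIC => h.
by rewrite -(ler_nat R) -muln2 natrM; move: h tR pL L40; lra.
Qed.

(** Each condition fails with probability at most n^-2. With five conditions on each of n + 1 levels
    and one global condition, the total is at most (5n + 6)/n^2 <= 11/n. *)
Lemma Pr_good_family n M K3 C0 (c eps q K : R) : (0 < n)%N ->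
  Pr p (fun X : {set {set 'I_n}} => ~~ good_bad p C0 eps X) * n%:R ^+ 2 <= 1 ->
  (forall k, ((M - 2) * n <= 2 * M * k)%N ->
     Pr p (fun X : {set {set 'I_n}} => ~~ good_deg M k X) * n%:R ^+ 2 <= 1) ->
  (forall k, (0 < k)%N -> midl n k -> midl n k.-1 -> [/\
     Pr p (fun X : {set {set 'I_n}} => ~~ good_gam p k X) * n%:R ^+ 2 <= 1,
     Pr p (fun X : {set {set 'I_n}} => ~~ good_path M K3 c k X) * n%:R ^+ 2 <= 1,
     Pr p (fun X : {set {set 'I_n}} => ~~ good_coarse p q K k X) * n%:R ^+ 2 <= 1 &
     Pr p (fun X : {set {set 'I_n}} =>
       ~~ (#|layer n k :&: X|%:R <= 11 / 10 * p * #|layer n k|%:R)) * n%:R ^+ 2 <= 1]) ->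
  Pr p (fun X : {set {set 'I_n}} => ~~ good_family M K3 C0 c eps q K X) * n%:R <= 11.
Proof.
move=> n0 hb hd hm; have p0 : 0 <= p by move: p34; lra.
have nR : 1 <= n%:R :> R by rewrite ler1n.
have n2 : 0 < n%:R ^+ 2 :> R by rewrite exprn_gt0 // ltr0n.
have lev (k : 'I_n.+1) : Pr p (fun X : {set {set 'I_n}} => ~~ good_level M K3 c q K k X) <= 5 / n%:R ^+ 2.
  rewrite ler_pdivlMr //.
  apply: le_trans (ler_wpM2r (ltW n2) (Pr_not_and _ _)) _; rewrite mulrDl.
  have h1 := @Pr_not_imply n _ (fun X : {set {set 'I_n}} => good_deg M k X) (hd k).
  set b := [&& _, _ & _]; case: (boolP b) => [/and3P[k0 m1 m2]|_] /=; last first.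
    rewrite [X in _ + X * _ <= _](_ : _ = 0) ?mul0r ?addr0; first by apply: le_trans h1 _; lra.
    by rewrite /Pr big_pred0.
  have [a1 a2 a3 a4] := hm k k0 m1 m2.
  apply: (@le_trans _ _ (1 + 4)); last by lra.
  apply: lerD => //.
  apply: le_trans (ler_wpM2r (ltW n2) (Pr_not_and _ _)) _; rewrite mulrDl.
  apply: (@le_trans _ _ (1 + 3)); last by lra.
  apply: lerD => //.
  apply: le_trans (ler_wpM2r (ltW n2) (Pr_not_and _ _)) _; rewrite mulrDl.
  apply: (@le_trans _ _ (1 + 2)); last by lra.
  apply: lerD => //.
  apply: le_trans (ler_wpM2r (ltW n2) (Pr_not_and _ _)) _; rewrite mulrDl.
  apply: (@le_trans _ _ (1 + 1)); last by lra.
  exact: lerD.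
have all_lev : Pr p (fun X : {set {set 'I_n}} => ~~ [forall k : 'I_n.+1, good_level M K3 c q K k X])
    <= n.+1%:R * (5 / n%:R ^+ 2).
  have cn : #|(predT : pred 'I_n.+1)| = n.+1 by rewrite -[RHS](card_ord n.+1); apply: eq_card.
  apply: (@le_trans _ _ (#|(predT : pred 'I_n.+1)|%:R * (5 / n%:R ^+ 2))); last by rewrite cn.
  apply: (@Pr_union_le R n p p0 p1 _ predT _
    (fun (k : 'I_n.+1) X => ~~ good_level M K3 c q K k X)) => // X.
  by rewrite negb_forall => /existsP[k hk]; exists k.
have tot : Pr p (fun X : {set {set 'I_n}} => ~~ good_family M K3 C0 c eps q K X) <=
    (1 + n.+1%:R * 5) / n%:R ^+ 2.
  apply: le_trans (Pr_not_and _ _) _; rewrite mulrDl; apply: lerD.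
    by rewrite mul1r -[_^-1]mul1r ler_pdivlMr.
  by rewrite -mulrA.
apply: le_trans (ler_wpM2r (ler0n _ n) tot) _.
have -> : (1 + n.+1%:R * 5) / n%:R ^+ 2 * n%:R = (1 + n.+1%:R * 5) / n%:R :> R.
  by field; rewrite gt_eqF //; lra.
rewrite ler_pdivrMr ?ltr0n // -natr1; lra.
Qed.

Lemma coarse_mass (e1 g : R) n : (0 < n)%N ->
  e1 / n%:R ^+ 3 * p * (g * n%:R ^+ 4) / 64 = e1 * p * g / 64 * n%:R.
Proof. by move=> n0; field; rewrite pnatr_eq0 -lt0n. Qed.

Lemma half_split (a b : R) : a <= b / 2 -> a + 4 * (b / 8) <= b.
Proof. lra. Qed.

Lemma half_mul (a m b : R) : a * 2 <= m * b -> a <= b / 2 * m.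
Proof. lra. Qed.

Lemma complement_bound (P b e : R) : 1 - P <= b + b -> b <= e / 2 -> 1 - e <= P.
Proof. lra. Qed.

Lemma fiftieth (m : R) : 200 <= m -> 4 <= 1 / 50 * m.
Proof. lra. Qed.

Lemma exists_Gam_const : exists g : R, [/\ 0 < g, g <= 1 &
  forall n (x : {set 'I_n}), (12 <= n)%N -> (n <= 6 * #|x|)%N -> (6 * #|x| <= 5 * n)%N ->
    g * n%:R ^+ 4 <= #|Gam x|%:R].
Proof.
exists (1 / 20736); split; [by lra|by lra|].
by move=> n x h1 h2 h3; exact: card_Gam_mid.
Qed.

Lemma exists_eps (a m : R) : 0 < a -> a <= 1 -> 20 <= m -> exists eps : R,
  [/\ 0 < eps, eps <= 1, eps * 192 * 16 <= a & 4 * m * eps <= 1].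
Proof.
move=> a0 a1 m20; have m0 : 0 < m by lra.
have E : a / (3072 * m) * m * 3072 = a by field; rewrite gt_eqF.
exists (a / (3072 * m)).
have x0 : 0 < a / (3072 * m) by rewrite divr_gt0 // mulr_gt0.
move: E x0; move: (a / (3072 * m)) => x E x0.
have h : x * 20 <= x * m by rewrite ler_wpM2l // ltW.
by split => //; lra.
Qed.

(* The last clause is quantified so that the large constant stays out of reach of
   linear arithmetic in the proofs using it. *)
Lemma exists_e0 (d : R) : 0 < d -> exists e0 : R,
  [/\ 0 < e0, e0 <= 1 & forall x, x <= 1 / 50 -> (d + 10) * e0 + x <= 1 / 25].
Proof.
move=> d0; have d10 : 0 < d + 10 by lra.
exists ((1 / 50) / (d + 10)).
have E : (d + 10) * ((1 / 50) / (d + 10)) = 1 / 50 by rewrite mulrC divfK // gt_eqF.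
have x0 : 0 < (1 / 50) / (d + 10) by rewrite divr_gt0 // divr_gt0.
move: E x0; move: ((1 / 50) / (d + 10)) => x E x0.
have dx : 0 < d * x by rewrite mulr_gt0.
split => //; first by lra.
by move=> y y1; lra.
Qed.

(** The error K e1 must be small while the exponent K^2 e1 a is large, so e1 is of order e0^2 and K
    of order 1/e0. Solving K e1 = e0/8 and K^2 e1 a = 1024 gives e1 = e0^2 a/256^2. *)
Lemma exists_e1K (e0 a : R) : 0 < e0 -> e0 <= 1 -> 0 < a -> a <= 1 -> exists e1 K : R,
  [/\ 0 < e1, e1 <= 1 & 0 < K] /\
  [/\ K * e1 = e0 / 8, 1024 <= K ^+ 2 * e1 * a & K * (e1 * a) <= 64].
Proof.
move=> e00 e01 a0 a1; pose e1 : R := e0 ^+ 2 * a / 256 ^+ 2.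
have s256 : 1 <= 256 ^+ 2 :> R by rewrite exprn_ege1 // ler1n.
have e10 : 0 < e1 by rewrite divr_gt0 ?exprn_gt0 // mulr_gt0 // exprn_gt0.
have e11 : e1 <= 1.
  rewrite ler_pdivrMr ?exprn_gt0 // mul1r; apply: le_trans s256.
  by rewrite mulr_ile1 ?exprn_ge0 ?exprn_ile1 // ltW.
pose K : R := e0 / (8 * e1).
have K0 : 0 < K by rewrite divr_gt0 // mulr_gt0.
have hK1 : K * e1 = e0 / 8 by rewrite /K; field; rewrite gt_eqF.
exists e1, K; split; split => //.
  rewrite le_eqVlt; apply/orP; left; apply/eqP.
  have -> : K ^+ 2 * e1 * a = (K * e1) ^+ 2 * a / e1 by field; rewrite gt_eqF.
  by rewrite hK1 /e1; field; rewrite !gt_eqF.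
have -> : K * (e1 * a) = e0 / 8 * a by rewrite -hK1; ring.
have : e0 * a <= 1 by rewrite mulr_ile1 // ltW.
by rewrite mulrAC ler_pdivrMr // => h; apply: le_trans h _; lra.
Qed.

(** All constants are fixed here; what remains is to set q = e1/n^3 and take n large. The family and
    its complement have the same law, so both are good with probability at least 1 - 22/n. *)
Lemma middle_layers_of_parameters (g c eps e0 e1 K e : R) (M K3 C0 nd np nb : nat) :
  0 < e -> 0 < g -> 0 < c -> (20 <= M)%N -> 0 < eps -> eps <= 1 ->
  eps * 192 * 16 <= p * g * c -> 4 * M%:R * eps <= 1 -> (0 < C0)%N -> 0 < e0 ->
  (forall x, x <= 1 / 50 -> (6144 / (p * g * c) + 10) * e0 + x <= 1 / 25) ->
  0 < e1 -> e1 <= 1 -> 0 < K -> K * e1 = e0 / 8 ->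
  1024 <= K ^+ 2 * e1 * p * g -> K * (e1 * p * g) <= 64 ->
  (forall n (x : {set 'I_n}), (12 <= n)%N -> (n <= 6 * #|x|)%N -> (6 * #|x| <= 5 * n)%N ->
    g * n%:R ^+ 4 <= #|Gam x|%:R) ->
  (forall n, (nd <= n)%N -> forall k, ((M - 2) * n <= 2 * M * k)%N ->
    Pr p (fun X : {set {set 'I_n}} => ~~ good_deg M k X) * n%:R ^+ 2 <= 1) ->
  (forall n, (np <= n)%N -> forall k,
    Pr p (fun X : {set {set 'I_n}} => ~~ good_path M K3 c k X) * n%:R ^+ 2 <= 1) ->
  (forall n, (nb <= n)%N ->
    Pr p (fun X : {set {set 'I_n}} => ~~ good_bad p C0 eps X) * n%:R ^+ 2 <= 1) ->
  exists n0, forall n, (n0 <= n)%N ->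
  1 - e <= Pr p (fun X : {set {set 'I_n}} => middle_layers X).
Proof.
move=> e_gt0 g0 c0 M20 eps0 eps1 epsc epsM C00 e00 hodd e10 e11 K0 hK1 hK2 hK3 hG hd hp hb.
have p0 : 0 < p by move: p34; lra.
have pg0 : 0 < p * g by exact: mulr_gt0.
have pgc0 : 0 < p * g * c by exact: mulr_gt0.
have [ng hg] := Pr_good_gam p34 p1 g0.
have [nl hl] := Pr_layer_large p34 p1 g0.
have [nc hc] := Pr_good_coarse p34 p1 g0 e10 K0 hK2 hK3.
have h64 : 0 < e1 * p * g / 64 by rewrite divr_gt0 // mulr_gt0 // mulr_gt0.
have [nq hq] := @poly_le_exp R 6 34 _ h64.
have [n1 hn1] := natr_ge (200 : R).
have [n2 hn2] := natr_ge ((1 + 2 * C0%:R) * 2 / e0).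
have [n3 hn3] := natr_ge (32 * K3%:R / (p * g)).
have [n4 hn4] := natr_ge (192 * C0%:R * 16 / (p * g * c)).
have [n5 hn5] := natr_ge (11 * 2 / e).
exists (maxn (maxn (maxn nd np) (maxn nb ng)) (maxn (maxn (maxn nl nc) (maxn nq n1))
  (maxn (maxn n2 n3) (maxn (maxn n4 n5) (maxn 40 (M * C0 * (1 + 2 * M))))))).
move=> n; rewrite !geq_max => /andP[/andP[/andP[/hd dd /hp dp] /andP[/hb db /hg dg]]].
move=> /andP[/andP[/andP[/hl dl /hc dc] /andP[/hq dq /hn1 d1]]].
move=> /andP[/andP[/hn2 d2 /hn3 d3] /andP[/andP[/hn4 d4 /hn5 d5] /andP[n40 nM]]].
have n0 : (0 < n)%N by apply: leq_trans n40.
have nR : 0 < n%:R :> R by rewrite ltr0n.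
have nR1 : 1 <= n%:R :> R by rewrite ler1n.
have nE : n%:R != 0 :> R by rewrite gt_eqF.
have Gmid (x : {set 'I_n}) : (n <= 6 * #|x|)%N -> (6 * #|x| <= 5 * n)%N ->
    g * n%:R ^+ 4 <= #|Gam x|%:R.
  by apply: hG; apply: leq_trans n40.
have Glev k : midl n k -> forall x : {set 'I_n}, #|x| = k -> g * n%:R ^+ 4 <= #|Gam x|%:R.
  by move=> /andP[m1 m2] x xk; apply: Gmid; rewrite xk.
pose q : R := e1 / n%:R ^+ 3.
have n31 : 1 <= n%:R ^+ 3 :> R by rewrite exprn_ege1.
have q0 : 0 < q by rewrite divr_gt0 // exprn_gt0.
have num : numeric n p M K3 C0 c g eps q K e0.
  constructor => //.
  - exact: ltW.
  - by rewrite ler_pdivrMr ?mul1r ?exprn_gt0 //; exact: le_trans n31.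
  - exact: ltW.
  - by apply: leq_trans M20.
  - rewrite natrM natrX ler_pdivlMr //.
    have -> : K3%:R * n%:R ^+ 3 * 32 = 32 * K3%:R * n%:R ^+ 3 :> R by ring.
    have -> : p * g * n%:R ^+ 4 = n%:R * (p * g) * n%:R ^+ 3 by ring.
    apply: ler_wpM2r; first exact: exprn_ge0.
    by rewrite -ler_pdivrMr.
  - rewrite /q coarse_mass // expRN ler_pdivrMr ?expR_gt0 // mul1r.
    apply: le_trans dq.
    have nat17 : ((n.+1 ^ 4).+1 <= 17 * n ^ 4)%N.
      apply: (@leq_ltn_trans ((2 * n) ^ 4)); first by rewrite leq_exp2r //; move: n40; clear; lia.
      rewrite expnMn (_ : 2 ^ 4 = 16)%N //; have : (0 < n ^ 4)%N by rewrite expn_gt0 n0.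
      by move: (n ^ 4)%N => y; clear; lia.
    have -> : 34 * n%:R ^+ 6 = 2 * (17 * n%:R ^+ 4 * n%:R ^+ 2) :> R by ring.
    apply: ler_wpM2l => //; apply: ler_wpM2r; first exact: exprn_ge0.
    by rewrite -natrX -natrM ler_nat.
  - by rewrite [leRHS]mulrC -ler_pdivrMr.
  - have -> : n%:R^-1 + 2 * n%:R * C0%:R * q + 4 * K * q * n%:R ^+ 3 =
        (1 + 2 * C0%:R * e1 / n%:R) / n%:R + 4 * (K * e1).
      by rewrite /q; field.
    rewrite hK1; apply: half_split; rewrite ler_pdivrMr //.
    apply: (@le_trans _ _ (1 + 2 * C0%:R)); last by apply: half_mul; rewrite -ler_pdivrMr.
    rewrite lerD2l -mulrA ler_piMr ?mulr_ge0 // ler_pdivrMr // mul1r.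
    exact: le_trans nR1.
  - by apply: hodd; rewrite ler_pdivrMr //; exact: fiftieth.
have bad : Pr p (fun X : {set {set 'I_n}} => ~~ good_family M K3 C0 c eps q K X) * n%:R <= 11.
  apply: Pr_good_family => // k k0 m1 m2; split.
  - by apply: dg; exact: Glev.
  - exact: dp.
  - by apply: dc => //; exact: Glev.
  - by apply: dl; exact: Glev.
have p0' := ltW p0.
pose E (X : {set {set 'I_n}}) := good_family M K3 C0 c eps q K X && good_family M K3 C0 c eps q K (cpl X).
apply: (@le_trans _ _ (Pr p E)); last first.
  by apply: (Pr_mono p0' p1) => X /andP[]; exact: (good_family_middle num).
have cE : Pr p (fun X : {set {set 'I_n}} => ~~ good_family M K3 C0 c eps q K (cpl X)) =
    Pr p (fun X : {set {set 'I_n}} => ~~ good_family M K3 C0 c eps q K X).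
  by apply: Pr_cpl.
have H : 1 - Pr p E <= Pr p (fun X : {set {set 'I_n}} => ~~ good_family M K3 C0 c eps q K X) +
    Pr p (fun X : {set {set 'I_n}} => ~~ good_family M K3 C0 c eps q K X).
  rewrite -PrC -{2}cE.
  exact: (@Pr_not_and n (good_family M K3 C0 c eps q K)
    (fun X => good_family M K3 C0 c eps q K (cpl X))).
apply: (complement_bound H); rewrite -(ler_pM2r nR); apply: le_trans bad _.
by apply: half_mul; rewrite -ler_pdivrMr.
Qed.

(** The order of choice avoids circularity: [g] is absolute, [M], [K3] and [c] depend on p, then
    come [eps], [C0] from [eps], [e0], and finally [e1] and [K] from [e0]. *)
Lemma middle_layers_whp (e : R) : 0 < e -> exists n0, forall n, (n0 <= n)%N ->
  1 - e <= Pr p (fun X : {set {set 'I_n}} => middle_layers X).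
Proof.
move=> e_gt0; have p0 : 0 < p by move: p34; lra.
have [g [g0 g1 Gmid]] := exists_Gam_const.
have [M0 hM0] := Pr_good_deg p34 p1.
have [M [M20 MM0]] : exists M, (20 <= M)%N /\ (M0 <= M)%N.
  by exists (maxn M0 20); rewrite leq_maxr leq_maxl.
have Mp : (0 < M)%N by apply: leq_trans M20.
have MR : 20 <= M%:R :> R by rewrite ler_nat.
have [nd hd] := hM0 M MM0.
have [K3 [np hp]] := Pr_good_path p34 p1 Mp.
have [c [c0 c1 hp']] : exists c : R, [/\ 0 < c, c <= 1 & forall n, (np <= n)%N -> forall k,
    Pr p (fun X : {set {set 'I_n}} => ~~ good_path M K3 c k X) * n%:R ^+ 2 <= 1].
  have M4 : 0 < 4 * M%:R :> R by rewrite mulr_gt0 // ltr0n.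
  exists (p ^+ 4 / (4 * M%:R)); split => //; first by rewrite divr_gt0 // exprn_gt0.
  rewrite ler_pdivrMr // mul1r (@le_trans _ _ 1) //; first by rewrite exprn_ile1 // ltW.
  by rewrite -natrM ler1n muln_gt0.
have pg0 : 0 < p * g by exact: mulr_gt0.
have pg1 : p * g <= 1 by rewrite mulr_ile1 // ltW.
have pgc0 : 0 < p * g * c by exact: mulr_gt0.
have pgc1 : p * g * c <= 1 by rewrite mulr_ile1 // ltW.
have [eps [eps0 eps1 epsc epsM]] := exists_eps pgc0 pgc1 MR.
have [C0 [C00 [nb hb]]] := Pr_good_bad p34 p1 eps0 eps1.
have d0 : 0 < 6144 / (p * g * c) by rewrite divr_gt0.
have [e0 [e00 e01 hodd]] := exists_e0 d0.
have [e1 [K [[e10 e11 K0] [hK1 hK2 hK3]]]] := exists_e1K e00 e01 pg0 pg1.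
rewrite mulrA in hK2; rewrite (mulrA e1) in hK3.
exact: (middle_layers_of_parameters e_gt0 g0 c0 M20 eps0 eps1 epsc epsM C00 e00 hodd
  e10 e11 K0 hK1 hK2 hK3 Gmid hd hp' hb).
Qed.

End GoodFamilies.

From mathcomp Require Import all_boot all_order all_algebra.
From mathcomp Require Import all_classical all_reals all_analysis.
Import GRing.Theory Num.Theory.
Import numFieldNormedType.Exports.
Local Open Scope classical_set_scope.
Local Open Scope ring_scope.

Theorem theorem1p1 (R : realType) (p : R) (p_gt : 3 / 4 < p) (p_le1 : p <= 1) :
  (fun n : nat => Pr p (fun X : {set {set 'I_n}} =>
     [forall F : {set {set 'I_n}}, maximum_antichain X F ==>
        (F == X :&: layer n n./2) || (F == X :&: layer n (uphalf n))]
     && (width X == maxn #|X :&: layer n n./2| #|X :&: layer n (uphalf n)|)))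
  @ \oo --> (1 : R).
Proof.
apply/cvgrPdist_le => e e_gt0.
have [n0 whp] := middle_layers_whp p_gt p_le1 e_gt0.
have p_ge0 : 0 <= p by apply: ltW; apply: lt_trans p_gt; rewrite divr_gt0.
exists n0 => //= n /= /whp low.
have up : Pr p (@middle_layers n) <= 1.
  by rewrite -(Pr_total n p); apply: (Pr_mono p_ge0 p_le1).
rewrite ger0_norm ?subr_ge0 //.
by rewrite lerBlDr addrC -lerBlDr.
Qed.
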